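(* Fix a compact set $B\subset\mathscr R_{\mathrm{Kaw}}$. There exist constants $C_B<\infty$, $c_B>0$ and $n_0=n_0(B)<\infty$ such that, uniformly over $(p,\beta)\in B$, for every $n\ge n_0$ with $k=Np\in\mathbb Z$ and every bounded $f:\Omega_k\to\mathbb R$, \[ \operatorname{Var}_{\mu_\beta^k}(f)\le C_Bn^2\,\mathcal E_P(f,f)+C_Be^{-c_Bn}\|f\|_\infty^2, \] where \[ \mathcal E_P(f,f)=\frac12\sum_{x,y\in\Omega_k}\mu_\beta^k(x)P(x,y)\big(f(y)-f(x)\big)^2 . \]
   Context: Parameter region: for $p\in(0,1)$ let $c_p=\frac{\log(p/(1-p))}{2p-1}$ if $p\ne\frac12$ and $c_{1/2}=2$. $\mathscr R_{\mathrm{Kaw}}=\{(p,\beta):0<p<1,\ 0\le\beta<c_p,\ 4\beta p(1-p)<\tfrac12\}$. Model: $\mathcal I=\binom{[n]}{2}$ is the set of $N=n(n-1)/2$ edge-positions; a simple graph on $[n]$ is identified with $X\in\{0,1\}^{\mathcal I}$. $\Omega_k=\{X\in\{0,1\}^{\mathcal I}:\sum_eX_e=k\}$, where throughout $k=Np$ is an integer. $\mathcal H_\beta(X)=\frac{2\beta}{n}\sum_{v=1}^n\binom{\deg_X(v)}{2}$ and $\mu_\beta^k(X)=e^{\mathcal H_\beta(X)}/\sum_{Y\in\Omega_k}e^{\mathcal H_\beta(Y)}$ for $X\in\Omega_k$. Full (global) Kawasaki kernel $P$ on $\Omega_k$: for $x\in\Omega_k$, $s$ with $x_s=1$ and $t$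 with $x_t=0$, let $x^{s\leftrightarrow t}$ be obtained by deleting edge $s$ and adding edge $t$; for $y=x^{s\leftrightarrow t}$, $P(x,y)=\frac1{k(N-k)}\frac{\mu_\beta^k(y)}{\mu_\beta^k(x)+\mu_\beta^k(y)}$; $P(x,y)=0$ for all other $y\ne x$, and $P(x,x)=1-\sum_{y\ne x}P(x,y)$. *)

(* Defs.v *)
From HB Require Import structures.
From mathcomp Require Import all_boot all_order all_algebra.
From mathcomp Require Import all_classical all_reals all_analysis.

Set Implicit Arguments.
Unset Strict Implicit.
Unset Printing Implicit Defensive.

Import Order.TTheory GRing.Theory Num.Theory.
Import numFieldNormedType.Exports.

Local Open Scope classical_set_scope.
Local Open Scope ring_scope.

Definition c_kaw (R : realType) (p : R) : R :=
  if p == 2^-1 then 2 else ln (p / (1 - p)) / (2 * p - 1).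

Definition R_kaw (R : realType) : set (R * R) :=
  [set q | [/\ 0 < q.1 < 1, 0 <= q.2 < c_kaw q.1
             & 4 * q.2 * q.1 * (1 - q.1) < 2^-1]].

Definition edge (n : nat) := {e : {set 'I_n} | #|e| == 2%N}.
HB.instance Definition _ (n : nat) := SubFinite.on (edge n).

Definition graph (n : nat) := {ffun edge n -> bool}.
HB.instance Definition _ (n : nat) := Finite.on (graph n).

Definition nb_edges (n : nat) : nat := 'C(n, 2).

Lemma card_edge (n : nat) : #|{: edge n}| = nb_edges n.
Proof.
rewrite card_sig /nb_edges -[in RHS](card_ord n) -card_draws.
by apply: eq_card => e; rewrite !inE.
Qed.

Definition Omega (n k : nat) := {x : graph n | (\sum_e x e)%N == k}.
HB.instance Definition _ (n k : nat) := SubFinite.on (Omega n k).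

Definition deg (n : nat) (x : graph n) (v : 'I_n) : nat :=
  #|[set e : edge n | x e && (v \in val e)]%SET|.

Definition hamiltonian (R : realType) (n : nat) (beta : R) (x : graph n) : R :=
  2 * beta / n%:R * \sum_(v < n) 'C(deg x v, 2)%:R.

Definition gibbs (R : realType) (n k : nat) (beta : R) (x : Omega n k) : R :=
  expR (hamiltonian beta (val x))
  / \sum_(y : Omega n k) expR (hamiltonian beta (val y)).

Definition swap (n : nat) (x : graph n) (s t : edge n) : graph n :=
  [ffun e => if e == s then false else if e == t then true else x e].

Definition swap_neighbor (n : nat) (x y : graph n) : bool :=
  [exists s : edge n, exists t : edge n, [&& x s, ~~ x t & y == swap x s t]].

Definition kawasaki_off (R : realType) (n k : nat) (beta : R)
    (x y : Omega n k) : R :=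
  if swap_neighbor (val x) (val y) then
    (k%:R * ((nb_edges n)%:R - k%:R))^-1
    * (gibbs beta y / (gibbs beta x + gibbs beta y))
  else 0.

Definition kawasaki (R : realType) (n k : nat) (beta : R)
    (x y : Omega n k) : R :=
  if y == x then 1 - \sum_(z : Omega n k | z != x) kawasaki_off beta x z
  else kawasaki_off beta x y.

Definition mean (R : realType) (T : finType) (mu : T -> R) (f : T -> R) : R :=
  \sum_x mu x * f x.

Definition var (R : realType) (T : finType) (mu : T -> R) (f : T -> R) : R :=
  mean mu (fun x => (f x - mean mu f) ^+ 2).

Definition dirichlet (R : realType) (T : finType) (mu : T -> R)
    (P : T -> T -> R) (f : T -> R) : R :=
  2^-1 * \sum_x \sum_y mu x * P x y * (f y - f x) ^+ 2.

Definition sup_norm (R : realType) (T : Type) (f : T -> R) : R :=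
  sup (range (fun x => `|f x|)).

(* Main.v *)
(* Let z_v be the deviation of deg(v) from p (n - 1). On Omega_k the Hamiltonian is
   (beta / n) sum_v z_v ^ 2 up to a constant. Replace z ^ 2 by a Huber function that
   is linear beyond eps n: then a swap changes the energy by O(eps), so all rates
   are close to 1/2, and path coupling contracts as soon as 4 beta p (1 - p) < 1/2.
   A self-adjoint contraction has a gap of the same order, whence a Poincare
   inequality with constant O(n ^ 2) for the truncated measure.
   The truncated weights are below the true ones and the conductances are monotone
   in the weights, so only the probability that some |z_v| > eps n is lost. It is
   exponentially small. First, sum_v |z_v| <= delta n ^ 2 outside an event of probability
   exp (- c n ^ 2), by a union bound over degree sequences: since sum_v z_v = 0, the
   Kearns--Saul inequality, whose constant is c_p, gives a sequence the uniform
   weight at most exp (- c_p |z| ^ 2 / n), against the energy beta |z| ^ 2 / n.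
   Next, on this event, swapping edges at v with edges away from v shows that
   deg(v), apart from its own energy, is distributed as under the uniform measure up
   to a factor exp (O(delta n)), and beta < c_p concludes as before. *)

(* Origin of the threshold: at two configurations one exchange apart, the roughly N moves sharing an
   edge position with that exchange coalesce, at rates close to 1/2; the other moves disagree in
   rate by at most a quarter of a mixed second difference of the energy, which sums to about 4 beta
   p (1 - p) N. For the true energy both counts break down: a large z_v makes rates extreme, and the
   moves meeting v number N (2 p (1 - p) (n - 1) + (1 - 2 p) z_v). The linear tail cures both, since
   its second differences vanish at such vertices. The same c_p serves for one degree and for the
   whole sequence because the sum over edges uv of (l_u + l_v)^2 is at most n |l|^2 + (sum l)^2,
   whose last term vanishes for a tilt l proportional to z. Two stages are needed because a union
   bound over exp O(n log n) degree sequences detects only events of cost above n log n, such as a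
   total deviation of order n^2, while one bad vertex costs only order n. *)
Require Import Defs.
From mathcomp Require Import all_boot all_order all_algebra.
From mathcomp Require Import all_classical all_reals all_analysis.
From mathcomp Require Import ring lra zify.

Set Implicit Arguments.
Unset Strict Implicit.
Unset Printing Implicit Defensive.

Import Order.TTheory GRing.Theory Num.Theory.
Import numFieldNormedType.Exports.

Local Open Scope classical_set_scope.
Local Open Scope ring_scope.

(** * Logistic function and the Kearns--Saul inequality *)

Definition logistic (R : realType) (x : R) : R := (1 + expR (- x))^-1.

Lemma MVT_global (R : realType) (f df : R -> R) (a b : R) :
  (forall x : R, is_derive x 1 f (df x)) -> a <= b ->
  exists c, [/\ a <= c, c <= b & f b - f a = df c * (b - a)].
Proof.
move=> fdf ab.
have [c cab E] := @MVT_segment R f df a b ab (fun x _ => fdf x)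
  (derivable_within_continuous (fun x _ => @ex_derive _ _ _ _ _ _ _ (fdf x))).
by exists c; move: cab; rewrite in_itv /= => /andP[].
Qed.

Lemma logistic_gt0 (R : realType) (x : R) : 0 < logistic x.
Proof. by rewrite invr_gt0 addr_gt0 ?expR_gt0. Qed.

Lemma logistic_lt1 (R : realType) (x : R) : logistic x < 1.
Proof. by rewrite invf_lt1 ?addr_gt0 ?expR_gt0 // ltrDl expR_gt0. Qed.

Lemma logisticN (R : realType) (x : R) : logistic (- x) = 1 - logistic x.
Proof.
rewrite /logistic opprK expRN.
have := expR_gt0 x; move: (expR x) => e e0.
by field; rewrite !gt_eqF //; lra.
Qed.

(** The acceptance probability of a Kawasaki move is thus the logistic function of the energy
    difference, free of the partition function. *)
Lemma logistic_expR (R : realType) (a b : R) :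
  expR b / (expR a + expR b) = logistic (b - a).
Proof.
rewrite /logistic opprB expRD expRN.
have := expR_gt0 a; have := expR_gt0 b; move: (expR a) (expR b) => u v v0 u0.
by field; rewrite !gt_eqF //; lra.
Qed.

Lemma is_derive_logistic (R : realType) (x : R) :
  is_derive x 1 (@logistic R) (logistic x * (1 - logistic x)).
Proof.
have n0 : 1 + expR (- x) != 0 by rewrite gt_eqF // addr_gt0 ?expR_gt0.
have H : is_derive x (1 : R) (fun y : R => 1 + expR (- y)) (- expR (- x)).
  have -> : - expR (- x) = 0 + expR (- x) * - 1 by rewrite add0r mulrN1.
  exact: (@is_deriveD R R R (cst (1 : R)) (fun y => expR (- y))).
have := @is_deriveV R (fun y => 1 + expR (- y)) x _ _ n0 H.
rewrite /logistic; have -> // : (- (1 + expR (- x)) ^- 2) *: (- expR (- x)) =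
   (1 + expR (- x))^-1 * (1 - (1 + expR (- x))^-1).
by rewrite /GRing.scale /=; move: (expR (-x)) n0 => e n0; field.
Qed.

Lemma logistic_lip (R : realType) (a b : R) : `|logistic a - logistic b| <= 4^-1 * `|a - b|.
Proof.
wlog ab : a b / b <= a.
  move=> H; case: (leP b a) => [/H //|/ltW /H].
  by rewrite distrC (distrC b).
have [c [_ _ ->]] := MVT_global (@is_derive_logistic R) ab.
rewrite normrM ler_wpM2r // ger0_norm; first by have := sqr_ge0 (logistic c - 2^-1); nra.
by rewrite mulr_ge0 ?(ltW (logistic_gt0 _)) // subr_ge0 ltW ?logistic_lt1.
Qed.

Lemma logistic0 (R : realType) : logistic 0 = 2^-1 :> R.
Proof. by rewrite /logistic oppr0 expR0. Qed.

Lemma logistic_ge_half (R : realType) (x : R) : 0 <= x -> 2^-1 <= logistic x.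
Proof.
move=> x0; rewrite -logistic0 -subr_ge0.
have [c [_ _ ->]] := MVT_global (@is_derive_logistic R) x0.
by rewrite !mulr_ge0 ?subr_ge0 ?(ltW (logistic_gt0 _)) // ltW // logistic_lt1.
Qed.

Lemma logistic_mono (R : realType) (x y : R) : x <= y -> logistic x <= logistic y.
Proof.
move=> xy; rewrite -subr_ge0; have [c [_ _ ->]] := MVT_global (@is_derive_logistic R) xy.
by rewrite !mulr_ge0 ?subr_ge0 ?(ltW (logistic_gt0 _)) // ltW // logistic_lt1.
Qed.

(* [logistic' = logistic (1 - logistic)] decreases on [0, +oo[, so [logistic] is concave there. *)
Lemma logistic_slope (R : realType) (x y : R) : 0 <= x -> x <= y ->
  (logistic y - 2^-1) * x <= (logistic x - 2^-1) * y.
Proof.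
move=> x0 xy.
have [c [c0 cx E1]] := MVT_global (@is_derive_logistic R) x0.
have [d [xd dy E2]] := MVT_global (@is_derive_logistic R) xy.
move: E1; rewrite logistic0 subr0 => E1.
have cd := logistic_mono (le_trans cx xd).
have := logistic_ge_half c0; move: (logistic c) (logistic d) cd E1 E2 => u v uv E1 E2 hu.
have -> : logistic y - 2^-1 = u * (1 - u) * x + v * (1 - v) * (y - x) by lra.
rewrite E1.
have : v * (1 - v) <= u * (1 - u) by nra.
have : 0 <= x * (y - x) by nra.
by move: (u * (1 - u)) (v * (1 - v)) => A B; nra.
Qed.

Definition softplus (R : realType) (x : R) : R := ln (1 + expR x).

Lemma is_derive_softplus (R : realType) (x : R) :
  is_derive x 1 (@softplus R) (logistic x).
Proof.
have n0 : 0 < 1 + expR x by rewrite addr_gt0 ?expR_gt0.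
have H : is_derive x (1 : R) (fun y : R => 1 + expR y) (expR x).
  rewrite -[X in is_derive _ _ _ X]add0r.
  exact: (@is_deriveD R R R (cst (1 : R)) expR x 1 _ _ (is_derive_cst _ _ _) (is_derive_expR x)).
have := @is_derive1_comp R (@ln R) (fun y : R => 1 + expR y) x _ _ (is_derive1_ln n0) H.
have -> // : (1 + expR x)^-1 * expR x = logistic x.
have := logistic_expR 0 x; rewrite subr0 expR0 => <-; exact: mulrC.
Qed.

(* The even function [ln (2 cosh (x / 2))]. *)
Definition logcosh (R : realType) (x : R) : R := softplus x - 2^-1 * x.

Lemma logcoshN (R : realType) (x : R) : logcosh (- x) = logcosh x.
Proof.
rewrite /logcosh /softplus.
have -> : 1 + expR x = expR x * (1 + expR (- x)).
  by rewrite mulrDr mulr1 -expRD subrr expR0 addrC.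
rewrite lnM ?posrE ?expR_gt0 ?addr_gt0 ?expR_gt0 // expRK; lra.
Qed.

(* The Jaakkola--Jordan bound: [logcosh] is a concave function of [x ^ 2]. *)
Lemma logcosh_parabola (R : realType) (L k : R) : 0 <= L ->
  (forall x : R, 0 <= x -> x <= L -> 2 * k * x <= logistic x - 2^-1) ->
  (forall x : R, L <= x -> logistic x - 2^-1 <= 2 * k * x) ->
  forall x : R, logcosh x <= logcosh L + k * (x ^+ 2 - L ^+ 2).
Proof.
move=> L0 lo hi.
suff H x : 0 <= x -> logcosh x <= logcosh L + k * (x ^+ 2 - L ^+ 2).
  move=> x; case: (leP 0 x) => [/H //|x0].
  by rewrite -logcoshN -[in X in _ <= X]sqrrN; apply: H; lra.
move=> x0.
pose F (y : R) := softplus y - (2^-1 * y + k * y ^+ 2).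
have dF (y : R) : is_derive y (1 : R) F (logistic y - (2^-1 + 2 * k * y)).
  have D1 : is_derive y (1 : R) (fun z : R => 2^-1 * z + k * z ^+ 2) (2^-1 + 2 * k * y).
    have D := @is_deriveD R R R (fun z => 2^-1 *: z) (fun z => k *: (z * z)) y 1
      (2^-1 *: 1) (k *: (y *: 1 + y *: 1)).
    have -> : 2^-1 + 2 * k * y = 2^-1 *: 1 + k *: (y *: 1 + y *: 1).
      by rewrite /GRing.scale /=; lra.
    exact: D.
  exact: is_deriveB (is_derive_softplus y) D1.
have -> : logcosh x = F x + k * x ^+ 2 by rewrite /F /logcosh; ring.
suff : F x <= F L by rewrite /F /logcosh; lra.
case: (leP x L) => [xL|/ltW Lx].
  have [c [xc cL E]] := MVT_global dF xL.
  rewrite -subr_ge0 E mulr_ge0 ?subr_ge0 //.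
  have := lo c (le_trans x0 xc) cL; lra.
have [c [xc cL E]] := MVT_global dF Lx.
rewrite -subr_le0 E mulr_le0_ge0 ?subr_ge0 //.
have := hi c xc; lra.
Qed.

(** The cumulant generating function of the centred Bernoulli law of mean [logistic L] is [softplus
    (L + l) - softplus L - logistic L * l]. When [logcosh] at [L + l] is bounded by the parabola
    touching it at [L], the terms linear in [l] cancel by the tangency condition on [k], leaving
    [k * l ^+ 2]. *)
Lemma bernoulli_mgf_parabola (R : realType) (L k l : R) : 0 <= L ->
  2 * k * L = logistic L - 2^-1 ->
  (forall x : R, 0 <= x -> x <= L -> 2 * k * x <= logistic x - 2^-1) ->
  (forall x : R, L <= x -> logistic x - 2^-1 <= 2 * k * x) ->
  logistic L * expR ((1 - logistic L) * l) + (1 - logistic L) * expR (- (logistic L * l))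
    <= expR (k * l ^+ 2).
Proof.
move=> L0 kL lo hi.
have := logcosh_parabola L0 lo hi (L + l).
have E : logistic L * expR ((1 - logistic L) * l) + (1 - logistic L) * expR (- (logistic L * l)) =
   expR (softplus (L + l) - softplus L - logistic L * l).
  have := logistic_expR 0 L; rewrite subr0 expR0.
  move: (logistic L) => s Es.
  rewrite mulrBl mul1r !expRD !expRN !lnK ?posrE ?addr_gt0 ?expR_gt0 // expRD.
  have := expR_gt0 L; have := expR_gt0 (s * l); move: (expR L) (expR (s * l)) Es => e A <- A0 e0.
  by field; rewrite !gt_eqF ?addr_gt0 ?mulr_gt0 ?invr_gt0.
rewrite E ler_expR /logcosh => H.
have -> : logistic L = 2 * k * L + 2^-1 by lra.
nra.
Qed.

Lemma bernoulli_mgf_ge_half (R : realType) (p K l : R) :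
  2^-1 <= p -> p < 1 -> 0 < K -> K <= c_kaw p ->
  p * expR ((1 - p) * l) + (1 - p) * expR (- (p * l)) <= expR (l ^+ 2 / (4 * K)).
Proof.
move=> p2 p1 K0 Kc.
have p0 : 0 < p by lra.
pose L := ln (p / (1 - p)).
have pL : logistic L = p.
  rewrite /logistic expRN lnK ?posrE ?divr_gt0 ?subr_gt0 // invf_div.
  by field; rewrite subrKC oner_eq0 gt_eqF.
have L0 : 0 <= L.
  by rewrite ln_ge0 // ler_pdivlMr ?subr_gt0 //; lra.
(* The parabola tangent at the log-odds [L] has [k = (2 * p - 1) / (4 * L) = (4 * c_kaw p)^-1]. At
   [p = 1/2], where [L = 0] and tangency holds for every [k], the limit value 1/8 is taken, and the
   slope bound is the Lipschitz constant 1/4 of [logistic]. *)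
have [k [kK kL klo khi]] : exists k, [/\ k <= (4 * K)^-1, 2 * k * L = logistic L - 2^-1,
    forall x : R, 0 <= x -> x <= L -> 2 * k * x <= logistic x - 2^-1 &
    forall x : R, L <= x -> logistic x - 2^-1 <= 2 * k * x].
  have [E|pn] := eqVneq p 2^-1.
    have Lz : L = 0.
      rewrite /L E; have -> : 1 - 2^-1 = 2^-1 :> R by lra.
      by rewrite divff ?ln1 // invr_eq0 pnatr_eq0.
    exists 8^-1; rewrite Lz logistic0; split.
    - move: Kc; rewrite /c_kaw E eqxx => K2.
      rewrite lef_pV2 ?posrE; lra.
    - lra.
    - move=> x x0 x1; have -> : x = 0 by apply/le_anti; rewrite x1 x0.
      by rewrite mulr0 logistic0 subrr.
    - move=> x x0; have := logistic_lip x 0; rewrite logistic0 subr0 !ger0_norm //; first lra.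
      by rewrite subr_ge0 logistic_ge_half.
  have L1 : 0 < L by rewrite ln_gt0 // ltr_pdivlMr ?subr_gt0 // mul1r; move: p2; rewrite le_eqVlt eq_sym (negbTE pn) /=; lra.
  exists ((2 * p - 1) / (4 * L)); rewrite pL; split.
  - move: Kc; rewrite /c_kaw (negbTE pn) -/L => Kc.
    have p3 : 0 < 2 * p - 1 by move: p2; rewrite le_eqVlt eq_sym (negbTE pn) /=; lra.
    move: Kc; rewrite ler_pdivlMr // => Kc.
    rewrite ler_pdivrMr ?mulr_gt0 // [leRHS]mulrC ler_pdivlMr ?mulr_gt0 //; lra.
  - by field; rewrite gt_eqF.
  - move=> x x0 xL; have := logistic_slope x0 xL; rewrite pL => H.
    have -> : 2 * ((2 * p - 1) / (4 * L)) * x = (p - 2^-1) * x / L by field; rewrite gt_eqF.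
    by rewrite ler_pdivrMr.
  - move=> x Lx; have := logistic_slope L0 Lx; rewrite pL => H.
    have -> : 2 * ((2 * p - 1) / (4 * L)) * x = (p - 2^-1) * x / L by field; rewrite gt_eqF.
    by rewrite ler_pdivlMr.
have := bernoulli_mgf_parabola l L0 kL klo khi; rewrite pL => /le_trans; apply.
by rewrite ler_expR mulrC ler_wpM2l ?sqr_ge0.
Qed.

Lemma c_kawN (R : realType) (p : R) : 0 < p < 1 -> c_kaw (1 - p) = c_kaw p.
Proof.
move=> /andP[p0 p1]; rewrite /c_kaw.
have -> : (1 - p == 2^-1) = (p == 2^-1).
  by apply/eqP/eqP; lra.
case: eqP => // /eqP pn.
have n2 : 2 * p - 1 != 0 by apply: contra pn => /eqP ?; apply/eqP; lra.
have -> : (1 - p) / (1 - (1 - p)) = (p / (1 - p))^-1.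
  by rewrite invf_div; congr (_ / _); ring.
rewrite lnV ?posrE ?divr_gt0 ?subr_gt0 //.
have -> : 2 * (1 - p) - 1 = - (2 * p - 1) by ring.
by rewrite invrN mulrNN.
Qed.

(* The Kearns--Saul inequality: [c_kaw p] is the best sub-Gaussian constant of
   the Bernoulli([p]) law. *)
Lemma bernoulli_mgf (R : realType) (p K l : R) :
  0 < p < 1 -> 0 < K -> K <= c_kaw p ->
  p * expR ((1 - p) * l) + (1 - p) * expR (- (p * l)) <= expR (l ^+ 2 / (4 * K)).
Proof.
move=> p01 K0 Kc; have /andP[p0 p1] := p01.
case: (leP 2^-1 p) => [p2|p2]; first exact: bernoulli_mgf_ge_half.
have H : p * expR ((1 - p) * l) + (1 - p) * expR (- (p * l)) =
    (1 - p) * expR ((1 - (1 - p)) * - l) + (1 - (1 - p)) * expR (- ((1 - p) * - l)).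
  by rewrite subKr !mulrN opprK addrC.
rewrite H -(sqrrN l); apply: bernoulli_mgf_ge_half => //; try lra.
by rewrite c_kawN.
Qed.

(** * Lower semicontinuity of [c_kaw] and uniform margins on compact sets *)

(** For the log-odds [L] of [q > 1/2], the Lipschitz constant 1/4 of [logistic] gives
    [q - 1/2 <= L / 4]. This global bound by the value at 1/2 stands in for a limit at that
    removable singularity. *)
Lemma c_kaw_ge2 (R : realType) (p : R) : 0 < p < 1 -> 2 <= c_kaw p.
Proof.
have H (q : R) : 2^-1 < q -> q < 1 -> 2 <= c_kaw q.
  move=> q2 q1; rewrite /c_kaw gt_eqF // ler_pdivlMr; last by lra.
  have q0 : 0 < q by lra.
  set L := ln _.
  have sL : logistic L = q.
    rewrite /logistic expRN lnK ?posrE ?divr_gt0 ?subr_gt0 // invf_div.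
    by field; rewrite subrKC oner_eq0 gt_eqF.
  have L0 : 0 <= L by rewrite ln_ge0 // ler_pdivlMr ?subr_gt0 //; lra.
  have := logistic_lip L 0; rewrite sL logistic0 subr0 !ger0_norm //; lra.
move=> /andP[p0 p1]; have [p2|p2|p2] := ltgtP 2^-1 p.
- exact: H.
- by rewrite -c_kawN ?p0 //; apply: H; lra.
- by rewrite /c_kaw -p2 eqxx.
Qed.

Lemma cvg_c_kaw (R : realType) (p0 : R) : 0 < p0 < 1 -> p0 != 2^-1 ->
  ln (p / (1 - p)) / (2 * p - 1) @[p --> p0] --> c_kaw p0.
Proof.
move=> /andP[p00 p01] pn; rewrite /c_kaw (negbTE pn).
have c1 : (1 - p) @[p --> p0] --> 1 - p0 by apply: cvgB; [exact: cvg_cst|exact: cvg_id].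
apply: cvgM.
  have /continuous_cvg : {for p0 / (1 - p0), continuous (@ln R)}.
    by apply: continuous_ln; rewrite divr_gt0 // subr_gt0.
  apply; apply: cvgM; first exact: cvg_id.
  by apply: cvgV => //; rewrite subr_eq0 gt_eqF.
apply: cvgV.
  by apply: contra pn => /eqP ?; apply/eqP; lra.
apply: cvgB; last exact: cvg_cst.
by apply: cvgM; [exact: cvg_cst|exact: cvg_id].
Qed.

(** Lower semicontinuity, the half of continuity that keeps [beta < c_kaw p] true nearby. At 1/2 it
    comes from the global minimum, elsewhere from continuity of the quotient. *)
Lemma c_kaw_lower (R : realType) (p0 z : R) : 0 < p0 < 1 -> z < c_kaw p0 ->
  \forall p \near p0, z < c_kaw p.
Proof.
move=> p01 zc; have /andP[p00 p1] := p01.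
have [pE|pn] := eqVneq p0 2^-1.
  have p_gt0 : \forall p \near p0, 0 < p by exact: (cvgr_gt p0 cvg_id).
  have p_lt1 : \forall p \near p0, p < 1 by exact: (cvgr_lt p0 cvg_id).
  near=> p; apply: (@lt_le_trans _ _ 2).
    by move: zc; rewrite /c_kaw pE eqxx.
  by apply: c_kaw_ge2; apply/andP; split; near: p.
have pn' : \forall p \near p0, p != 2^-1.
  have := pn; rewrite neq_lt => /orP[h|h].
    have h' : \forall p \near p0, p < 2^-1 by exact: (cvgr_lt p0 cvg_id).
    by near=> p; rewrite lt_eqF //; near: p.
  have h' : \forall p \near p0, 2^-1 < p by exact: (cvgr_gt p0 cvg_id).
  by near=> p; rewrite gt_eqF //; near: p.
have := cvgr_gt _ (cvg_c_kaw p01 pn) _ zc => H.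
near=> p; rewrite /c_kaw ifN; last by near: p.
by near: p; exact: H.
Unshelve. all: by end_near.
Qed.

(** Each strict inequality of the region holds with some margin near every point of [B]; the
    near-covering form of compactness makes one margin serve all of [B]. Every later constant
    depends on [B] through [eta] alone. *)
Lemma compact_margin (R : realType) (B : set (R * R)) :
  compact B -> B `<=` @R_kaw R ->
  exists eta : R, 0 < eta /\ forall p beta, B (p, beta) ->
    [/\ eta <= p, p <= 1 - eta, 0 <= beta, beta + eta <= c_kaw p &
        4 * beta * p * (1 - p) <= 2^-1 - eta].
Proof.
move=> /compact_near_coveringP Bc Bsub.
pose P (e : R) (q : R * R) := [/\ e <= q.1, q.1 <= 1 - e, q.2 + e <= c_kaw q.1 &
        4 * q.2 * q.1 * (1 - q.1) <= 2^-1 - e].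
have near_P : \forall e \near (0 : R)^'+, B `<=` P e.
  apply: Bc => -[p0 b0] /Bsub [] /= p01 /andP[b00 b0c] b0p.
  have /andP[p00 p1] := p01.
  (* The distance to [c_kaw p0] is split in three: one share for the variation of [beta], one for
     that of [c_kaw], one for the margin. *)
  pose s := (c_kaw p0 - b0) / 3.
  have s0 : 0 < s by rewrite divr_gt0 // subr_gt0.
  pose r := (2^-1 - 4 * b0 * p0 * (1 - p0)) / 2.
  have r0 : 0 < r by rewrite divr_gt0 // subr_gt0.
  have c1 : q.1 @[q --> (p0, b0)] --> p0 by exact: cvg_fst.
  have c2 : q.2 @[q --> (p0, b0)] --> b0 by exact: cvg_snd.
  have n1 : \forall q \near (p0, b0), p0 / 2 < q.1 by apply: (cvgr_gt p0 c1); lra.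
  have n2 : \forall q \near (p0, b0), q.1 < (1 + p0) / 2 by apply: (cvgr_lt p0 c1); lra.
  have n3 : \forall q \near (p0, b0), q.2 < b0 + s by apply: (cvgr_lt b0 c2); lra.
  have n4 : \forall q \near (p0, b0), c_kaw p0 - s < c_kaw q.1.
    have zl : c_kaw p0 - s < c_kaw p0 by lra.
    exact: c1 (c_kaw_lower p01 zl).
  have c5 : 4 * q.2 * q.1 * (1 - q.1) @[q --> (p0, b0)] --> 4 * b0 * p0 * (1 - p0).
    apply: cvgM; last by apply: cvgB => //; exact: cvg_cst.
    by apply: cvgM => //; apply: cvgM => //; exact: cvg_cst.
  have n5 : \forall q \near (p0, b0), 4 * q.2 * q.1 * (1 - q.1) < 2^-1 - r.
    by apply: (cvgr_lt _ c5); rewrite /r; lra.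
  have m0 : 0 < Num.min (Num.min (p0 / 2) ((1 - p0) / 2)) (Num.min s r).
    by rewrite !lt_min s0 r0 !divr_gt0 // subr_gt0.
  exists ([set q | [/\ p0 / 2 < q.1, q.1 < (1 + p0) / 2, q.2 < b0 + s,
      c_kaw p0 - s < c_kaw q.1 & 4 * q.2 * q.1 * (1 - q.1) < 2^-1 - r]],
      [set e | e < Num.min (Num.min (p0 / 2) ((1 - p0) / 2)) (Num.min s r)]).
    split => /=; last exact: nbhs_right_lt.
    by near=> q; split; near: q.
  move=> [[q1 q2] e] /= [[a1 a2 a3 a4 a5]]; rewrite !lt_min => /andP[/andP[e1 e2] /andP[e3 e4]].
  have sE : c_kaw p0 = b0 + 3 * s by rewrite /s; lra.
  by split => /=; lra.
have pos : \forall e \near (0 : R)^'+, 0 < e by exact: nbhs_right_gt.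
have [e [e0 He]] := filter_ex (filterI pos near_P).
exists e; split => // p beta pB; have [h1 h2 h3 h4] := He _ pB.
by split => //; have [_ /andP[]] := Bsub _ pB.
Unshelve. all: by end_near.
Qed.

(** * Exchanging edges *)

Definition has_size (E : finType) (k : nat) (x : {ffun E -> bool}) : bool := (\sum_e x e)%N == k.

Definition exch (E : finType) (x : {ffun E -> bool}) (s t : E) : {ffun E -> bool} :=
  [ffun e => if e == s then false else if e == t then true else x e].

Lemma exchE (E : finType) (x : {ffun E -> bool}) (s t e : E) :
  exch x s t e = if e == s then false else if e == t then true else x e.
Proof. by rewrite ffunE. Qed.

Lemma exch_at1 (E : finType) (x : {ffun E -> bool}) (s t : E) : exch x s t s = false.
Proof. by rewrite ffunE eqxx. Qed.

Lemma exch_at2 (E : finType) (x : {ffun E -> bool}) (s t : E) : s != t -> exch x s t t = true.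
Proof. by move=> st; rewrite ffunE eq_sym (negbTE st) eqxx. Qed.

Lemma exch_other (E : finType) (x : {ffun E -> bool}) (s t e : E) :
  e != s -> e != t -> exch x s t e = x e.
Proof. by move=> es et; rewrite ffunE (negbTE es) (negbTE et). Qed.

Lemma exch_neq (E : finType) (x : {ffun E -> bool}) (s t : E) : x s -> ~~ x t -> s != t.
Proof. by move=> xs; apply: contraNneq => <-. Qed.

Lemma exchK (E : finType) (x : {ffun E -> bool}) (s t : E) :
  x s -> ~~ x t -> exch (exch x s t) t s = x.
Proof.
move=> xs xt; apply/ffunP => e; rewrite !ffunE.
case: (eqVneq e t) => [->|et]; first by rewrite (negbTE xt).
by case: (eqVneq e s) => [->|//]; rewrite xs.
Qed.

Lemma exchC (E : finType) (x : {ffun E -> bool}) (a b s t : E) :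
  a != s -> a != t -> b != s -> b != t ->
  exch (exch x a b) s t = exch (exch x s t) a b.
Proof.
move=> as_ at_ bs bt; apply/ffunP => e; rewrite !ffunE.
case: (eqVneq e s) => [->|es]; first by rewrite eq_sym (negbTE as_) eq_sym (negbTE bs).
by case: (eqVneq e t) => [->|//]; rewrite eq_sym (negbTE at_) eq_sym (negbTE bt).
Qed.

Lemma exch_exchl (E : finType) (x : {ffun E -> bool}) (s t b : E) :
  x s -> ~~ x t -> ~~ x b -> b != t -> exch (exch x s t) t b = exch x s b.
Proof.
move=> xs xt xb bt; apply/ffunP => e; rewrite !ffunE.
case: (eqVneq e t) => [->|et].
  by rewrite eq_sym (negbTE (exch_neq xs xt)) eq_sym (negbTE bt) (negbTE xt).
case: (eqVneq e b) => [->|//].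
by rewrite eq_sym (negbTE (exch_neq xs xb)).
Qed.

Lemma exch_exchr (E : finType) (x : {ffun E -> bool}) (s t a : E) :
  x s -> ~~ x t -> x a -> a != s -> exch (exch x s t) a s = exch x a t.
Proof.
move=> xs xt xa as_; apply/ffunP => e; rewrite !ffunE.
case: (eqVneq e a) => [//|ea].
case: (eqVneq e s) => [->|//].
by rewrite (negbTE (exch_neq xs xt)) xs.
Qed.

(** Stated additively to avoid truncated subtraction. Suitable [F] give the changes of the size, of
    the degrees and of the number of edges outside a target configuration. *)
Lemma sumn_exch (E : finType) (x : {ffun E -> bool}) (s t : E) (F : E -> bool -> nat) :
  x s -> ~~ x t ->
  (\sum_e F e (exch x s t e) + (F s true + F t false) =
  \sum_e F e (x e) + (F s false + F t true))%N.
Proof.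
move=> xs xt; have st := exch_neq xs xt.
have D (G : E -> nat) :
    (\sum_e G e = G s + (G t + \sum_(e | (e != s) && (e != t)) G e))%N.
  by rewrite (bigD1 s) //= (bigD1 t) //=; rewrite eq_sym.
rewrite !D exch_at1 exch_at2 // xs (negbTE xt).
rewrite (eq_bigr (fun e => F e (x e))); last by move=> e /andP[? ?]; rewrite exch_other.
by move: (\sum_(_ | _) _)%N => S; lia.
Qed.

Lemma has_size_exch (E : finType) (k : nat) (x : {ffun E -> bool}) (s t : E) :
  x s -> ~~ x t -> has_size k (exch x s t) = has_size k x.
Proof.
move=> xs xt; rewrite /has_size.
have := sumn_exch (fun=> nat_of_bool) xs xt.
by rewrite addn0 add0n => /addIn ->.
Qed.

(* The complete graph on ['I_n], with an abstract type [E] of edge positions. *)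
Definition incidence (n : nat) (E : finType) (inc : 'I_n -> E -> bool) : Prop :=
  (forall e, \sum_v inc v e = 2)%N /\
  (forall u v, u != v -> \sum_e (inc u e && inc v e) = 1)%N.

Definition degree (n : nat) (E : finType) (inc : 'I_n -> E -> bool) (x : {ffun E -> bool})
  (v : 'I_n) : nat := (\sum_e (x e && inc v e))%N.

Lemma degree_exch (n : nat) (E : finType) (inc : 'I_n -> E -> bool) (x : {ffun E -> bool})
    (s t : E) (v : 'I_n) : x s -> ~~ x t ->
  (degree inc (exch x s t) v + inc v s = degree inc x v + inc v t)%N.
Proof.
move=> xs xt; have := sumn_exch (fun e b => nat_of_bool (b && inc v e)) xs xt.
by rewrite /= addn0 add0n.
Qed.

Lemma sum_inc (n : nat) (E : finType) (inc : 'I_n -> E -> bool) (v : 'I_n) :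
  incidence inc -> (\sum_e inc v e = n.-1)%N.
Proof.
move=> [inc2 incp].
transitivity (\sum_(u | u != v) \sum_e (inc u e && inc v e))%N; last first.
  rewrite (eq_bigr (fun=> 1%N)); last by move=> u uv; rewrite incp.
  by rewrite sum1_card cardC1 card_ord.
rewrite exchange_big /=; apply: eq_bigr => e _.
case: (boolP (inc v e)) => ve; last by rewrite big1 // => u _; rewrite andbF.
have := inc2 e; rewrite (bigD1 v) //= ve => -[] Q.
by rewrite -[LHS]Q; apply: eq_bigr => u _; rewrite andbT.
Qed.

Lemma sum_degree (n : nat) (E : finType) (inc : 'I_n -> E -> bool) (k : nat)
    (x : {ffun E -> bool}) : incidence inc -> has_size k x -> (\sum_v degree inc x v = 2 * k)%N.
Proof.
move=> [inc2 _] /eqP <-; rewrite big_distrr exchange_big /=; apply: eq_bigr => e _.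
by case: (x e); [rewrite muln1 -[RHS](inc2 e) | rewrite muln0 big1].
Qed.

Lemma degree_compl (n : nat) (E : finType) (inc : 'I_n -> E -> bool)
    (x : {ffun E -> bool}) (v : 'I_n) : incidence inc ->
  (\sum_e (~~ x e && inc v e) + degree inc x v = n.-1)%N.
Proof.
move=> Einc; rewrite -(sum_inc v Einc) -big_split /=; apply: eq_bigr => e _.
by case: (x e); case: (inc v e).
Qed.

Lemma sum_edges (E : finType) (k : nat) (x : {ffun E -> bool}) : has_size k x ->
  (\sum_e (x e) = k)%N /\ (\sum_e (~~ x e) = #|E| - k)%N.
Proof.
move=> /eqP xk; split => //.
have : (\sum_e (x e) + \sum_e (~~ x e) = #|E|)%N.
  rewrite -big_split /= -sum1_card; apply: eq_bigr => e _.
  by case: (x e).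
by rewrite xk; lia.
Qed.

Lemma has_size_le (E : finType) (k : nat) (x : {ffun E -> bool}) : has_size k x -> (k <= #|E|)%N.
Proof.
move=> /eqP <-; rewrite -sum1_card leq_sum // => e _.
exact: leq_b1.
Qed.

(** The map sending [(x, s, t)] to [(exch x s t, t, s)] is an involution on the admissible triples.
    Reversibility and the double count of exchanges at a vertex rest on it. *)
Lemma sum_exch_rev (R : realType) (E : finType) (k : nat) (F : {ffun E -> bool} -> E -> E -> R) :
  \sum_(x | has_size k x) \sum_(s | x s) \sum_(t | ~~ x t) F x s t =
  \sum_(x | has_size k x) \sum_(s | x s) \sum_(t | ~~ x t) F (exch x s t) t s.
Proof.
have pairs (G : {ffun E -> bool} -> E -> E -> R) :
    \sum_(x | has_size k x) \sum_(s | x s) \sum_(t | ~~ x t) G x s t =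
    \sum_(p : {ffun E -> bool} * (E * E) |
       [&& has_size k p.1, p.1 p.2.1 & ~~ p.1 p.2.2]) G p.1 p.2.1 p.2.2.
  transitivity (\sum_(x | has_size k x) \sum_(q | x q.1 && ~~ x q.2) G x q.1 q.2).
    by apply: eq_bigr => x _; rewrite pair_big_dep.
  by rewrite pair_big_dep.
rewrite !pairs.
pose h (p : {ffun E -> bool} * (E * E)) :=
  (exch p.1 p.2.1 p.2.2, (p.2.2, p.2.1)).
have hK p : [&& has_size k p.1, p.1 p.2.1 & ~~ p.1 p.2.2] -> h (h p) = p.
  by case: p => x [s t] /= /and3P[_ xs xt]; rewrite /h /= exchK.
have hP p : [&& has_size k p.1, p.1 p.2.1 & ~~ p.1 p.2.2] ->
    [&& has_size k (h p).1, (h p).1 (h p).2.1 & ~~ (h p).1 (h p).2.2].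
  case: p => x [s t] /= /and3P[xk xs xt].
  by rewrite has_size_exch // xk exch_at2 ?exch_at1 // (exch_neq xs xt).
rewrite (reindex_onto h h) //; apply: eq_bigl => p.
apply/andP/idP => [[/hP P /eqP Q]|P]; last by split; [exact: hP|apply/eqP/hK].
by move: P; rewrite Q.
Qed.

(** Induction on the number of edges of [x] missing from [y]: while the two differ, exchanging one
    such edge for an edge of [y] missing from [x] lowers this number by one. *)
Lemma osc_le (R : realType) (E : finType) (k : nat) (f : {ffun E -> bool} -> R) (l : R) : 0 <= l ->
  (forall x s t, has_size k x -> x s -> ~~ x t -> `|f (exch x s t) - f x| <= l) ->
  forall x y, has_size k x -> has_size k y -> `|f x - f y| <= l * (#|E|)%:R.
Proof.
move=> l0 fl x y xk yk.
pose d x := (\sum_e (x e && ~~ y e))%N.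
suff H m : forall x, has_size k x -> d x = m -> `|f x - f y| <= l * m%:R.
  apply: le_trans (H _ _ xk erefl) _; rewrite ler_wpM2l // ler_nat.
  by rewrite -sum1_card leq_sum // => e _; exact: leq_b1.
elim: m => [|m IH] {xk}x xk dx.
  suff -> : x = y by rewrite subrr normr0 mulr0.
  have xy e : x e -> y e.
    move=> xe; apply/negPn/negP => ye; move: dx; rewrite /d (bigD1 e) //= xe ye.
    by [].
  apply/ffunP => e; have [xE yE] := (eqP xk, eqP yk).
  have /eqP : (\sum_e (y e && ~~ x e) = 0)%N.
    have : (\sum_e (y e && ~~ x e) + \sum_e x e = \sum_e y e)%N.
      rewrite -big_split /=; apply: eq_bigr => i _.
      by have := xy i; case: (x i); case: (y i) => // /(_ isT).
    by rewrite xE yE; lia.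
  rewrite sum_nat_eq0 => /forallP /(_ e); have := xy e.
  by case: (x e); case: (y e) => // /(_ isT).
have [s /andP[xs ys]] : exists s, x s && ~~ y s.
  apply/existsP; move: dx; rewrite /d; apply: contra_eqT; rewrite negb_exists => /forallP H.
  by rewrite big1 // => e _; rewrite (negbTE (H e)).
have [t /andP[xt yt]] : exists t, ~~ x t && y t.
  apply/existsP; move: dx; rewrite /d; apply: contra_eqT; rewrite negb_exists => /forallP H.
  have : (\sum_e (x e && ~~ y e) + \sum_e y e = \sum_e x e)%N.
    rewrite -big_split /=; apply: eq_bigr => i _.
    by have := H i; case: (x i); case: (y i).
  by rewrite (eqP xk) (eqP yk); lia.
have dS : d (exch x s t) = m.
  have := sumn_exch (fun e b => nat_of_bool (b && ~~ y e)) xs xt.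
  by rewrite -/(d x) -/(d (exch x s t)) dx ys yt /=; lia.
have := IH _ _ dS; rewrite has_size_exch // => /(_ xk) H1.
have H2 := fl _ _ _ xk xs xt.
have -> : f x - f y = (f (exch x s t) - f y) - (f (exch x s t) - f x) by ring.
apply: le_trans (ler_normB _ _) _.
by rewrite -addn1 natrD mulrDr mulr1 lerD.
Qed.

(** * Spectral gap by path coupling *)

Lemma weighted_cauchy_schwarz (R : realType) (T : finType) (w u v : T -> R) :
  (forall x, 0 <= w x) ->
  (\sum_x w x * (u x * v x)) ^+ 2 <=
  (\sum_x w x * u x ^+ 2) * (\sum_x w x * v x ^+ 2).
Proof.
move=> w0; set B := \sum_x _; set A := \sum_x _; set C := \sum_x _.
have A0 : 0 <= A by apply: sumr_ge0 => x _; rewrite mulr_ge0 ?sqr_ge0.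
have H : 0 <= A * (A * C - B ^+ 2).
  have -> : A * (A * C - B ^+ 2) = \sum_x w x * (A * v x - B * u x) ^+ 2.
    rewrite (eq_bigr (fun x => A ^+ 2 * (w x * v x ^+ 2) -
       (2 * A * B) * (w x * (u x * v x)) + B ^+ 2 * (w x * u x ^+ 2))); last first.
      by move=> x _; ring.
    by rewrite big_split /= sumrB -!mulr_sumr -/A -/B -/C; ring.
  by apply: sumr_ge0 => x _; rewrite mulr_ge0 ?sqr_ge0.
move: A0; rewrite le_eqVlt => /orP[/eqP A0|A0]; last first.
  by move: H; rewrite pmulr_rge0 // subr_ge0.
suff -> : B = 0 by rewrite -A0 mul0r expr0n.
apply: big1 => x _.
have /eqP : w x * u x ^+ 2 = 0.
  apply/eqP; rewrite eq_le mulr_ge0 ?sqr_ge0 // andbT A0 /A (bigD1 x) //= lerDl.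
  by apply: sumr_ge0 => y _; rewrite mulr_ge0 ?sqr_ge0.
rewrite mulf_eq0 sqrf_eq0 => /orP[] /eqP ->; by rewrite ?mul0r ?mulr0.
Qed.

(** If [q = b / a / r] exceeded 1, Bernoulli's inequality would make [q ^+ t] unbounded, whereas it
    is at most [C / a]. *)
Lemma le_of_geometric (R : realType) (a b C r : R) : 0 < r -> 0 < a ->
  (forall t, a * (b / a) ^+ t <= C * r ^+ t) -> b <= r * a.
Proof.
move=> r0 a0 H; rewrite leNgt; apply/negP => ra.
pose q := b / a / r.
have q1 : 0 < q - 1.
  by rewrite subr_gt0 /q ltr_pdivlMr // ltr_pdivlMr // mul1r.
have bern t : 1 + t%:R * (q - 1) <= q ^+ t.
  elim: t => [|t IH]; first by rewrite mul0r addr0 expr0.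
  have t0 : 0 <= t%:R :> R := ler0n _ t.
  rewrite exprS -addn1 natrD; have : 0 <= q by lra.
  move/ler_wpM2l => /(_ _ _ IH); apply: le_trans.
  by have := mulr_ge0 t0 (sqr_ge0 (q - 1)); lra.
have qC t : q ^+ t <= C / a.
  rewrite ler_pdivlMr // mulrC expr_div_n mulrA ler_pdivrMr ?exprn_gt0 //; exact: H.
have C0 : 0 <= C / a / (q - 1).
  by rewrite divr_ge0 ?(ltW q1) //; apply: le_trans (qC 0%N); rewrite expr0.
have := archi_boundP C0; set t := Num.bound _.
rewrite ltr_pdivrMr // => Ht.
by have := bern t; have := qC t; lra.
Qed.

(* [a_t = |A^t f|^2] is log-convex for a self-adjoint [A], so the ratio
   [a_1 / a_0] is at most the exponential rate of decay of [a_t]. *)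
Lemma selfadjoint_decay (R : realType) (T : finType) (w : T -> R)
    (A : (T -> R) -> T -> R) (f : T -> R) (C r : R) :
  (forall x, 0 <= w x) -> 0 < r ->
  (forall g h, \sum_x w x * (g x * A h x) = \sum_x w x * (A g x * h x)) ->
  (forall t, \sum_x w x * iter t A f x ^+ 2 <= C * r ^+ t) ->
  \sum_x w x * A f x ^+ 2 <= r * \sum_x w x * f x ^+ 2.
Proof.
move=> w0 r0 sa dec; pose a t := \sum_x w x * iter t A f x ^+ 2.
rewrite -/(a 0%N) -/(a 1%N).
have a0 t : 0 <= a t by apply: sumr_ge0 => x _; rewrite mulr_ge0 ?sqr_ge0.
(* Self-adjointness moves one factor: [a t.+1] is the pairing of the iterates [t] and [t.+2], to
   which Cauchy--Schwarz applies. *)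
have lc t : a t.+1 ^+ 2 <= a t * a t.+2.
  have := weighted_cauchy_schwarz (iter t A f) (iter t.+2 A f) w0.
  by rewrite -/(a t) -/(a t.+2) /= sa.
have [z|a00] := ltP 0 (a 0%N); last first.
  have z : a 0%N = 0 by apply/le_anti; rewrite a00 a0.
  have := lc 0%N; rewrite z mul0r => H.
  have /eqP : a 1%N ^+ 2 = 0 by apply/le_anti; rewrite H sqr_ge0.
  by rewrite sqrf_eq0 => /eqP ->; rewrite mulr0.
apply: (@le_of_geometric _ _ _ C) => // t.
have [a1|] := ltP 0 (a 1%N); last first.
  move=> a1; have -> : a 1%N = 0 by apply/le_anti; rewrite a1 a0.
  case: t => [|t]; first by rewrite !expr0 mulr1 mulr1; have := dec 0%N; rewrite expr0 mulr1.
  rewrite mul0r expr0n /= mulr0.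
  by apply: (le_trans _ (dec t.+1)); exact: a0.
have H s : 0 < a s /\ a s * (a 1%N / a 0%N) <= a s.+1.
  elim: s => [|s [p IH]]; first by split=> //; rewrite mulrC divfK ?gt_eqF.
  have p1 : 0 < a s.+1 by apply: (lt_le_trans _ IH); rewrite mulr_gt0 ?divr_gt0.
  split=> //; rewrite -(ler_pM2l p); apply: (le_trans _ (lc s)).
  by rewrite mulrCA expr2 ler_wpM2l // ltW.
apply: (le_trans _ (dec t)); rewrite -/(a t).
elim: t => [|t IH]; first by rewrite expr0 mulr1.
rewrite exprSr mulrA; apply: (le_trans _ (H t).2).
by rewrite ler_wpM2r // divr_ge0.
Qed.

(** Decay at rate [r ^+ 2] of the squared norms bounds the norm of [A f] by [r] times that of [f];
    the inequality [2 r f (A f) <= r^2 f^2 + (A f)^2] turns this into a Rayleigh bound. The sup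
    bound is asked only where [w] is positive, so that [w] may live on part of the type. *)
Lemma selfadjoint_rayleigh (R : realType) (T : finType) (w : T -> R)
    (A : (T -> R) -> T -> R) (f : T -> R) (C r : R) :
  (forall x, 0 <= w x) -> 0 < r ->
  (forall g h, \sum_x w x * (g x * A h x) = \sum_x w x * (A g x * h x)) ->
  (forall t x, 0 < w x -> `|iter t A f x| <= C * r ^+ t) ->
  \sum_x w x * (f x * A f x) <= r * \sum_x w x * f x ^+ 2.
Proof.
move=> w0 r0 sa dec.
have : \sum_x w x * A f x ^+ 2 <= r ^+ 2 * \sum_x w x * f x ^+ 2.
  apply: (@selfadjoint_decay _ _ _ _ _ (C ^+ 2 * \sum_x w x)) => //; first exact: exprn_gt0.
  move=> t; rewrite mulrAC -exprM mulnC exprM -exprMn mulr_sumr; apply: ler_sum => x _.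
  have [wx|wx] := ltP 0 (w x); last first.
    have -> : w x = 0 by apply/le_anti; rewrite wx w0.
    by rewrite mul0r mulr0.
  rewrite mulrC ler_wpM2r // -real_normK ?num_real // lerXn2r ?nnegrE //.
    exact: (le_trans _ (dec t x wx)).
  exact: dec.
set S := \sum_x w x * f x ^+ 2; set S1 := \sum_x w x * A f x ^+ 2 => H.
have : \sum_x w x * (f x * A f x) <= 2^-1 * r * S + 2^-1 / r * S1.
  rewrite !mulr_sumr -big_split /=; apply: ler_sum => x _.
  have -> : 2^-1 * r * (w x * f x ^+ 2) + 2^-1 / r * (w x * A f x ^+ 2) =
    w x * (2^-1 / r * (r ^+ 2 * f x ^+ 2 + A f x ^+ 2)).
    by field; rewrite gt_eqF.
  rewrite ler_wpM2l // mulrAC ler_pdivlMr //.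
  by have := sqr_ge0 (r * f x - A f x); lra.
move/le_trans; apply.
have : 2^-1 / r * S1 <= 2^-1 / r * (r ^+ 2 * S).
  by rewrite ler_wpM2l // divr_ge0 // ltW.
have -> : 2^-1 / r * (r ^+ 2 * S) = 2^-1 * r * S by field; rewrite gt_eqF.
lra.
Qed.

(** The generator before division by [k (N - k)]. It acts on functions of all configurations, so
    that it can be iterated without restricting to a subtype. *)
Definition kawasaki_gen (R : realType) (E : finType) (H f : {ffun E -> bool} -> R) (x : {ffun E -> bool}) : R :=
  \sum_(s | x s) \sum_(t | ~~ x t)
    logistic (H (exch x s t) - H x) * (f (exch x s t) - f x).

Lemma sum_occupied_exch (R : realType) (E : finType) (x : {ffun E -> bool}) (s t : E) (G : E -> R) :
  x s -> ~~ x t ->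
  \sum_(a | exch x s t a) G a = G t + \sum_(a | x a && (a != s)) G a.
Proof.
move=> xs xt; have st := exch_neq xs xt.
rewrite (bigD1 t) /=; last by rewrite exch_at2.
congr (_ + _); apply: eq_bigl => a; rewrite exchE.
case: (eqVneq a s) => [|as_]; first by rewrite andbF.
by case: (eqVneq a t) => [->|]; rewrite ?(negbTE xt) // !andbT.
Qed.

Lemma sum_empty_exch (R : realType) (E : finType) (x : {ffun E -> bool}) (s t : E) (G : E -> R) :
  x s -> ~~ x t ->
  \sum_(b | ~~ exch x s t b) G b = G s + \sum_(b | ~~ x b && (b != t)) G b.
Proof.
move=> xs xt; have st := exch_neq xs xt.
rewrite (bigD1 s) /=; last by rewrite exch_at1.
congr (_ + _); apply: eq_bigl => a; rewrite exchE.
case: (eqVneq a s) => [->|as_]; first by rewrite xs andbF.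
by case: (eqVneq a t) => [->|]; rewrite ?andbF // !andbT.
Qed.

Lemma card_occupied (R : realType) (E : finType) (k : nat) (x : {ffun E -> bool}) : has_size k x ->
  \sum_(a | x a) 1 = k%:R :> R.
Proof.
move=> /sum_edges [<- _]; rewrite natr_sum big_mkcond /=.
by apply: eq_bigr => e _; case: (x e).
Qed.

Lemma card_empty (R : realType) (E : finType) (k : nat) (x : {ffun E -> bool}) : has_size k x ->
  \sum_(a | ~~ x a) 1 = (#|E|)%:R - k%:R :> R.
Proof.
move=> xk; rewrite -natrB ?(has_size_le xk) //; have [_ <-] := sum_edges xk.
rewrite natr_sum big_mkcond /=.
by apply: eq_bigr => e _; case: (x e).
Qed.

Lemma ler_norm_sum_le (R : realType) (I : finType) (P : pred I) (F G : I -> R) :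
  (forall i, P i -> `|F i| <= G i) -> `|\sum_(i | P i) F i| <= \sum_(i | P i) G i.
Proof. by move=> FG; apply: le_trans (ler_norm_sum _ _ _) _; exact: ler_sum. Qed.


(* Path coupling, in the dual form: compare the generator at the two ends of
   a exch, matching the moves [(a, b)] away from [s], [t] with each other, and
   letting [(s, b)], [(a, t)] coalesce with [(t, b)], [(a, s)]. *)
Lemma kawasaki_contraction (R : realType) (E : finType) (k : nat) (H f : {ffun E -> bool} -> R)
    (D h M l : R) (x : {ffun E -> bool}) (s t : E) :
  D = k%:R * ((#|E|)%:R - k%:R) -> 0 <= h -> 0 <= l ->
  (forall z a b, has_size k z -> z a -> ~~ z b -> `|H (exch z a b) - H z| <= h) ->
  (forall z a b, has_size k z -> z a -> ~~ z b -> `|f (exch z a b) - f z| <= l) ->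
  has_size k x -> x s -> ~~ x t ->
  \sum_(a | x a && (a != s)) \sum_(b | ~~ x b && (b != t))
    `|(H (exch (exch x s t) a b) - H (exch x s t)) - (H (exch x a b) - H x)| <= M ->
  `|(D * f (exch x s t) + kawasaki_gen H f (exch x s t)) -
    (D * f x + kawasaki_gen H f x)| <=
  l * (D - ((#|E|)%:R * (2^-1 - h / 2) - M / 4)).
Proof.
move=> Ddef h0 l0 Hh fl xk xs xt HM.
set y := exch x s t; set dl := f y - f x.
have st := exch_neq xs xt.
have yk : has_size k y by rewrite has_size_exch.
have dl_l : `|dl| <= l by apply: fl.
pose q z a b := logistic (H (exch z a b) - H z).
pose X z a b := q z a b * (f (exch z a b) - f z).
have q0 z a b : 0 <= q z a b by apply/ltW/logistic_gt0.
have q1 z a b : q z a b <= 1 by apply/ltW/logistic_lt1.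
have qh z a b : has_size k z -> z a -> ~~ z b -> 2^-1 - h / 4 <= q z a b.
  move=> zk za zb; have := Hh _ _ _ zk za zb; rewrite /q => Hz.
  have := logistic_lip (H (exch z a b) - H z) 0; rewrite logistic0 subr0.
  by rewrite ler_norml; lra.
set PA := fun a => x a && (a != s); set PB := fun b => ~~ x b && (b != t).
set NA : R := \sum_(a | PA a) 1; set NB : R := \sum_(b | PB b) 1.
have kA : k%:R = 1 + NA by rewrite -(card_occupied _ xk) (bigD1 s).
have kB : (#|E|)%:R - k%:R = 1 + NB by rewrite -(card_empty _ xk) (bigD1 t).
have NA0 : 0 <= NA by apply: sumr_ge0.
have NB0 : 0 <= NB by apply: sumr_ge0.
have Lx : kawasaki_gen H f x = X x s t + \sum_(b | PB b) X x s b +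
    (\sum_(a | PA a) X x a t + \sum_(a | PA a) \sum_(b | PB b) X x a b).
  rewrite /kawasaki_gen (bigD1 s) //= (bigD1 t) //= -big_split /=.
  by congr (_ + _); apply: eq_bigr => a _; rewrite (bigD1 t).
have Ly : kawasaki_gen H f y = X y t s + \sum_(b | PB b) X y t b +
    (\sum_(a | PA a) X y a s + \sum_(a | PA a) \sum_(b | PB b) X y a b).
  rewrite /kawasaki_gen sum_occupied_exch // sum_empty_exch // -big_split /=.
  by congr (_ + _); apply: eq_bigr => a _; rewrite sum_empty_exch.
set S1 := \sum_(a | PA a) \sum_(b | PB b) q y a b.
set S2 := \sum_(b | PB b) q y t b.
set S3 := \sum_(a | PA a) q y a s.
(* The exchange and its reverse have rates summing to 1, so together they remove [dl] exactly
   once. *)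
have e0 : X y t s - X x s t = - dl.
  rewrite /X /q exchK // -/y.
  have -> : H x - H y = - (H y - H x) by ring.
  by rewrite logisticN /dl; ring.
(* A matched move contributes its rate at [y] times the new difference of [f], hence the [l * S1]
   that offsets [S1 * dl]; the mismatch of its two rates costs a quarter of the mixed second
   difference of [H]. *)
have e1 : `|\sum_(a | PA a) \sum_(b | PB b) (X y a b - X x a b) + S1 * dl|
    <= l * (S1 + M / 4).
  rewrite /S1 mulr_suml -big_split /=.
  under eq_bigr do rewrite mulr_suml -big_split /=.
  apply: (@le_trans _ _ (l * (S1 + \sum_(a | PA a) \sum_(b | PB b)
     `|(H (exch y a b) - H y) - (H (exch x a b) - H x)| / 4))); last first.
    rewrite ler_wpM2l // lerD2l.
    by under eq_bigr do rewrite -mulr_suml; rewrite -mulr_suml ler_wpM2r.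
  rewrite /S1 -big_split /= mulr_sumr; apply: ler_norm_sum_le => a /andP[xa as_].
  rewrite -big_split /= mulr_sumr; apply: ler_norm_sum_le => b /andP[xb bt].
  have at_ : a != t by rewrite (exch_neq xa xt).
  have bs : b != s by rewrite eq_sym (exch_neq xs xb).
  have ya : y a by rewrite exch_other.
  have yb : ~~ y b by rewrite exch_other.
  have F1 : `|f (exch y a b) - f (exch x a b)| <= l.
    rewrite -exchC //; apply: fl; rewrite ?has_size_exch //; first by rewrite exch_other // eq_sym.
    by rewrite exch_other // eq_sym.
  have F2 : `|f (exch x a b) - f x| <= l by apply: fl.
  have := logistic_lip (H (exch y a b) - H y) (H (exch x a b) - H x).
  rewrite -/(q y a b) -/(q x a b) => F3.
  have -> : X y a b - X x a b + q y a b * dl =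
    q y a b * (f (exch y a b) - f (exch x a b)) +
    (q y a b - q x a b) * (f (exch x a b) - f x).
    by rewrite /X /dl; ring.
  apply: le_trans (ler_normD _ _) _; rewrite [leRHS]mulrDr lerD //.
    by rewrite normrM ger0_norm // mulrC ler_wpM2r.
  rewrite normrM mulrC; apply: ler_pM => //; lra.
(* Both moves end at the same configuration, so apart from [S2 * dl] only the difference of their
   rates remains, at most a quarter of [h]. *)
have e2 : `|\sum_(b | PB b) (X y t b - X x s b) + S2 * dl| <= l * (NB * (h / 4)).
  rewrite /S2 mulr_suml -big_split /= /NB mulr_suml mulr_sumr.
  apply: ler_norm_sum_le => b /andP[xb bt]; rewrite mul1r.
  have F := fl _ _ _ xk xs xb.
  have -> : X y t b - X x s b + q y t b * dl =
    (q y t b - q x s b) * (f (exch x s b) - f x).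
    by rewrite /X /dl exch_exchl //; ring.
  rewrite normrM mulrC; apply: ler_pM => //.
  rewrite /q exch_exchl //; apply: le_trans (logistic_lip _ _) _.
  have -> : H (exch x s b) - H y - (H (exch x s b) - H x) = - (H y - H x) by ring.
  by rewrite normrN; have := Hh _ _ _ xk xs xt; rewrite -/y; lra.
have e3 : `|\sum_(a | PA a) (X y a s - X x a t) + S3 * dl| <= l * (NA * (h / 4)).
  rewrite /S3 mulr_suml -big_split /= /NA mulr_suml mulr_sumr.
  apply: ler_norm_sum_le => a /andP[xa as_]; rewrite mul1r.
  have F := fl _ _ _ xk xa xt.
  have -> : X y a s - X x a t + q y a s * dl =
    (q y a s - q x a t) * (f (exch x a t) - f x).
    by rewrite /X /dl exch_exchr //; ring.
  rewrite normrM mulrC; apply: ler_pM => //.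
  rewrite /q exch_exchr //; apply: le_trans (logistic_lip _ _) _.
  have -> : H (exch x a t) - H y - (H (exch x a t) - H x) = - (H y - H x) by ring.
  by rewrite normrN; have := Hh _ _ _ xk xs xt; rewrite -/y; lra.
have S1le : S1 <= NA * NB.
  rewrite /NA mulr_suml; apply: ler_sum => a _; rewrite mul1r; exact: ler_sum.
have S2le : S2 <= NB by apply: ler_sum.
have S3le : S3 <= NA by apply: ler_sum.
have S2ge : NB * (2^-1 - h / 4) <= S2.
  rewrite /NB mulr_suml; apply: ler_sum => b /andP[xb bt]; rewrite mul1r; apply: qh => //.
    by rewrite exch_at2.
  by rewrite exch_other // eq_sym (exch_neq xs xb).
have S3ge : NA * (2^-1 - h / 4) <= S3.
  rewrite /NA mulr_suml; apply: ler_sum => a /andP[xa as_]; rewrite mul1r; apply: qh => //.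
    by rewrite exch_other // (exch_neq xa xt).
  by rewrite exch_at1.
move: e1 e2 e3; under eq_bigr do rewrite sumrB; rewrite !sumrB.
move: Lx Ly; set T1x := \sum_(a | PA a) \sum_(b | PB b) X x a b.
set T1y := \sum_(a | PA a) \sum_(b | PB b) X y a b.
set T2x := \sum_(b | PB b) X x s b; set T2y := \sum_(b | PB b) X y t b.
set T3x := \sum_(a | PA a) X x a t; set T3y := \sum_(a | PA a) X y a s.
move=> -> -> e1 e2 e3.
have DE : D = (1 + NA) * (1 + NB) by rewrite Ddef kA -kB kA; ring.
have NE : (#|E|)%:R = 2 + NA + NB by move: kA kB; lra.
have -> : D * f y + (X y t s + T2y + (T3y + T1y)) - (D * f x + (X x s t + T2x + (T3x + T1x))) =
  (D - S1 - S2 - S3 - 1) * dl + ((T1y - T1x + S1 * dl) + (T2y - T2x + S2 * dl) +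
   (T3y - T3x + S3 * dl)).
  have -> : X y t s = X x s t - dl by rewrite -e0; ring.
  by rewrite /dl; ring.
(* Rates are at most 1 and [D] counts all pairs, so the weight left on [dl] is nonnegative: this is
   the laziness provided by the normalisation by [D]. *)
have Q0 : 0 <= D - S1 - S2 - S3 - 1 by rewrite DE; lra.
apply: le_trans (ler_normD _ _) _.
rewrite normrM (ger0_norm Q0).
have e4 : (D - S1 - S2 - S3 - 1) * `|dl| <= (D - S1 - S2 - S3 - 1) * l by rewrite ler_wpM2l.
have e5 := ler_normD (T1y - T1x + S1 * dl + (T2y - T2x + S2 * dl)) (T3y - T3x + S3 * dl).
have e6 := ler_normD (T1y - T1x + S1 * dl) (T2y - T2x + S2 * dl).
apply: (@le_trans _ _ (l * (D - S2 - S3 - 1 + M / 4 + (NA + NB) * (h / 4)))); first lra.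
by rewrite ler_wpM2l // NE; lra.
Qed.

Lemma logistic_balance (R : realType) (a b : R) :
  expR a * logistic (b - a) = expR b * logistic (a - b).
Proof. by rewrite -!logistic_expR [expR b + _]addrC; ring. Qed.

(** Symmetrisation under the reversal of exchanges, with detailed balance. The bilinear form serves
    three times: its symmetry gives self-adjointness, [g = 1] gives conservation of the mean, and
    [g = h] gives the Dirichlet form. *)
Lemma kawasaki_gen_form (R : realType) (E : finType) (k : nat)
    (H g h : {ffun E -> bool} -> R) :
  \sum_(x | has_size k x) expR (H x) * (g x * kawasaki_gen H h x) =
  - (2^-1 * \sum_(x | has_size k x) \sum_(s | x s) \sum_(t | ~~ x t)
      expR (H x) * logistic (H (exch x s t) - H x) *
      ((g (exch x s t) - g x) * (h (exch x s t) - h x))).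
Proof.
set S := \sum_(x | has_size k x) \sum_(s | _) _.
have L : \sum_(x | has_size k x) expR (H x) * (g x * kawasaki_gen H h x) =
    \sum_(x | has_size k x) \sum_(s | x s) \sum_(t | ~~ x t)
      expR (H x) * logistic (H (exch x s t) - H x) * (g x * (h (exch x s t) - h x)).
  apply: eq_bigr => x _; rewrite mulrA mulr_sumr; apply: eq_bigr => s _.
  by rewrite mulr_sumr; apply: eq_bigr => t _; ring.
have L' := L; rewrite sum_exch_rev in L'.
suff : S = - (\sum_(x | has_size k x) expR (H x) * (g x * kawasaki_gen H h x)) *+ 2 by lra.
rewrite mulr2n {1}L L' -opprD -big_split -sumrN /=; apply: eq_bigr => x xk.
rewrite -big_split -sumrN /=; apply: eq_bigr => s xs.
rewrite -big_split -sumrN /=; apply: eq_bigr => t xt.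
by rewrite exchK // [expR (H (exch _ _ _)) * _]logistic_balance; ring.
Qed.

Lemma sumr_gt0_in (R : realType) (T : finType) (P : pred T) (w : T -> R) (x : T) :
  P x -> (forall y, P y -> 0 < w y) -> 0 < \sum_(y | P y) w y.
Proof.
move=> Px w0; rewrite (bigD1 x) //= ltr_pwDl ?w0 //.
by apply: sumr_ge0 => y /andP[Py _]; rewrite ltW ?w0.
Qed.

Lemma norm_le_of_mean0 (R : realType) (T : finType) (P : pred T) (w g : T -> R) (c : R) :
  (forall x, P x -> 0 < w x) -> \sum_(x | P x) w x * g x = 0 ->
  (forall x y, P x -> P y -> `|g x - g y| <= c) ->
  forall x, P x -> `|g x| <= c.
Proof.
move=> w0 g0 gc x Px.
have Z0 : 0 < \sum_(y | P y) w y by exact: sumr_gt0_in Px w0.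
rewrite -(ler_pM2l Z0) -[X in X * `|_|]gtr0_norm // -normrM.
have -> : (\sum_(y | P y) w y) * g x = \sum_(y | P y) w y * (g x - g y).
  by under [RHS]eq_bigr do rewrite mulrBr; rewrite sumrB g0 subr0 mulr_suml.
rewrite mulr_suml; apply: ler_norm_sum_le => y Py.
by rewrite normrM gtr0_norm ?w0 // ler_wpM2l ?gc // ltW ?w0.
Qed.

(** With [L] the generator, [A = 1 + D^-1 L] preserves mean zero and contracts the Lipschitz
    seminorm by [rho = 1 - gap / D]. For a function of mean zero this seminorm controls the sup
    norm, so the iterates decay like [rho ^+ t] and the Rayleigh quotient of [A] is at most [rho].
    The bound [gap < D] keeps [rho] positive. *)
Lemma kawasaki_poincare (R : realType) (E : finType) (k : nat)
    (H f : {ffun E -> bool} -> R) (D gap m h M : R) :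
  D = k%:R * (#|E|%:R - k%:R) ->
  gap = #|E|%:R * (2^-1 - h / 2) - M / 4 ->
  m = (\sum_(x | has_size k x) expR (H x) * f x) / \sum_(x | has_size k x) expR (H x) ->
  0 <= h -> 0 < gap -> gap < D ->
  (forall z a b, has_size k z -> z a -> ~~ z b -> `|H (exch z a b) - H z| <= h) ->
  (forall x s t, has_size k x -> x s -> ~~ x t ->
    \sum_(a | x a && (a != s)) \sum_(b | ~~ x b && (b != t))
    `|(H (exch (exch x s t) a b) - H (exch x s t)) - (H (exch x a b) - H x)| <= M) ->
  gap * \sum_(x | has_size k x) expR (H x) * (f x - m) ^+ 2 <=
  2^-1 * \sum_(x | has_size k x) \sum_(s | x s) \sum_(t | ~~ x t)
      expR (H x) * logistic (H (exch x s t) - H x) * (f (exch x s t) - f x) ^+ 2.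
Proof.
move=> DE gapE mE h0 gap0 gapD Hh HM.
have D0 : 0 < D by exact: lt_trans gapD.
pose w x := if has_size k x then expR (H x) else 0.
have wE (F : {ffun E -> bool} -> R) :
    \sum_x w x * F x = \sum_(x | has_size k x) expR (H x) * F x.
  rewrite [RHS]big_mkcond; apply: eq_bigr => x _.
  by rewrite /w; case: ifP; rewrite ?mul0r.
pose A g x := g x + D^-1 * kawasaki_gen H g x.
have AE g g' : \sum_x w x * (g x * A g' x) = \sum_(x | has_size k x) expR (H x) * (g x * g' x) +
    D^-1 * \sum_(x | has_size k x) expR (H x) * (g x * kawasaki_gen H g' x).
  rewrite wE mulr_sumr -big_split /=; apply: eq_bigr => x _; rewrite /A; ring.
have formC g g' : \sum_(x | has_size k x) expR (H x) * (g x * kawasaki_gen H g' x) =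
    \sum_(x | has_size k x) expR (H x) * (g' x * kawasaki_gen H g x).
  rewrite !kawasaki_gen_form; congr (- (_ * _)); apply: eq_bigr => x _.
  by apply: eq_bigr => s _; apply: eq_bigr => t _; congr (_ * _); exact: mulrC.
have sa g g' : \sum_x w x * (g x * A g' x) = \sum_x w x * (A g x * g' x).
  rewrite AE formC; under [X in X + _]eq_bigr do rewrite [g _ * _]mulrC.
  by rewrite -AE; apply: eq_bigr => x _; rewrite [A g x * _]mulrC.
have mean0 g : \sum_(x | has_size k x) expR (H x) * g x = 0 ->
    \sum_(x | has_size k x) expR (H x) * A g x = 0.
  move=> g0; have := AE (fun=> 1) g.
  rewrite wE kawasaki_gen_form; under [X in - (_ * X)]eq_bigr do
    under eq_bigr do under eq_bigr do rewrite subrr mul0r mulr0.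
  rewrite ![X in - (_ * X)]big1 ?mulr0 ?oppr0 ?mulr0 ?addr0; last first.
    by move=> x _; rewrite big1 // => s _; rewrite big1.
  under eq_bigr do rewrite mul1r.
  by under [RHS]eq_bigr do rewrite mul1r; rewrite g0.
pose rho := 1 - gap / D.
have rho0 : 0 < rho by rewrite subr_gt0 ltr_pdivrMr // mul1r.
have lip g l : 0 <= l ->
    (forall z a b, has_size k z -> z a -> ~~ z b -> `|g (exch z a b) - g z| <= l) ->
    (forall z a b, has_size k z -> z a -> ~~ z b -> `|A g (exch z a b) - A g z| <= l * rho).
  move=> l0 gl z a b zk za zb.
  have := kawasaki_contraction DE h0 l0 Hh gl zk za zb (HM _ _ _ zk za zb).
  rewrite -gapE -(ler_pM2l (_ : 0 < D^-1)) ?invr_gt0 //.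
  rewrite -[X in X * `|_|]gtr0_norm ?invr_gt0 // -normrM.
  have -> : D^-1 * (l * (D - gap)) = l * rho by rewrite /rho; field; rewrite gt_eqF.
  congr (is_true (`|_| <= _)).
  by rewrite /A; field; rewrite gt_eqF.
pose f0 x := f x - m.
have Z0 (x : {ffun E -> bool}) : has_size k x -> 0 < \sum_(y | has_size k y) expR (H y).
  by move=> xk; apply: (sumr_gt0_in xk) => y _; exact: expR_gt0.
have f00 : \sum_(x | has_size k x) expR (H x) * f0 x = 0.
  have [x xk|no] := pickP (@has_size E k); last by rewrite big_pred0.
  rewrite /f0; under eq_bigr do rewrite mulrBr.
  by rewrite sumrB -mulr_suml mE [X in _ - X]mulrC divfK ?subrr // gt_eqF // (Z0 _ xk).
(* A crude Lipschitz constant is enough: it enters the prefactor of the geometric decay and not its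
   rate. *)
pose l := 2 * \sum_x `|f x|.
have l0 : 0 <= l by rewrite mulr_ge0 // sumr_ge0.
have f0l z a b : has_size k z -> z a -> ~~ z b -> `|f0 (exch z a b) - f0 z| <= l.
  move=> zk za zb; rewrite /f0.
  have -> : f (exch z a b) - m - (f z - m) = f (exch z a b) - f z by ring.
  have B y : `|f y| <= \sum_x `|f x| by rewrite (bigD1 y) //= lerDl sumr_ge0.
  by apply: le_trans (ler_normB _ _) _; rewrite /l mulr_natl mulr2n lerD.
have it t : \sum_(x | has_size k x) expR (H x) * iter t A f0 x = 0 /\
    forall z a b, has_size k z -> z a -> ~~ z b ->
      `|iter t A f0 (exch z a b) - iter t A f0 z| <= l * rho ^+ t.
  elim: t => [|t [IH1 IH2]]; first by rewrite expr0 mulr1.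
  split; first exact: mean0.
  rewrite exprSr mulrA; apply: lip => //.
  by rewrite mulr_ge0 // exprn_ge0 // ltW.
have := @selfadjoint_rayleigh R _ w A f0 (l * #|E|%:R) rho _ rho0 sa _.
rewrite AE wE kawasaki_gen_form => Ray.
set V := \sum_(x | has_size k x) expR (H x) * f0 x ^+ 2 in Ray *.
set Dir := \sum_(x | has_size k x) \sum_(s | x s) _ in Ray.
have DirE : \sum_(x | has_size k x) \sum_(s | x s) \sum_(t | ~~ x t)
      expR (H x) * logistic (H (exch x s t) - H x) * (f (exch x s t) - f x) ^+ 2 = Dir.
  apply: eq_bigr => x _; apply: eq_bigr => s _; apply: eq_bigr => t _.
  by rewrite /f0; ring.
rewrite DirE.
have {}Ray : V + D^-1 * - (2^-1 * Dir) <= rho * V.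
  apply: Ray => [x|t x wx].
    by rewrite /w; case: ifP => // _; exact: expR_ge0.
  have xk : has_size k x by move: wx; rewrite /w; case: ifP => //; rewrite ltxx.
  have [t1 t2] := it t.
  rewrite mulrAC; apply: (norm_le_of_mean0 _ t1) => // [y _|y z yk zk].
    exact: expR_gt0.
  by apply: (osc_le _ t2) => //; rewrite mulr_ge0 // exprn_ge0 // ltW.
move: Ray; rewrite -(ler_pM2l D0) !mulrDr mulrA divff ?gt_eqF // mul1r mulrA.
have -> : D * rho = D - gap by rewrite /rho; field; rewrite gt_eqF.
rewrite mulrBl; lra.
Qed.

(** * The truncated energy *)

(* [z ^ 2] continued linearly outside [[-m, m]]. *)
Definition huber (R : realType) (m z : R) : R :=
  z ^+ 2 - Num.max (z - m) 0 ^+ 2 - Num.max (- z - m) 0 ^+ 2.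

Lemma huber_le (R : realType) (m z : R) : huber m z <= z ^+ 2.
Proof. by rewrite /huber; have := sqr_ge0 (Num.max (z - m) 0); have := sqr_ge0 (Num.max (- z - m) 0); lra. Qed.

Lemma huber_in (R : realType) (m z : R) : `|z| <= m -> huber m z = z ^+ 2.
Proof.
rewrite ler_norml => /andP[z1 z2].
by rewrite /huber !max_r ?expr0n ?subr0 //; lra.
Qed.

Lemma huber_right (R : realType) (m z : R) : 0 <= m -> m <= z ->
  huber m z = 2 * m * z - m ^+ 2.
Proof.
by move=> m0 mz; rewrite /huber max_l ?max_r ?expr0n /=; [ring|lra|lra].
Qed.

Lemma huberN (R : realType) (m z : R) : huber m (- z) = huber m z.
Proof. by rewrite /huber sqrrN opprK addrAC. Qed.

Lemma huber_mid (R : realType) (m z : R) : - m <= z -> z <= m -> huber m z = z ^+ 2.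
Proof. by move=> z1 z2; apply: huber_in; rewrite ler_norml z1. Qed.

Lemma huber_left (R : realType) (m z : R) : 0 <= m -> z <= - m ->
  huber m z = - (2 * m * z) - m ^+ 2.
Proof. by move=> m0 mz; rewrite -huberN huber_right ?mulrN; lra. Qed.

Lemma huber_cases (R : realType) (m z : R) : 0 <= m ->
  [\/ (m <= z /\ huber m z = 2 * m * z - m ^+ 2),
      ((- m <= z /\ z <= m) /\ huber m z = z ^+ 2) |
      (z <= - m /\ huber m z = - (2 * m * z) - m ^+ 2)].
Proof.
move=> m0; case: (leP m z) => [mz|/ltW zm].
  by constructor 1; rewrite huber_right.
case: (leP (- m) z) => [mz|/ltW mz].
  by constructor 2; rewrite huber_mid.
by constructor 3; rewrite huber_left.
Qed.

Lemma huber_step (R : realType) (m z : R) : 1 <= m ->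
  `|huber m (z + 1) - huber m z| <= 2 * m + 1.
Proof.
move=> m1; have m0 : 0 <= m by lra.
rewrite ler_norml.
have [[? ->]|[[? ?] ->]|[? ->]] := huber_cases z m0;
have [[? ->]|[[? ?] ->]|[? ->]] := huber_cases (z + 1) m0; try nra.
Qed.

(** Beyond [m + 1] all three points lie on one linear piece and the second difference vanishes;
    elsewhere it is at most that of the square. The indicator later restricts sums to vertices of
    nearly typical degree. *)
Lemma huber_second_diff (R : realType) (m z : R) : 1 <= m ->
  `|huber m (z + 1) + huber m (z - 1) - 2 * huber m z| <= 2 * (`|z| <= m + 1)%R%:R.
Proof.
move=> m1; have m0 : 0 <= m by lra.
case: (leP `|z| (m + 1)) => [_|].
  rewrite mulr1 ler_norml.
  have [[? ->]|[[? ?] ->]|[? ->]] := huber_cases z m0;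
  have [[? ->]|[[? ?] ->]|[? ->]] := huber_cases (z + 1) m0;
  have [[? ->]|[[? ?] ->]|[? ->]] := huber_cases (z - 1) m0; try nra.
rewrite mulr0 lter_normr => zm.
have -> : huber m (z + 1) + huber m (z - 1) - 2 * huber m z = 0; last by rewrite normr0.
case/orP: zm => zm; first by rewrite !huber_right; lra.
by rewrite !huber_left; lra.
Qed.

(** For nonzero increments this is, up to sign, a second difference centred at [z - 1], [z] or
    [z + 1], whence the radius [m + 2] instead of [m + 1]. *)
Lemma huber_mixed_diff (R : realType) (m z : R) (a b s t : bool) : 1 <= m ->
  `|(huber m (z + (t%:R - s%:R) + (b%:R - a%:R)) - huber m (z + (t%:R - s%:R))) -
    (huber m (z + (b%:R - a%:R)) - huber m z)|
  <= 2 * (s + t)%:R * (a + b)%:R * (`|z| <= m + 2)%R%:R.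
Proof.
move=> m1.
have nn (u : R) (i j c : nat) : u = 0 -> `|u| <= 2 * i%:R * j%:R * c%:R.
  by move=> ->; rewrite normr0 !mulr_ge0.
have far (c y : R) : `|c - z| <= 1 -> `|y| <= 2 * (`|c| <= m + 1)%R%:R ->
    `|y| <= 2 * (`|z| <= m + 2)%R%:R.
  move=> cz /le_trans; apply; rewrite ler_wpM2l // ler_nat.
  case: (leP `|c| (m + 1)) => // cm.
  suff -> : `|z| <= m + 2 by [].
  have -> : z = c - (c - z) by ring.
  by apply: le_trans (ler_normB _ _) _; lra.
have N0 : `|z - z| <= 1 by rewrite subrr normr0.
have NP : `|(z + 1) - z| <= 1 by rewrite addrAC subrr add0r normr1.
have NM : `|(z - 1) - z| <= 1 by rewrite addrAC subrr add0r normrN1.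
have := huber_second_diff z m1 => /(far _ _ N0) S0.
have := huber_second_diff (z + 1) m1; rewrite addrK => /(far _ _ NP) SP.
have := huber_second_diff (z - 1) m1; rewrite subrK => /(far _ _ NM) SM.
have [<-|] := eqVneq s t; first by apply: nn; rewrite subrr !addr0; ring.
have [<-|] := eqVneq a b; first by move=> _; apply: nn; rewrite subrr !addr0; ring.
have close (u v : R) (c : bool) : `|v| <= 2 * c%:R -> u = v \/ u = - v ->
    `|u| <= 2 * 1 * 1 * c%:R.
  by rewrite !mulr1 => vc [->|->]; rewrite ?normrN.
case: s t a b => [] [] // [] [] // _ _;
  rewrite /= ?subr0 ?sub0r ?addrK ?subrK.
- by apply: close SM _; left; ring.
- by apply: close S0 _; right; ring.
- by apply: close S0 _; right; ring.
- by apply: close SP _; left; ring.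
Qed.

Definition huber_energy (R : realType) (n : nat) (E : finType) (inc : 'I_n -> E -> bool)
    (b m d0 : R) (x : {ffun E -> bool}) : R :=
  b * \sum_v huber m ((degree inc x v)%:R - d0).

Lemma degree_exchR (R : realType) (n : nat) (E : finType) (inc : 'I_n -> E -> bool)
    (x : {ffun E -> bool}) (s t : E) (v : 'I_n) (d0 : R) : x s -> ~~ x t ->
  (degree inc (exch x s t) v)%:R - d0 =
  (degree inc x v)%:R - d0 + ((inc v t)%:R - (inc v s)%:R).
Proof.
move=> xs xt; have /(congr1 (GRing.natmul (1 : R))) := degree_exch inc v xs xt.
rewrite !natrD; lra.
Qed.

Lemma huber_stepb (R : realType) (m z : R) (s t : bool) : 1 <= m ->
  `|huber m (z + (t%:R - s%:R)) - huber m z| <= (2 * m + 1) * (s + t)%:R.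
Proof.
move=> m1; have [<-|] := eqVneq s t.
  by rewrite subrr addr0 subrr normr0 mulr_ge0 //; lra.
case: s t => [] [] // _; rewrite /= ?subr0 ?sub0r ?mulr1.
  by have := huber_step (z - 1) m1; rewrite subrK distrC.
exact: huber_step.
Qed.

Lemma huber_energy_step (R : realType) (n : nat) (E : finType) (inc : 'I_n -> E -> bool)
    (b m d0 : R) (x : {ffun E -> bool}) (s t : E) :
  incidence inc -> 0 <= b -> 1 <= m -> x s -> ~~ x t ->
  `|huber_energy inc b m d0 (exch x s t) - huber_energy inc b m d0 x| <= b * (4 * (2 * m + 1)).
Proof.
move=> [inc2 _] b0 m1 xs xt.
rewrite /huber_energy -mulrBr normrM ger0_norm // ler_wpM2l // -sumrB.
apply: (@le_trans _ _ (\sum_v (2 * m + 1) * (inc v s + inc v t)%:R)).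
  apply: ler_norm_sum_le => v _; rewrite degree_exchR //; exact: huber_stepb.
by rewrite -mulr_sumr -natr_sum big_split /= !inc2 mulrC.
Qed.

(** The interaction constant of the path coupling. At a vertex [v] the sum over pairs is
    [N (2 p (1 - p) (n - 1) + (1 - 2 p) z_v)], with [N] the number of edge positions, and the
    indicator from the mixed difference bounds [z_v] by [m + 2]. The factor 8 is the 2 of the second
    difference times the four endpoints of [s] and [t]. *)
Lemma huber_energy_mixed (R : realType) (n : nat) (E : finType) (inc : 'I_n -> E -> bool)
    (k : nat) (b m p : R) (H : {ffun E -> bool} -> R) (x : {ffun E -> bool}) (s t : E) :
  H = huber_energy inc b m (n.-1%:R * p) -> incidence inc -> 0 <= b -> 1 <= m -> 0 < p < 1 -> k%:R = #|E|%:R * p ->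
  has_size k x -> x s -> ~~ x t ->
  \sum_(a | x a && (a != s)) \sum_(c | ~~ x c && (c != t))
    `|(H (exch (exch x s t) a c) - H (exch x s t)) - (H (exch x a c) - H x)|
  <= b * (8 * (#|E|%:R * (2 * p * (1 - p) * n%:R + m + 2))).
Proof.
move=> -> Einc b0 m1 /andP[p0 p1] kp xk xs xt.
pose z v : R := (degree inc x v)%:R - n.-1%:R * p.
have inc2 := Einc.1.
pose Q v a c : R := 2 * (inc v s + inc v t)%:R * (inc v a + inc v c)%:R * (`|z v| <= m + 2)%R%:R.
have Q0 v a c : 0 <= Q v a c by rewrite !mulr_ge0.
apply: (@le_trans _ _ (\sum_(a | x a) \sum_(c | ~~ x c) b * \sum_v Q v a c)).
  rewrite [leRHS](bigD1 s) //= -[leLHS]add0r lerD //.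
    by apply: sumr_ge0 => c _; rewrite mulr_ge0 // sumr_ge0.
  apply: ler_sum => a /andP[xa as_].
  rewrite [leRHS](bigD1 t) //= -[leLHS]add0r lerD //.
    by rewrite mulr_ge0 // sumr_ge0.
  apply: ler_sum => c /andP[xc ct].
  have ya : exch x s t a by rewrite exch_other // (exch_neq xa xt).
  have yc : ~~ exch x s t c by rewrite exch_other // eq_sym (exch_neq xs xc).
  rewrite /huber_energy -!mulrBr normrM ger0_norm // ler_wpM2l // -!sumrB.
  by apply: ler_norm_sum_le => v _; rewrite !degree_exchR //; exact: huber_mixed_diff.
have -> : \sum_(a | x a) \sum_(c | ~~ x c) b * \sum_v Q v a c =
    b * \sum_v (2 * (inc v s + inc v t)%:R * (`|z v| <= m + 2)%R%:R) *
       (\sum_(a | x a) \sum_(c | ~~ x c) (inc v a + inc v c)%:R).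
  under eq_bigr do rewrite -mulr_sumr; rewrite -mulr_sumr; congr (_ * _).
  under eq_bigr do rewrite exchange_big /=.
  rewrite exchange_big /=; apply: eq_bigr => v _; rewrite mulr_sumr.
  apply: eq_bigr => a _; rewrite mulr_sumr; apply: eq_bigr => c _; rewrite /Q; ring.
rewrite ler_wpM2l //.
have E1 v : \sum_(a | x a) \sum_(c | ~~ x c) (inc v a + inc v c)%:R =
    (degree inc x v)%:R * (#|E|%:R - k%:R) + (n.-1%:R - (degree inc x v)%:R) * k%:R :> R.
  have da : \sum_(a | x a) (inc v a)%:R = (degree inc x v)%:R :> R.
    rewrite natr_sum big_mkcond; apply: eq_bigr => e _; by case: (x e).
  have dc : \sum_(a | ~~ x a) (inc v a)%:R = n.-1%:R - (degree inc x v)%:R :> R.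
    have /(congr1 (GRing.natmul (1 : R))) := degree_compl x v Einc.
    rewrite natrD natr_sum => <-; rewrite addrK big_mkcond; apply: eq_bigr => e _.
    by case: (x e).
  under eq_bigr do under eq_bigr do rewrite natrD.
  under eq_bigr do rewrite big_split /= dc.
  rewrite big_split /=; congr (_ + _).
    rewrite -da mulr_suml; apply: eq_bigr => a _.
    rewrite -(card_empty _ xk) mulr_sumr; by apply: eq_bigr => c _; rewrite mulr1.
  rewrite -(card_occupied _ xk) mulr_sumr; by apply: eq_bigr => c _; rewrite mulr1.
set W := #|E|%:R * (2 * p * (1 - p) * n%:R + m + 2).
apply: (@le_trans _ _ (\sum_v 2 * (inc v s + inc v t)%:R * W)); last first.
  rewrite -mulr_suml -mulr_sumr -natr_sum big_split /= !inc2.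
  by rewrite -natrM.
apply: ler_sum => v _.
rewrite -!mulrA ler_wpM2l // ler_wpM2l //.
have N0 : 0 <= #|E|%:R :> R by [].
have n1 : n.-1%:R <= n%:R :> R by rewrite ler_nat leq_pred.
have pp : 0 <= 2 * p * (1 - p) by rewrite !mulr_ge0 //; lra.
case: (leP `|z v| (m + 2)) => zv; last first.
  rewrite mul0r /W mulr_ge0 // !addr_ge0 ?mulr_ge0 //; lra.
rewrite mul1r E1 kp.
have -> : (degree inc x v)%:R = z v + n.-1%:R * p by rewrite /z subrK.
have -> : (z v + n.-1%:R * p) * (#|E|%:R - #|E|%:R * p) +
   (n.-1%:R - (z v + n.-1%:R * p)) * (#|E|%:R * p) =
   #|E|%:R * (2 * p * (1 - p) * n.-1%:R + (1 - 2 * p) * z v) by ring.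
rewrite /W ler_wpM2l // -addrA lerD //; first by rewrite ler_wpM2l.
apply: le_trans (ler_norm _) _; rewrite normrM -[leRHS]mul1r ler_pM //.
by rewrite ler_norml; lra.
Qed.

(** * Concentration of the degrees *)

Lemma card_edges_inc (n : nat) (E : finType) (inc : 'I_n -> E -> bool) :
  incidence inc -> (2 * #|E| = n * n.-1)%N.
Proof.
move=> Einc; have [inc2 _] := Einc.
transitivity (\sum_(e : E) \sum_v inc v e)%N.
  by rewrite (eq_bigr (fun=> 2%N)) // sum_nat_const mulnC.
rewrite exchange_big /= (eq_bigr (fun=> n.-1)); last by move=> v _; rewrite sum_inc.
by rewrite sum_nat_const card_ord.
Qed.

Lemma card_has_size (R : realType) (E : finType) (k : nat) :
  \sum_(x : {ffun E -> bool} | has_size k x) 1 = 'C(#|E|, k)%:R :> R.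
Proof.
pose h (A : {set E}) : {ffun E -> bool} := [ffun e => e \in A].
have hi : injective h.
  by move=> A B /ffunP AB; apply/setP => e; have := AB e; rewrite !ffunE.
rewrite -card_draws -(card_imset _ hi).
rewrite -(sumr_const _ (1 : R)); apply: eq_bigl => x.
apply/idP/imsetP => [/eqP xk|[A]].
  exists [set e | x e]%SET; last by apply/ffunP => e; rewrite ffunE inE.
  rewrite inE -xk -sum1dep_card big_mkcond /=; apply/eqP.
  by apply: eq_bigr => e _; case: (x e).
rewrite inE => /eqP <- ->; apply/eqP; rewrite -sum1_card [RHS]big_mkcond.
by apply: eq_bigr => e _; rewrite ffunE; case: (e \in A).
Qed.

(** The terms of the binomial law increase up to its integer mean [k] and decrease after it, so the
    term at [k] is the largest of [N.+1] terms with sum 1. *)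
Lemma binomial_mode (R : realType) (N k : nat) (p : R) :
  0 < p < 1 -> k%:R = N%:R * p ->
  1 <= N.+1%:R * ('C(N, k)%:R * (p ^+ k * (1 - p) ^+ (N - k))).
Proof.
move=> /andP[p0 p1] kp.
pose t j : R := 'C(N, j)%:R * (p ^+ j * (1 - p) ^+ (N - j)).
have q0 : 0 < 1 - p by lra.
have kN : (k <= N)%N by rewrite -(ler_nat R) kp ler_piMr //; lra.
have t0 j : 0 <= t j by rewrite !mulr_ge0 // exprn_ge0 // ltW.
have rec j : (j < N)%N -> j.+1%:R * (1 - p) * t j.+1 = (N%:R - j%:R) * p * t j.
  move=> jN; rewrite /t -natrB; last exact: ltnW.
  have : (j.+1 * 'C(N, j.+1) = (N - j) * 'C(N, j))%N by rewrite mul_bin_left.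
  move/(congr1 (GRing.natmul (1 : R))); rewrite !natrM => H.
  have -> : (1 - p) ^+ (N - j) = (1 - p) * (1 - p) ^+ (N - j.+1).
    by rewrite -exprS subnSK.
  transitivity (j.+1%:R * 'C(N, j.+1)%:R * ((1 - p) * (p ^+ j.+1 * (1 - p) ^+ (N - j.+1)))).
    by ring.
  by rewrite H exprS; ring.
have up j : (j < k)%N -> t j <= t j.+1.
  move=> jk; have jN := leq_trans jk kN.
  have c0 : 0 < j.+1%:R * (1 - p) by rewrite mulr_gt0.
  rewrite -(ler_pM2l c0) rec // ler_wpM2r //.
  have : j.+1%:R <= k%:R :> R by rewrite ler_nat.
  by rewrite kp -natr1; lra.
have down j : (k <= j)%N -> (j < N)%N -> t j.+1 <= t j.
  move=> kj jN; have c0 : 0 < j.+1%:R * (1 - p) by rewrite mulr_gt0.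
  rewrite -(ler_pM2l c0) rec // ler_wpM2r //.
  have : k%:R <= j%:R :> R by rewrite ler_nat.
  by rewrite kp -natr1; lra.
have mode j : (j <= N)%N -> t j <= t k.
  move=> jN; case: (leqP j k) => [jk|/ltnW kj].
    rewrite -(subKn jk); elim: (k - j)%N (leq_subr j k) => [|i IH] ik.
      by rewrite subn0.
    apply: (le_trans _ (IH (ltnW ik))).
    by rewrite -(subnSK ik); apply: up; lia.
  rewrite -(subnKC kj) in jN *; elim: (j - k)%N jN => [|i IH] iN.
    by rewrite addn0.
  rewrite addnS in iN *; apply: (le_trans _ (IH (ltnW iN))); apply: down => //.
  exact: leq_addr.
have t1 : \sum_(i < N.+1) t i = 1.
  have := exprDn (1 - p) p N; rewrite subrK expr1n => ->.
  by apply: eq_bigr => i _; rewrite /t mulr_natl [p ^+ i * _]mulrC.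
rewrite -[leLHS]t1; apply: (@le_trans _ _ (\sum_(i < N.+1) t k)).
  by apply: ler_sum => i _; apply: mode; rewrite -ltnS.
by rewrite sumr_const card_ord -[t k *+ _]mulr_natl.
Qed.

Definition bern (R : realType) (E : finType) (p : R) (x : {ffun E -> bool}) : R :=
  \prod_e (if x e then p else 1 - p).

Lemma bern_has_size (R : realType) (E : finType) (k : nat) (p : R) (x : {ffun E -> bool}) :
  has_size k x -> bern p x = p ^+ k * (1 - p) ^+ (#|E| - k).
Proof.
move=> xk; rewrite /bern (bigID (fun e => x e)) /=.
have [s1 s2] := sum_edges xk.
rewrite (eq_bigr (fun=> p)); last by move=> e ->.
rewrite [X in _ * X](eq_bigr (fun=> 1 - p)); last by move=> e /negbTE ->.
rewrite !prodr_const; congr (_ ^+ _ * _ ^+ _).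
  by rewrite -s1 -sum1_card big_mkcond; apply: eq_bigr => e _; rewrite /in_mem /=; case: (x e).
by rewrite -s2 -sum1_card big_mkcond; apply: eq_bigr => e _; rewrite /in_mem /=; case: (x e).
Qed.

Lemma bern_mgf (R : realType) (E : finType) (p K : R) (th : E -> R) :
  0 < p < 1 -> 0 < K -> K <= c_kaw p ->
  \sum_x bern p x * expR (\sum_e th e * ((x e)%:R - p))
  <= expR ((\sum_e th e ^+ 2) / (4 * K)).
Proof.
move=> p01 K0 Kc.
pose G e (b : bool) : R := (if b then p else 1 - p) * expR (th e * (b%:R - p)).
rewrite (eq_bigr (fun x : {ffun E -> bool} => \prod_e G e (x e))); last first.
  by move=> x _; rewrite /bern expR_sum -big_split.
rewrite -(bigA_distr_bigA G) mulr_suml expR_sum /=.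
apply: ler_prod => e _; rewrite big_bool /G /=.
have /andP[p0 p1] := p01.
rewrite addr_ge0 ?mulr_ge0 ?expR_ge0 //=; try lra.
have := bernoulli_mgf (th e) p01 K0 Kc.
by rewrite sub0r mulrN [th e * p]mulrC [th e * (1 - p)]mulrC.
Qed.

(** The uniform law on size [k] is the Bernoulli law conditioned on an event of probability at least
    [1 / #|E|.+1]; conditioning costs at most the inverse factor. *)
Lemma sum_has_size_le_bern (R : realType) (E : finType) (k : nat) (p : R)
    (F : {ffun E -> bool} -> R) :
  0 < p < 1 -> k%:R = #|E|%:R * p -> (forall x, 0 <= F x) ->
  \sum_(x | has_size k x) F x <=
  #|E|.+1%:R * (\sum_(x : {ffun E -> bool} | has_size k x) 1) * \sum_x bern p x * F x.
Proof.
move=> p01 kp F0; have /andP[p0 p1] := p01.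
have := binomial_mode p01 kp; rewrite -(card_has_size R E k).
set c := \sum_(x | _) 1; set w := p ^+ k * _ => H.
have b0 (x : {ffun E -> bool}) : 0 <= bern p x.
  by apply: prodr_ge0 => e _; case: (x e); lra.
apply: (@le_trans _ _ (#|E|.+1%:R * c * \sum_(x | has_size k x) bern p x * F x)); last first.
  rewrite ler_wpM2l //; first by rewrite mulr_ge0 // sumr_ge0.
  rewrite [leRHS](bigID (@has_size E k)) /= lerDl sumr_ge0 // => x _.
  by rewrite mulr_ge0.
rewrite mulr_sumr; apply: ler_sum => x xk; rewrite (bern_has_size _ xk) -/w mulrA.
by rewrite -[leLHS]mul1r ler_wpM2r // -mulrA.
Qed.

(** When the square is expanded, a diagonal pair is counted [n - 1] times and an ordered pair of
    distinct vertices once. Keeping the square of the sum apart matters: it vanishes for the tilt of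
    sum zero in [total_deviation], while bounding it by the first term would halve the exponent
    there. *)
Lemma sum_edge_sq (R : realType) (n : nat) (E : finType) (inc : 'I_n -> E -> bool)
    (l : 'I_n -> R) : incidence inc ->
  \sum_e (\sum_v l v * (inc v e)%:R) ^+ 2 <=
  n%:R * \sum_v l v ^+ 2 + (\sum_v l v) ^+ 2.
Proof.
move=> Einc; have [_ incp] := Einc.
under eq_bigr => e _.
  rewrite expr2 mulr_suml; under eq_bigr do rewrite mulr_sumr; over.
rewrite exchange_big /= expr2 mulr_suml mulr_sumr -big_split /=.
apply: ler_sum => u _; rewrite exchange_big /= mulr_sumr (bigD1 u) //=.
rewrite [X in _ <= _ + X](bigD1 u) //= addrA lerD //.
  under eq_bigr => e _.
    have -> : l u * (inc u e)%:R * (l u * (inc u e)%:R) = l u ^+ 2 * (inc u e)%:R.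
      by rewrite expr2; case: (inc u e); rewrite ?mulr1 ?mulr0 ?mul0r.
    over.
  rewrite -mulr_sumr -natr_sum sum_inc // -expr2 mulrC.
  have : n.-1%:R <= n%:R :> R by rewrite ler_nat leq_pred.
  by have := sqr_ge0 (l u); nra.
apply: ler_sum => v vu.
under eq_bigr => e _.
  have -> : l u * (inc u e)%:R * (l v * (inc v e)%:R) = l u * l v * (inc u e && inc v e)%:R.
    by case: (inc u e); case: (inc v e); rewrite ?mulr1 ?mulr0 ?mul0r.
  over.
by rewrite -mulr_sumr -natr_sum incp ?mulr1 // eq_sym.
Qed.

Lemma uniform_mgf (R : realType) (n : nat) (E : finType) (inc : 'I_n -> E -> bool)
    (k : nat) (p K : R) (l : 'I_n -> R) :
  incidence inc -> 0 < p < 1 -> k%:R = #|E|%:R * p -> 0 < K -> K <= c_kaw p ->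
  \sum_(x | has_size k x) expR (\sum_v l v * ((degree inc x v)%:R - n.-1%:R * p)) <=
  #|E|.+1%:R * (\sum_(x : {ffun E -> bool} | has_size k x) 1) *
    expR ((\sum_e (\sum_v l v * (inc v e)%:R) ^+ 2) / (4 * K)).
Proof.
move=> Einc p01 kp K0 Kc.
apply: le_trans (sum_has_size_le_bern p01 kp _) _ => [x|]; first exact: expR_ge0.
rewrite ler_wpM2l //; first by rewrite mulr_ge0 // sumr_ge0.
pose th e := \sum_v l v * (inc v e)%:R.
rewrite (eq_bigr (fun x : {ffun E -> bool} =>
   bern p x * expR (\sum_e th e * ((x e)%:R - p)))); last first.
  move=> x _; congr (_ * expR _).
  under [RHS]eq_bigr do rewrite mulr_suml.
  rewrite exchange_big /=; apply: eq_bigr => v _.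
  under [RHS]eq_bigr do rewrite -mulrA; rewrite -mulr_sumr; congr (_ * _).
  under [RHS]eq_bigr do rewrite mulrBr; rewrite sumrB -mulr_suml -natr_sum sum_inc //.
  congr (_ - _); rewrite /degree natr_sum; apply: eq_bigr => e _.
  by case: (x e); case: (inc v e); rewrite ?mulr1 ?mulr0.
exact: bern_mgf.
Qed.

Definition degree_dev (R : realType) (n : nat) (E : finType) (inc : 'I_n -> E -> bool)
    (p : R) (x : {ffun E -> bool}) (v : 'I_n) : R :=
  (degree inc x v)%:R - n.-1%:R * p.

Definition energy (R : realType) (n : nat) (E : finType) (inc : 'I_n -> E -> bool)
    (b p : R) (x : {ffun E -> bool}) : R :=
  b * \sum_v degree_dev inc p x v ^+ 2.

Lemma sum_degree_dev (R : realType) (n : nat) (E : finType) (inc : 'I_n -> E -> bool)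
    (k : nat) (p : R) (x : {ffun E -> bool}) :
  incidence inc -> k%:R = #|E|%:R * p -> has_size k x -> \sum_v degree_dev inc p x v = 0.
Proof.
move=> Einc kp xk; rewrite /degree_dev sumrB -natr_sum (sum_degree Einc xk) natrM kp.
rewrite sumr_const card_ord -[X in _ - X]mulr_natl !mulrA -!natrM (card_edges_inc Einc).
by rewrite subrr.
Qed.

Lemma degree_lt (n : nat) (E : finType) (inc : 'I_n -> E -> bool) (x : {ffun E -> bool})
  (v : 'I_n) : incidence inc -> (degree inc x v < n)%N.
Proof.
move=> Einc; have := degree_compl x v Einc; have := ltn_ord v; lia.
Qed.

Lemma norm_sum_sq_le (R : realType) (n : nat) (z : 'I_n -> R) :
  (\sum_v `|z v|) ^+ 2 <= n%:R * \sum_v z v ^+ 2.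
Proof.
have := @weighted_cauchy_schwarz R 'I_n (fun=> 1) (fun=> 1) (fun v => `|z v|) (fun=> ler01).
under eq_bigr do rewrite !mul1r; move=> /le_trans; apply.
under eq_bigr do rewrite mul1r expr1n.
rewrite sumr_const card_ord ler_wpM2l //.
by apply: ler_sum => v _; rewrite mul1r real_normK ?num_real.
Qed.

(* A fixed degree sequence [z] has uniform weight at most [exp (- K |z|^2 / n)],
   and there are only [exp O(n log n)] degree sequences. *)
Lemma total_deviation (R : realType) (n : nat) (E : finType) (inc : 'I_n -> E -> bool)
    (k : nat) (p K b d : R) :
  incidence inc -> (0 < n)%N -> 0 < p < 1 -> k%:R = #|E|%:R * p -> 0 < K -> K <= c_kaw p ->
  0 <= b -> b * n%:R <= K -> 0 <= d ->
  \sum_(x | has_size k x && (d * n%:R ^+ 2 <= \sum_v `|degree_dev inc p x v|)) expR (energy inc b p x)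
  <= n.+1%:R ^+ n * (#|E|.+1%:R * (\sum_(x : {ffun E -> bool} | has_size k x) 1) *
    expR (- ((K - b * n%:R) * d ^+ 2 * n%:R ^+ 2))).
Proof.
move=> Einc n0 p01 kp K0 Kc b0 bK d0.
have nR : 0 < n%:R :> R by rewrite ltr0n.
set bd := _ * expR (- _).
have bd0 : 0 <= bd by rewrite !mulr_ge0 ?expR_ge0 // sumr_ge0.
(* Degrees are below [n], so [inord] loses nothing, and there are [n.+1 ^ n] possible values. *)
pose D (x : {ffun E -> bool}) : {ffun 'I_n -> 'I_n.+1} := [ffun v => inord (degree inc x v)].
rewrite (partition_big D predT) //=.
apply: (@le_trans _ _ (\sum_(j : {ffun 'I_n -> 'I_n.+1}) bd)); last first.
  by rewrite sumr_const card_ffun !card_ord -[leLHS]mulr_natl natrX.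
apply: ler_sum => j _.
have [x0 /andP[/andP[xk0 dx0] /eqP Dx0]|no] := pickP (fun x =>
    has_size k x && (d * n%:R ^+ 2 <= \sum_v `|degree_dev inc p x v|) && (D x == j)); last first.
  by rewrite big_pred0.
pose z := degree_dev inc p x0.
have zE x : D x == j -> degree_dev inc p x =1 z.
  move=> /eqP Dx v; rewrite /z /degree_dev; congr (_%:R - _).
  have : D x v = D x0 v by rewrite Dx Dx0.
  by rewrite !ffunE => /(congr1 val); rewrite /= !inordK // ltnS ltnW // degree_lt.
set Z2 := \sum_v z v ^+ 2.
(* The tilt minimising [- l * z + n * l ^+ 2 / (4 * K)], with minimum [- K * z ^+ 2 / n]. *)
pose l v := 2 * K / n%:R * z v.
apply: (@le_trans _ _ (\sum_(x | has_size k x) expR (b * Z2 - \sum_v l v * z v) *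
   expR (\sum_v l v * ((degree inc x v)%:R - n.-1%:R * p)))).
  apply: (@le_trans _ _ (\sum_(x | has_size k x && (d * n%:R ^+ 2 <= \sum_v `|degree_dev inc p x v|) && (D x == j))
     expR (b * Z2 - \sum_v l v * z v) *
     expR (\sum_v l v * ((degree inc x v)%:R - n.-1%:R * p)))).
    apply: ler_sum => x /andP[_ Dx]; rewrite -expRD ler_expR /energy.
    have -> : \sum_v degree_dev inc p x v ^+ 2 = Z2 by apply: eq_bigr => v _; rewrite zE.
    have -> : \sum_v l v * ((degree inc x v)%:R - n.-1%:R * p) = \sum_v l v * z v.
      by apply: eq_bigr => v _; rewrite -(zE _ Dx).
    by rewrite subrK.
  rewrite [leRHS](bigID (fun x => (d * n%:R ^+ 2 <= \sum_v `|degree_dev inc p x v|) && (D x == j))) /=.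
  rewrite (eq_bigl (fun x => has_size k x && ((d * n%:R ^+ 2 <= \sum_v `|degree_dev inc p x v|) && (D x == j)))); last first.
    by move=> x; rewrite andbA.
  by rewrite lerDl sumr_ge0 // => x _; rewrite mulr_ge0 ?expR_ge0.
rewrite -mulr_sumr.
apply: le_trans (ler_wpM2l (expR_ge0 _) (uniform_mgf l Einc p01 kp K0 Kc)) _.
rewrite mulrCA; rewrite ler_wpM2l //; first by rewrite mulr_ge0 // sumr_ge0.
rewrite -expRD ler_expR.
apply: (@le_trans _ _ (b * Z2 - \sum_v l v * z v +
   (n%:R * \sum_v l v ^+ 2 + (\sum_v l v) ^+ 2) / (4 * K))).
  rewrite lerD2l ler_wpM2r ?invr_ge0 ?mulr_ge0 ?(ltW K0) //; exact: sum_edge_sq.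
have -> : \sum_v l v = 0.
  by rewrite /l -mulr_sumr (sum_degree_dev Einc kp xk0) mulr0.
have -> : \sum_v l v * z v = 2 * K / n%:R * Z2.
  by rewrite mulr_sumr; apply: eq_bigr => v _; rewrite /l expr2 mulrA.
have -> : \sum_v l v ^+ 2 = (2 * K / n%:R) ^+ 2 * Z2.
  by rewrite mulr_sumr; apply: eq_bigr => v _; rewrite /l exprMn.
have -> : b * Z2 - 2 * K / n%:R * Z2 +
   (n%:R * ((2 * K / n%:R) ^+ 2 * Z2) + 0 ^+ 2) / (4 * K) = - ((K - b * n%:R) / n%:R * Z2).
  by field; rewrite !gt_eqF.
(* By Cauchy--Schwarz a total deviation of at least [d n^2] forces a sum of squares of at least
   [d^2 n^3]. *)
rewrite lerN2 -!mulrA ler_wpM2l ?subr_ge0 // [leRHS]mulrC ler_pdivlMr // -(ler_pM2l nR).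
have -> : n%:R * (d * (d * n%:R ^+ 2) * n%:R) = (d * n%:R ^+ 2) ^+ 2 by ring.
apply: (le_trans _ (norm_sum_sq_le z)).
by rewrite lerXn2r ?nnegrE ?sumr_ge0 // mulr_ge0 // exprn_ge0 // ltW.
Qed.

(** * The degree of one vertex given the rest of the graph *)

Definition degree_off (n : nat) (E : finType) (inc : 'I_n -> E -> bool) (v : 'I_n)
    (x : {ffun E -> bool}) (u : 'I_n) : nat :=
  (\sum_e (x e && (inc u e && ~~ inc v e)))%N.

Definition dev_off (R : realType) (n : nat) (E : finType) (inc : 'I_n -> E -> bool)
    (p : R) (v : 'I_n) (x : {ffun E -> bool}) (u : 'I_n) : R :=
  (degree_off inc v x u)%:R - n.-1%:R * p.

(** The Gibbs factor of the other vertices with the edges at [v] erased. It does not depend on the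
    edges at [v], and the full weight is [exp (b z_v^2)] times it, up to a factor controlled by the
    total deviation. *)
Definition weight_off (R : realType) (n : nat) (E : finType) (inc : 'I_n -> E -> bool)
    (b p : R) (v : 'I_n) (x : {ffun E -> bool}) : R :=
  expR (b * \sum_(u | u != v) dev_off inc p v x u ^+ 2).

Definition total_dev (R : realType) (n : nat) (E : finType) (inc : 'I_n -> E -> bool)
    (p : R) (x : {ffun E -> bool}) : R := \sum_u `|degree_dev inc p x u|.

Lemma degree_off_bounds (n : nat) (E : finType) (inc : 'I_n -> E -> bool) (v u : 'I_n)
    (x : {ffun E -> bool}) : incidence inc -> u != v ->
  (degree_off inc v x u <= degree inc x u <= degree_off inc v x u + 1)%N.
Proof.
move=> [_ incp] uv; rewrite -(incp _ _ uv) -big_split /=; apply/andP; split.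
  by apply: leq_sum => e _; case: (x e); case: (inc u e); case: (inc v e).
by apply: leq_sum => e _; case: (x e); case: (inc u e); case: (inc v e).
Qed.

Lemma dev_off_bounds (R : realType) (n : nat) (E : finType) (inc : 'I_n -> E -> bool)
    (p : R) (v u : 'I_n) (x : {ffun E -> bool}) : incidence inc -> u != v ->
  dev_off inc p v x u <= degree_dev inc p x u <= dev_off inc p v x u + 1.
Proof.
move=> Einc uv; have := degree_off_bounds x Einc uv.
rewrite -!(ler_nat R) natrD /dev_off /degree_dev; lra.
Qed.

Lemma dev_off_norm (R : realType) (n : nat) (E : finType) (inc : 'I_n -> E -> bool)
    (p : R) (v u : 'I_n) (x : {ffun E -> bool}) : incidence inc -> u != v ->
  `|dev_off inc p v x u| <= `|degree_dev inc p x u| + 1.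
Proof.
move=> Einc uv; have := dev_off_bounds p x Einc uv.
move: (dev_off _ _ _ _ _) (degree_dev _ _ _ _) => a c.
have := ler_norm c; have := ler_norm (- c); rewrite normrN => ? ? /andP[? ?].
by rewrite ler_norml; apply/andP; split; lra.
Qed.

Lemma dev_off_sum_sq (R : realType) (n : nat) (E : finType) (inc : 'I_n -> E -> bool)
    (p : R) (v : 'I_n) (x : {ffun E -> bool}) : incidence inc ->
  `|\sum_(u | u != v) degree_dev inc p x u ^+ 2 - \sum_(u | u != v) dev_off inc p v x u ^+ 2|
  <= 2 * total_dev inc p x + n%:R.
Proof.
move=> Einc; rewrite -sumrB.
apply: (@le_trans _ _ (\sum_(u | u != v) (2 * `|degree_dev inc p x u| + 1))).
  apply: ler_norm_sum_le => u uv; have := dev_off_bounds p x Einc uv.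
  move: (dev_off _ _ _ _ _) (degree_dev _ _ _ _) => a c /andP[ac ca].
  have [e [e0 e1 ->]] : exists e, [/\ 0 <= e, e <= 1 & a = c - e].
    by exists (c - a); split; [lra|lra|ring].
  have -> : c ^+ 2 - (c - e) ^+ 2 = e * (2 * c - e) by ring.
  rewrite ler_norml; have [c0|c0] := leP 0 c.
    by rewrite (ger0_norm c0); apply/andP; split; nra.
  by rewrite (ltr0_norm c0); apply/andP; split; nra.
apply: (@le_trans _ _ (\sum_u (2 * `|degree_dev inc p x u| + 1))).
  rewrite [leRHS](bigID (fun u => u != v)) /= lerDl.
  by apply: sumr_ge0 => u _; rewrite addr_ge0 // mulr_ge0.
by rewrite big_split /= -mulr_sumr sumr_const card_ord.
Qed.

Lemma degree_off_exch (n : nat) (E : finType) (inc : 'I_n -> E -> bool) (v u : 'I_n)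
    (x : {ffun E -> bool}) (s t : E) : x s -> ~~ x t ->
  (degree_off inc v (exch x s t) u + (inc u s && ~~ inc v s) =
   degree_off inc v x u + (inc u t && ~~ inc v t))%N.
Proof.
move=> xs xt.
have := sumn_exch (fun e c => nat_of_bool (c && (inc u e && ~~ inc v e))) xs xt.
by rewrite /= addn0 add0n.
Qed.

(** The bound [exp t >= 1 + t] makes the loss linear in the deviations, so that it can be summed
    over the partner edge of the exchange. *)
Lemma weight_off_exch (R : realType) (n : nat) (E : finType) (inc : 'I_n -> E -> bool)
    (b p : R) (v : 'I_n) (x : {ffun E -> bool}) (s t : E) : 0 <= b -> x s -> ~~ x t ->
  weight_off inc b p v x * (1 - 2 * b * \sum_(u | u != v)
    ((inc u s && ~~ inc v s) + (inc u t && ~~ inc v t))%:R * `|dev_off inc p v x u|)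
  <= weight_off inc b p v (exch x s t).
Proof.
move=> b0 xs xt; rewrite /weight_off.
set S := \sum_(u | _) _ * _; set Q := \sum_(u | _) _ ^+ 2; set Q' := \sum_(u | _) _ ^+ 2.
have QQ : Q - 2 * S <= Q'.
  rewrite lerBlDr -lerBlDl -sumrB mulr_sumr; apply: ler_sum => u uv.
  have /(congr1 (GRing.natmul (1 : R))) := degree_off_exch inc v u xs xt.
  rewrite !natrD /dev_off.
  set a := (degree_off inc v x u)%:R; set a' := (degree_off inc v _ u)%:R.
  set y := n.-1%:R * p; case: (_ && _); case: (_ && _); rewrite /= ?mulr1n ?mulr0n => aa.
  - have -> : a' = a by move: aa; lra.
    by rewrite subrr !mulr_ge0 // addr_ge0.
  - have -> : a' = a - 1 by lra.
    by have := ler_norm (a - y); nra.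
  - have -> : a' = a + 1 by lra.
    by have := ler_norm (- (a - y)); rewrite normrN; nra.
  - have -> : a' = a by move: aa; lra.
    by rewrite subrr !mulr_ge0 // addr_ge0.
apply: (@le_trans _ _ (expR (b * Q) * expR (- (2 * b * S)))).
  rewrite ler_wpM2l ?expR_ge0 //; exact: expR_ge1Dx.
rewrite -expRD ler_expR.
by have := ler_wpM2l b0 QQ; lra.
Qed.

Lemma total_dev_exch (R : realType) (n : nat) (E : finType) (inc : 'I_n -> E -> bool)
    (p : R) (x : {ffun E -> bool}) (s t : E) : incidence inc -> x s -> ~~ x t ->
  total_dev inc p (exch x s t) <= total_dev inc p x + 4.
Proof.
move=> [inc2 _] xs xt.
have -> : 4 = \sum_v (inc v s + inc v t)%:R :> R.
  by rewrite -natr_sum big_split /= !inc2.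
rewrite /total_dev -big_split /=; apply: ler_sum => v _.
rewrite /degree_dev degree_exchR //; apply: le_trans (ler_normD _ _) _.
rewrite lerD2l; case: (inc v s); case: (inc v t);
  by rewrite /= ?subrr ?sub0r ?subr0 ?normrN ?normr0 ?normr1.
Qed.

Lemma exch_double_count (R : realType) (n : nat) (E : finType) (inc : 'I_n -> E -> bool)
    (k d : nat) (v : 'I_n) (F : {ffun E -> bool} -> {ffun E -> bool} -> R) :
  \sum_(x | has_size k x && (degree inc x v == d.+1)) \sum_(s | x s && inc v s)
    \sum_(t | ~~ x t && ~~ inc v t) F x (exch x s t) =
  \sum_(y | has_size k y && (degree inc y v == d)) \sum_(t | y t && ~~ inc v t)
    \sum_(s | ~~ y s && inc v s) F (exch y t s) y.
Proof.
have mk (K1 : nat -> bool) (i j : E -> bool) (G : {ffun E -> bool} -> E -> E -> R) :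
    \sum_(x | has_size k x && K1 (degree inc x v)) \sum_(s | x s && i s) \sum_(t | ~~ x t && j t) G x s t =
    \sum_(x | has_size k x) \sum_(s | x s) \sum_(t | ~~ x t)
      (if [&& K1 (degree inc x v), i s & j t] then G x s t else 0).
  rewrite big_mkcondr; apply: eq_bigr => x xk; case: (K1 _) => /=; last first.
    by rewrite big1 // => s _; rewrite big1.
  rewrite big_mkcondr; apply: eq_bigr => s _; case: (i s) => /=; last by rewrite big1.
  by rewrite big_mkcondr.
rewrite (mk (fun m => m == d.+1) _ (fun t => ~~ inc v t)).
rewrite (mk (fun m => m == d) (fun t => ~~ inc v t) (inc v) (fun y t s => F (exch y t s) y)).
rewrite sum_exch_rev; apply: eq_bigr => y yk; apply: eq_bigr => t yt.
apply: eq_bigr => s ys; rewrite exchK //.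
have := degree_exch inc v yt ys.
case: (inc v s); case: (inc v t); rewrite ?andbF //= addn0 addn1 => ->.
by rewrite eqSS.
Qed.

Lemma counts_at (R : realType) (n : nat) (E : finType) (inc : 'I_n -> E -> bool)
    (k : nat) (v : 'I_n) (x : {ffun E -> bool}) : incidence inc -> has_size k x ->
  [/\ \sum_(s | x s && inc v s) 1 = (degree inc x v)%:R :> R,
      \sum_(s | x s && ~~ inc v s) 1 = k%:R - (degree inc x v)%:R :> R,
      \sum_(s | ~~ x s && inc v s) 1 = n.-1%:R - (degree inc x v)%:R :> R &
      \sum_(s | ~~ x s && ~~ inc v s) 1 =
        #|E|%:R - k%:R - (n.-1%:R - (degree inc x v)%:R) :> R].
Proof.
move=> Einc xk.
have mk (P : pred E) : \sum_(s | P s) 1 = (\sum_s P s)%:R :> R.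
  by rewrite natr_sum big_mkcond; apply: eq_bigr => e _; case: (P e).
have h1 : \sum_(s | x s && inc v s) 1 = (degree inc x v)%:R :> R by rewrite mk.
have h3 : \sum_(s | ~~ x s && inc v s) 1 = n.-1%:R - (degree inc x v)%:R :> R.
  by rewrite mk -(degree_compl x v Einc) natrD addrK.
split=> //.
  by rewrite -(card_occupied _ xk) -h1 [in RHS](bigID (inc v)) /= addrAC subrr add0r.
by rewrite -(card_empty _ xk) -h3 [in RHS](bigID (inc v)) /= addrAC subrr add0r.
Qed.

Definition count_at (R : realType) (n : nat) (E : finType) (inc : 'I_n -> E -> bool)
    (k : nat) (v : 'I_n) (d : nat) : R :=
  \sum_(x : {ffun E -> bool} | has_size k x && (degree inc x v == d)) 1.

(** The threshold [D] is a parameter because each exchange may raise the total deviation by 4. *)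
Definition weight_at (R : realType) (n : nat) (E : finType) (inc : 'I_n -> E -> bool)
    (k : nat) (b p : R) (v : 'I_n) (d : nat) (D : R) : R :=
  \sum_(x | has_size k x && (degree inc x v == d))
    (if total_dev inc p x <= D then weight_off inc b p v x else 0).

(** Indexed by the lower degree: the number of exchanges taking the degree of [v] from [d.+1] to
    [d]. Its counterpart [rate_up] counts those from [d] to [d.+1]. *)
Definition rate_down (R : realType) (n N k d : nat) : R :=
  d.+1%:R * (N%:R - k%:R - (n.-1%:R - d.+1%:R)).

Definition rate_up (R : realType) (n k d : nat) : R :=
  (k%:R - d%:R) * (n.-1%:R - d%:R).

Lemma count_at_balance (R : realType) (n : nat) (E : finType) (inc : 'I_n -> E -> bool)
    (k d : nat) (v : 'I_n) : incidence inc ->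
  rate_down R n #|E| k d * count_at R inc k v d.+1 = rate_up R n k d * count_at R inc k v d.
Proof.
move=> Einc; have := exch_double_count inc k d v (fun _ _ => 1 : R).
have -> : \sum_(x | has_size k x && (degree inc x v == d.+1)) \sum_(s | x s && inc v s)
    \sum_(t | ~~ x t && ~~ inc v t) 1 = rate_down R n #|E| k d * count_at R inc k v d.+1.
  rewrite /count_at mulr_sumr; apply: eq_bigr => x /andP[xk /eqP dx].
  have [c1 _ _ c4] := counts_at R v Einc xk.
  by rewrite c4 -[X in \sum_(s | _) X]mul1r -mulr_suml c1 mulr1 dx.
move=> ->; rewrite /count_at mulr_sumr; apply: eq_bigr => x /andP[xk /eqP dx].
have [_ c2 c3 _] := counts_at R v Einc xk.
by rewrite c3 -[X in \sum_(s | _) X]mul1r -mulr_suml c2 mulr1 dx.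
Qed.

(** Each [u] meets at most [n - 1] of the partners [r], so the loss summed over [r] is at most
    [2 b n (D + n)]. With [b] of order [1 / n] and partners of order [n^2], one exchange loses only
    a fraction of order [(D + n) / n^2]. *)
Lemma sum_weight_off_factor (R : realType) (n : nat) (E : finType) (inc : 'I_n -> E -> bool)
    (b p D th : R) (v : 'I_n) (x : {ffun E -> bool}) (P : pred E) : incidence inc ->
  0 <= b -> total_dev inc p x <= D ->
  2 * b * n%:R * (D + n%:R) <= th * \sum_(r | P r) 1 ->
  (1 - th) * \sum_(r | P r) 1 <= \sum_(r | P r) (1 - 2 * b * \sum_(u | u != v)
     (inc u r && ~~ inc v r)%:R * `|dev_off inc p v x u|).
Proof.
move=> Einc b0 SD H; rewrite sumrB mulrBl mul1r lerD2l lerN2 -mulr_sumr.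
apply: (le_trans _ H); rewrite -[leRHS]mulrA ler_wpM2l ?mulr_ge0 //.
rewrite exchange_big /=.
apply: (@le_trans _ _ (\sum_u n%:R * (`|degree_dev inc p x u| + 1))); last first.
  rewrite -mulr_sumr ler_wpM2l // big_split /= sumr_const card_ord lerD2r //.
rewrite [leRHS](bigID (fun u => u != v)) /= -[leLHS]addr0 lerD //; last first.
  by apply: sumr_ge0 => u _; rewrite mulr_ge0 // addr_ge0.
apply: ler_sum => u uv; rewrite -mulr_suml ler_pM ?sumr_ge0 //; last exact: dev_off_norm.
apply: (@le_trans _ _ (n.-1%:R)); last by rewrite ler_nat leq_pred.
rewrite -(sum_inc u Einc) natr_sum [leLHS]big_mkcond /=; apply: ler_sum => e _.
by case: (P e); case: (inc u e); case: (inc v e).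
Qed.

Lemma weight_at_down (R : realType) (n : nat) (E : finType) (inc : 'I_n -> E -> bool)
    (k d : nat) (b p D th : R) (v : 'I_n) : incidence inc -> 0 <= b ->
  2 * b * n%:R * (D + n%:R) <= th * (#|E|%:R - k%:R - (n.-1%:R - d.+1%:R)) ->
  (1 - th) * (rate_down R n #|E| k d * weight_at inc k b p v d.+1 D) <=
  rate_up R n k d * weight_at inc k b p v d (D + 4).
Proof.
move=> Einc b0 H.
have DC := exch_double_count inc k d v
  (fun x y => if total_dev inc p x <= D then weight_off inc b p v y else 0).
apply: (@le_trans _ _ (\sum_(x | has_size k x && (degree inc x v == d.+1))
  \sum_(s | x s && inc v s) \sum_(t | ~~ x t && ~~ inc v t)
   (if total_dev inc p x <= D then weight_off inc b p v (exch x s t) else 0))).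
  rewrite /weight_at !mulr_sumr; apply: ler_sum => x /andP[xk /eqP dx].
  case: ifPn => xD; last by rewrite !mulr0 sumr_ge0 // => s _; rewrite sumr_ge0.
  have [c1 _ _ c4] := counts_at R v Einc xk.
  set W := weight_off inc b p v x.
  have -> : (1 - th) * (rate_down R n #|E| k d * W) = \sum_(s | x s && inc v s)
      W * ((1 - th) * \sum_(t | ~~ x t && ~~ inc v t) 1).
    by rewrite -[X in \sum_(s | _) X]mul1r -mulr_suml c1 c4 dx /rate_down; ring.
  apply: ler_sum => s /andP[xs vs].
  apply: (@le_trans _ _ (weight_off inc b p v x * \sum_(r | ~~ x r && ~~ inc v r)
     (1 - 2 * b * \sum_(u | u != v) (inc u r && ~~ inc v r)%:R * `|dev_off inc p v x u|))).
    rewrite ler_wpM2l ?expR_ge0 //; apply: (sum_weight_off_factor _ Einc b0 xD).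
    by rewrite c4 dx.
  rewrite mulr_sumr; apply: ler_sum => t /andP[xt vt].
  have := @weight_off_exch R n E inc b p v x s t b0 xs xt; rewrite vs.
  by under [X in 1 - 2 * b * X]eq_bigr do rewrite andbF add0n.
rewrite DC /weight_at mulr_sumr; apply: ler_sum => y /andP[yk /eqP dy].
have [_ c2 c3 _] := counts_at R v Einc yk.
rewrite /rate_up -dy -c2 -c3 mulr_suml mulr_suml; apply: ler_sum => t /andP[yt vt].
rewrite mul1r mulr_suml; apply: ler_sum => s /andP[ys vs]; rewrite mul1r.
have st := exch_neq yt ys.
have := @total_dev_exch R n E inc p (exch y t s) s t Einc.
rewrite exch_at1 exch_at2 // exchK // => /(_ isT isT) h.
case: ifPn => h1; last by case: ifP => // _; exact: expR_ge0.
by rewrite (le_trans h) // lerD2r.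
Qed.

Lemma weight_at_up (R : realType) (n : nat) (E : finType) (inc : 'I_n -> E -> bool)
    (k d : nat) (b p D th : R) (v : 'I_n) : incidence inc -> 0 <= b ->
  2 * b * n%:R * (D + n%:R) <= th * (k%:R - d%:R) ->
  (1 - th) * (rate_up R n k d * weight_at inc k b p v d D) <=
  rate_down R n #|E| k d * weight_at inc k b p v d.+1 (D + 4).
Proof.
move=> Einc b0 H.
have DC := exch_double_count inc k d v
  (fun x y => if total_dev inc p y <= D then weight_off inc b p v x else 0).
apply: (@le_trans _ _ (\sum_(y | has_size k y && (degree inc y v == d)) \sum_(t | y t && ~~ inc v t)
    \sum_(s | ~~ y s && inc v s)
     (if total_dev inc p y <= D then weight_off inc b p v (exch y t s) else 0))).
  rewrite /weight_at !mulr_sumr; apply: ler_sum => x /andP[xk /eqP dx].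
  case: ifPn => xD; last by rewrite !mulr0 sumr_ge0 // => s _; rewrite sumr_ge0.
  have [_ c2 c3 _] := counts_at R v Einc xk.
  set W := weight_off inc b p v x.
  have -> : (1 - th) * (rate_up R n k d * W) = \sum_(s | ~~ x s && inc v s)
      W * ((1 - th) * \sum_(t | x t && ~~ inc v t) 1).
    by rewrite -[X in \sum_(s | _) X]mul1r -mulr_suml c2 c3 dx /rate_up; ring.
  rewrite exchange_big /=; apply: ler_sum => s /andP[xs vs].
  apply: (@le_trans _ _ (weight_off inc b p v x * \sum_(r | x r && ~~ inc v r)
     (1 - 2 * b * \sum_(u | u != v) (inc u r && ~~ inc v r)%:R * `|dev_off inc p v x u|))).
    rewrite ler_wpM2l ?expR_ge0 //; apply: (sum_weight_off_factor _ Einc b0 xD).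
    by rewrite c2 dx.
  rewrite mulr_sumr; apply: ler_sum => t /andP[xt vt].
  have := @weight_off_exch R n E inc b p v x t s b0 xt xs; rewrite vs.
  by under [X in 1 - 2 * b * X]eq_bigr do rewrite andbF addn0.
rewrite -DC /weight_at mulr_sumr; apply: ler_sum => y /andP[yk /eqP dy].
have [c1 _ _ c4] := counts_at R v Einc yk.
rewrite /rate_down -dy -c4 -c1 mulr_suml mulr_suml; apply: ler_sum => t /andP[yt vt].
rewrite mul1r mulr_suml; apply: ler_sum => s /andP[ys vs]; rewrite mul1r.
have st := exch_neq yt ys.
have := @total_dev_exch R n E inc p (exch y t s) s t Einc.
rewrite exch_at1 exch_at2 // exchK // => /(_ isT isT) h.
case: ifPn => h1; last by case: ifP => // _; exact: expR_ge0.
by rewrite (le_trans h) // lerD2r.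
Qed.

Lemma count_at_ge0 (R : realType) (n : nat) (E : finType) (inc : 'I_n -> E -> bool)
    (k : nat) (v : 'I_n) (d : nat) : 0 <= count_at R inc k v d.
Proof. exact: sumr_ge0. Qed.

Lemma weight_at_ge0 (R : realType) (n : nat) (E : finType) (inc : 'I_n -> E -> bool)
    (k : nat) (b p : R) (v : 'I_n) (d : nat) (D : R) : 0 <= weight_at inc k b p v d D.
Proof. by apply: sumr_ge0 => x _; case: ifP => // _; exact: expR_ge0. Qed.

Lemma weight_at_mono (R : realType) (n : nat) (E : finType) (inc : 'I_n -> E -> bool)
    (k : nat) (b p : R) (v : 'I_n) (d : nat) (D D' : R) : D <= D' ->
  weight_at inc k b p v d D <= weight_at inc k b p v d D'.
Proof.
move=> DD; apply: ler_sum => x _; case: ifPn => h; first by rewrite (le_trans h).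
by case: ifP => // _; exact: expR_ge0.
Qed.

(** [weight_at] and [count_at] obey the same recursion in the degree, the former up to a factor
    [1 - th] and a shift of the threshold, so their ratio moves by at most that factor per step. The
    inequality is cross-multiplied to avoid dividing by a count. *)
Lemma telescope_from_below (R : realType) (n : nat) (E : finType) (inc : 'I_n -> E -> bool)
    (k : nat) (b p th Dm : R) (v : 'I_n) : incidence inc -> 0 <= b -> 0 <= th -> th < 1 ->
  n%:R < #|E|%:R - k%:R :> R -> n%:R < k%:R :> R ->
  2 * b * n%:R * (Dm + n%:R) <= th * (#|E|%:R - k%:R - n%:R) ->
  forall (j d : nat) (D : R), (d + j < n)%N -> D + 4 * j%:R <= Dm ->
  (1 - th) ^+ j * weight_at inc k b p v (d + j) D * count_at R inc k v d <=
  count_at R inc k v (d + j) * weight_at inc k b p v d (D + 4 * j%:R).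
Proof.
move=> Einc b0 th0 th1 N1 N2 C; elim=> [|j IH] d D dn Dle.
  by rewrite addn0 expr0 mul1r mulr0 addr0 mulrC.
rewrite addnS in dn *; set d' := (d + j)%N in dn *.
have j0 : 0 <= j%:R :> R by [].
have jS : j.+1%:R = j%:R + 1 :> R by rewrite -natr1.
have dn1 : d'.+1%:R <= n%:R :> R by rewrite ler_nat ltnW.
have dS : d'.+1%:R = d'%:R + 1 :> R by rewrite -natr1.
have d0 : 0 <= d'%:R :> R by [].
have nn : n.-1%:R <= n%:R :> R by rewrite ler_nat leq_pred.
have rD0 : 0 < rate_down R n #|E| k d' by rewrite /rate_down mulr_gt0 //; lra.
have rU0 : 0 <= rate_up R n k d'.
  rewrite /rate_up mulr_ge0 ?subr_ge0 //; first lra.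
  by rewrite ler_nat; lia.
have H1 : (1 - th) * (rate_down R n #|E| k d' * weight_at inc k b p v d'.+1 D) <=
    rate_up R n k d' * weight_at inc k b p v d' (D + 4).
  apply: weight_at_down => //; apply: (@le_trans _ _ (2 * b * n%:R * (Dm + n%:R))).
    by rewrite ler_wpM2l ?mulr_ge0 // lerD2r; lra.
  apply: (le_trans C); rewrite ler_wpM2l //; lra.
have H2 : (1 - th) ^+ j * weight_at inc k b p v d' (D + 4) * count_at R inc k v d <=
    count_at R inc k v d' * weight_at inc k b p v d (D + 4 * j.+1%:R).
  have -> : D + 4 * j.+1%:R = D + 4 + 4 * j%:R by rewrite jS; ring.
  by apply: IH; [exact: ltnW|lra].
have H3 := count_at_balance R k d' v Einc.
have t0 : 0 <= (1 - th) ^+ j by rewrite exprn_ge0 // subr_ge0 ltW.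
rewrite -(ler_pM2l rD0).
have c0 := count_at_ge0 R inc k v d.
have -> : rate_down R n #|E| k d' * ((1 - th) ^+ j.+1 * weight_at inc k b p v d'.+1 D *
   count_at R inc k v d) = ((1 - th) ^+ j * count_at R inc k v d) *
   ((1 - th) * (rate_down R n #|E| k d' * weight_at inc k b p v d'.+1 D)).
  by rewrite exprS; ring.
apply: le_trans (ler_wpM2l (mulr_ge0 t0 c0) H1) _.
have -> : (1 - th) ^+ j * count_at R inc k v d * (rate_up R n k d' * weight_at inc k b p v d' (D + 4)) =
  rate_up R n k d' * ((1 - th) ^+ j * weight_at inc k b p v d' (D + 4) * count_at R inc k v d) by ring.
apply: le_trans (ler_wpM2l rU0 H2) _.
by rewrite !mulrA H3.
Qed.

Lemma telescope_from_above (R : realType) (n : nat) (E : finType) (inc : 'I_n -> E -> bool)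
    (k : nat) (b p th Dm : R) (v : 'I_n) : incidence inc -> 0 <= b -> 0 <= th -> th < 1 ->
  n%:R < #|E|%:R - k%:R :> R -> n%:R < k%:R :> R ->
  2 * b * n%:R * (Dm + n%:R) <= th * (k%:R - n%:R) ->
  forall (j d : nat) (D : R), (d + j < n)%N -> D + 4 * j%:R <= Dm ->
  (1 - th) ^+ j * weight_at inc k b p v d D * count_at R inc k v (d + j) <=
  count_at R inc k v d * weight_at inc k b p v (d + j) (D + 4 * j%:R).
Proof.
move=> Einc b0 th0 th1 N1 N2 C; elim=> [|j IH] d D dn Dle.
  by rewrite addn0 expr0 mul1r mulr0 addr0 mulrC.
rewrite addnS -addSn in dn *.
have j0 : 0 <= j%:R :> R by [].
have jS : j.+1%:R = j%:R + 1 :> R by rewrite -natr1.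
have dn1 : d%:R <= n%:R :> R by rewrite ler_nat; lia.
have d0 : 0 <= d%:R :> R by [].
have nn : n.-1%:R <= n%:R :> R by rewrite ler_nat leq_pred.
have rU0 : 0 < rate_up R n k d.
  rewrite /rate_up mulr_gt0 ?subr_gt0 //; first lra.
  by rewrite ltr_nat; lia.
have rD0 : 0 <= rate_down R n #|E| k d.
  by have : 0 <= d.+1%:R :> R := ler0n _ _; move=> ?; rewrite /rate_down mulr_ge0 //; lra.
have H1 : (1 - th) * (rate_up R n k d * weight_at inc k b p v d D) <=
    rate_down R n #|E| k d * weight_at inc k b p v d.+1 (D + 4).
  apply: weight_at_up => //; apply: (@le_trans _ _ (2 * b * n%:R * (Dm + n%:R))).
    by rewrite ler_wpM2l ?mulr_ge0 // lerD2r; lra.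
  apply: (le_trans C); rewrite ler_wpM2l //; lra.
have H2 : (1 - th) ^+ j * weight_at inc k b p v d.+1 (D + 4) * count_at R inc k v (d.+1 + j) <=
    count_at R inc k v d.+1 * weight_at inc k b p v (d.+1 + j) (D + 4 * j.+1%:R).
  have -> : D + 4 * j.+1%:R = D + 4 + 4 * j%:R by rewrite jS; ring.
  by apply: IH => //; lra.
have H3 := count_at_balance R k d v Einc.
have t0 : 0 <= (1 - th) ^+ j by rewrite exprn_ge0 // subr_ge0 ltW.
rewrite -(ler_pM2l rU0).
have c0 := count_at_ge0 R inc k v (d.+1 + j).
set c := count_at R inc k v (d.+1 + j) in H2 c0 *.
have -> : rate_up R n k d * ((1 - th) ^+ j.+1 * weight_at inc k b p v d D * c) =
   ((1 - th) ^+ j * c) * ((1 - th) * (rate_up R n k d * weight_at inc k b p v d D)).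
  by rewrite exprS; ring.
apply: le_trans (ler_wpM2l (mulr_ge0 t0 c0) H1) _.
have -> : (1 - th) ^+ j * c * (rate_down R n #|E| k d * weight_at inc k b p v d.+1 (D + 4)) =
  rate_down R n #|E| k d * ((1 - th) ^+ j * weight_at inc k b p v d.+1 (D + 4) * c) by ring.
apply: le_trans (ler_wpM2l rD0 H2) _.
by rewrite !mulrA H3.
Qed.

Lemma sum_by_degree (R : realType) (n : nat) (E : finType) (inc : 'I_n -> E -> bool)
    (P : pred {ffun E -> bool}) (v : 'I_n) (F : {ffun E -> bool} -> R) : incidence inc ->
  \sum_(d < n) \sum_(x | P x && (degree inc x v == d)) F x = \sum_(x | P x) F x.
Proof.
move=> Einc.
by rewrite [RHS](partition_big (fun x => Ordinal (degree_lt x v Einc)) predT).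
Qed.

(** Summing the telescoped comparison over every reference degree [d0] yields totals: up to the
    raised threshold, degree [d] is at most [(1 - th) ^- n] times as likely under the weights off
    [v] as under the uniform law. At most [n] steps raise the threshold by [4 n]; the fifth [n]
    comes from comparing deviations with and without [v]. *)
Lemma weight_at_le (R : realType) (n : nat) (E : finType) (inc : 'I_n -> E -> bool)
    (k : nat) (b p th D : R) (v : 'I_n) (d : nat) : incidence inc -> 0 <= b -> 0 <= th -> th < 1 ->
  n%:R < #|E|%:R - k%:R :> R -> n%:R < k%:R :> R ->
  2 * b * n%:R * (D + 5 * n%:R) <= th * (#|E|%:R - k%:R - n%:R) ->
  2 * b * n%:R * (D + 5 * n%:R) <= th * (k%:R - n%:R) -> (d < n)%N ->
  (1 - th) ^+ n * weight_at inc k b p v d D * (\sum_(x : {ffun E -> bool} | has_size k x) 1) <=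
  count_at R inc k v d * \sum_(x | has_size k x)
    (if total_dev inc p x <= D + 4 * n%:R then weight_off inc b p v x else 0).
Proof.
move=> Einc b0 th0 th1 N1 N2 C1 C2 dn.
rewrite -[X in _ * X <= _](sum_by_degree _ v _ Einc).
rewrite -[X in _ <= _ * X](sum_by_degree _ v _ Einc).
rewrite [leLHS]mulr_sumr [leRHS]mulr_sumr; apply: ler_sum => d0 _.
rewrite -/(count_at R inc k v d0) -/(weight_at inc k b p v d0 (D + 4 * n%:R)).
have C1' : 2 * b * n%:R * (D + 4 * n%:R + n%:R) <= th * (#|E|%:R - k%:R - n%:R).
  by have -> : D + 4 * n%:R + n%:R = D + 5 * n%:R by ring.
have C2' : 2 * b * n%:R * (D + 4 * n%:R + n%:R) <= th * (k%:R - n%:R).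
  by have -> : D + 4 * n%:R + n%:R = D + 5 * n%:R by ring.
suff [j [jn H]] : exists j : nat, (j <= n)%N /\
    (1 - th) ^+ j * weight_at inc k b p v d D * count_at R inc k v d0 <=
    count_at R inc k v d * weight_at inc k b p v d0 (D + 4 * j%:R).
  have jn' : D + 4 * j%:R <= D + 4 * n%:R by rewrite lerD2l ler_wpM2l // ler_nat.
  apply: (le_trans _ (ler_wpM2l (count_at_ge0 R inc k v d) (weight_at_mono inc k b p v d0 jn'))).
  apply: (le_trans _ H).
  rewrite ler_wpM2r ?count_at_ge0 // ler_wpM2r ?weight_at_ge0 //.
  by apply: ler_wiXn2l => //; lra.
have jle (j : nat) : (j <= n)%N -> D + 4 * j%:R <= D + 4 * n%:R.
  by move=> jn; rewrite lerD2l ler_wpM2l // ler_nat.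
case: (leqP d0 d) => dd.
  exists (d - d0)%N; have jn : (d - d0 <= n)%N by rewrite (leq_trans (leq_subr _ _)) // ltnW.
  split => //.
  have := telescope_from_below p v Einc b0 th0 th1 N1 N2 C1' (d := d0) (j := d - d0) (D := D).
  by rewrite subnKC //; apply => //; exact: jle.
exists (d0 - d)%N; have jn : (d0 - d <= n)%N by rewrite (leq_trans (leq_subr _ _)) // ltnW.
split => //.
have := telescope_from_above p v Einc b0 th0 th1 N1 N2 C2' (d := d) (j := d0 - d) (D := D).
by rewrite (subnKC (ltnW dd)); apply => //; exact: jle.
Qed.

Lemma count_at_le (R : realType) (n : nat) (E : finType) (inc : 'I_n -> E -> bool)
    (k d : nat) (p K : R) (v : 'I_n) :
  incidence inc -> 0 < p < 1 -> k%:R = #|E|%:R * p -> 0 < K -> K <= c_kaw p ->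
  count_at R inc k v d <= #|E|.+1%:R * (\sum_(x : {ffun E -> bool} | has_size k x) 1) *
    expR (- (K * (d%:R - n.-1%:R * p) ^+ 2 / n%:R)).
Proof.
move=> Einc p01 kp K0 Kc.
have nR : 0 < n%:R :> R by rewrite ltr0n (leq_ltn_trans (leq0n v) (ltn_ord v)).
set z := d%:R - _; set l := 2 * K * z / n%:R.
pose lv u := if u == v then l else 0.
have lsum (F : 'I_n -> R) : \sum_u lv u * F u = l * F v.
  rewrite (bigD1 v) //= /lv eqxx big1 ?addr0 // => u uv.
  by rewrite (negbTE uv) mul0r.
apply: (@le_trans _ _ (\sum_(x | has_size k x) expR (- (l * z)) *
   expR (\sum_u lv u * ((degree inc x u)%:R - n.-1%:R * p)))).
  rewrite /count_at [leRHS](bigID (fun x => degree inc x v == d)) /= -[leLHS]addr0 lerD //.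
    apply: ler_sum => x /andP[_ /eqP dx].
    by rewrite lsum dx -expRD addNr expR0.
  by apply: sumr_ge0 => x _; rewrite mulr_ge0 ?expR_ge0.
rewrite -mulr_sumr; apply: le_trans (ler_wpM2l (expR_ge0 _) (uniform_mgf lv Einc p01 kp K0 Kc)) _.
rewrite mulrCA ler_wpM2l //; first by rewrite mulr_ge0 // sumr_ge0.
rewrite -expRD ler_expR.
have -> : \sum_e (\sum_u lv u * (inc u e)%:R) ^+ 2 = l ^+ 2 * n.-1%:R.
  rewrite -(sum_inc v Einc) natr_sum mulr_sumr; apply: eq_bigr => e _.
  by rewrite lsum exprMn; case: (inc v e); rewrite ?expr1n ?expr0n.
apply: (@le_trans _ _ (- (l * z) + l ^+ 2 * n%:R / (4 * K))).
  rewrite lerD2l ler_wpM2r ?invr_ge0 ?mulr_ge0 ?(ltW K0) // ler_wpM2l ?sqr_ge0 //.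
  by rewrite ler_nat leq_pred.
rewrite le_eqVlt; apply/orP; left; apply/eqP.
by rewrite /l; field; rewrite !gt_eqF.
Qed.

(* Given the rest of the graph, the degree of [v] is nearly binomial, tilted
   by its own energy [exp (b z ^ 2)] only. *)
Lemma vertex_deviation_at (R : realType) (n : nat) (E : finType) (inc : 'I_n -> E -> bool)
    (k d : nat) (p K b th D : R) (v : 'I_n) :
  incidence inc -> 0 < p < 1 -> k%:R = #|E|%:R * p -> 0 < K -> K <= c_kaw p ->
  0 <= b -> 0 <= th -> th < 1 ->
  n%:R < #|E|%:R - k%:R :> R -> n%:R < k%:R :> R ->
  2 * b * n%:R * (D + 5 * n%:R) <= th * (#|E|%:R - k%:R - n%:R) ->
  2 * b * n%:R * (D + 5 * n%:R) <= th * (k%:R - n%:R) -> (d < n)%N ->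
  (1 - th) ^+ n * \sum_(x | has_size k x && (total_dev inc p x <= D) && (degree inc x v == d))
    expR (energy inc b p x) <=
  #|E|.+1%:R * expR (- ((K - b * n%:R) * (d%:R - n.-1%:R * p) ^+ 2 / n%:R) +
     2 * b * (2 * D + 5 * n%:R)) * \sum_(x | has_size k x) expR (energy inc b p x).
Proof.
move=> Einc p01 kp K0 Kc b0 th0 th1 N1 N2 C1 C2 dn.
set z := d%:R - _.
have nR : 0 < n%:R :> R by rewrite ltr0n (leq_ltn_trans (leq0n d) dn).
set S := \sum_(x | _ && _ && _) _.
set c := \sum_(x : {ffun E -> bool} | has_size k x) (1 : R).
set Z := \sum_(x | has_size k x) expR (energy _ _ _ _).
have qE x : energy inc b p x = b * degree_dev inc p x v ^+ 2 + b * \sum_(u | u != v) degree_dev inc p x u ^+ 2.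
  by rewrite /energy (bigD1 v) //= mulrDr.
have tn0 : 0 <= (1 - th) ^+ n by rewrite exprn_ge0 // subr_ge0 ltW.
have SA : S <= expR (b * z ^+ 2 + b * (2 * D + n%:R)) * weight_at inc k b p v d D.
  have -> : S = \sum_(x | has_size k x && (degree inc x v == d))
      (if total_dev inc p x <= D then expR (energy inc b p x) else 0).
    rewrite -big_mkcondr; apply: eq_bigl => x.
    by rewrite -!andbA [(total_dev _ _ _ <= _) && _]andbC.
  rewrite /weight_at mulr_sumr; apply: ler_sum => x /andP[xk /eqP dx].
  case: ifPn => xD; last by rewrite mulr0.
  rewrite -expRD ler_expR qE /degree_dev dx -/z -addrA lerD2l -mulrDr ler_wpM2l //.
  have := dev_off_sum_sq p v x Einc; rewrite ler_norml => /andP[_]; lra.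
(* Here the total deviation is at most [D + 4 n], so the correction is [2 (D + 4 n) + n]; with the
   [2 D + n] of the previous bound it makes [2 (2 D + 5 n)]. *)
have WZ : \sum_(x | has_size k x) (if total_dev inc p x <= D + 4 * n%:R then weight_off inc b p v x else 0) <=
    expR (b * (2 * D + 9 * n%:R)) * Z.
  rewrite /Z mulr_sumr; apply: ler_sum => x xk.
  case: ifPn => xD; last by rewrite mulr_ge0 ?expR_ge0.
  rewrite -expRD ler_expR qE.
  have := dev_off_sum_sq p v x Einc; rewrite ler_norml => /andP[H _].
  have := sqr_ge0 (degree_dev inc p x v) => H2.
  rewrite -!mulrDr ler_wpM2l //; lra.
have [c0|c0] := ltP 0 c; last first.
  have z0 : c = 0 by apply/le_anti; rewrite c0 sumr_ge0.
  have noK (x : {ffun E -> bool}) : has_size k x = false.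
    apply/negP => xk; move: c0; rewrite /c (bigD1 x) //= leNgt => /negP; apply.
    by rewrite ltr_pwDl // sumr_ge0.
  rewrite /S big_pred0; last by move=> x; rewrite noK.
  by rewrite mulr0 mulr_ge0 ?mulr_ge0 ?expR_ge0 // sumr_ge0 // => x _; exact: expR_ge0.
have := weight_at_le p v Einc b0 th0 th1 N1 N2 C1 C2 dn; rewrite -/c => H.
have Z0 : 0 <= Z by apply: sumr_ge0 => x _; exact: expR_ge0.
have {H} : (1 - th) ^+ n * weight_at inc k b p v d D * c <=
   #|E|.+1%:R * c * expR (- (K * z ^+ 2 / n%:R)) * (expR (b * (2 * D + 9 * n%:R)) * Z).
  apply: (le_trans H); rewrite ler_pM ?count_at_ge0 //.
    by apply: sumr_ge0 => x _; case: ifP => // _; exact: expR_ge0.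
  exact: count_at_le.
have -> : #|E|.+1%:R * c * expR (- (K * z ^+ 2 / n%:R)) * (expR (b * (2 * D + 9 * n%:R)) * Z) =
   (#|E|.+1%:R * expR (- (K * z ^+ 2 / n%:R)) * expR (b * (2 * D + 9 * n%:R)) * Z) * c by ring.
rewrite ler_pM2r // => H.
apply: le_trans (ler_wpM2l tn0 SA) _.
rewrite mulrCA; apply: le_trans (ler_wpM2l (expR_ge0 _) H) _.
rewrite !mulrA ler_wpM2r // [expR _ * #|E|.+1%:R]mulrC -!mulrA ler_wpM2l //.
rewrite -!expRD ler_expR le_eqVlt; apply/orP; left; apply/eqP.
by field; rewrite gt_eqF.
Qed.

Lemma vertex_deviation (R : realType) (n : nat) (E : finType) (inc : 'I_n -> E -> bool)
    (k : nat) (p K b th D e : R) :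
  incidence inc -> 0 < p < 1 -> k%:R = #|E|%:R * p -> 0 < K -> K <= c_kaw p ->
  0 <= b -> b * n%:R <= K -> 0 <= th -> th < 1 -> 0 <= e ->
  n%:R < #|E|%:R - k%:R :> R -> n%:R < k%:R :> R ->
  2 * b * n%:R * (D + 5 * n%:R) <= th * (#|E|%:R - k%:R - n%:R) ->
  2 * b * n%:R * (D + 5 * n%:R) <= th * (k%:R - n%:R) ->
  (1 - th) ^+ n * \sum_(x | has_size k x && (total_dev inc p x <= D) &&
       [exists v, e * n%:R < `|degree_dev inc p x v|]) expR (energy inc b p x) <=
  n%:R ^+ 2 * (#|E|.+1%:R * expR (- ((K - b * n%:R) * e ^+ 2 * n%:R) +
     2 * b * (2 * D + 5 * n%:R)) * \sum_(x | has_size k x) expR (energy inc b p x)).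
Proof.
move=> Einc p01 kp K0 Kc b0 bK th0 th1 e0 N1 N2 C1 C2.
have tn0 : 0 <= (1 - th) ^+ n by rewrite exprn_ge0 // subr_ge0 ltW.
set bd := _ * \sum_(x | has_size k x) _.
have bd0 : 0 <= bd.
  by rewrite /bd mulr_ge0 ?mulr_ge0 ?expR_ge0 // sumr_ge0 // => x _; exact: expR_ge0.
pose S v (d : 'I_n) := \sum_(x | has_size k x && (total_dev inc p x <= D) && (degree inc x v == d))
   (if e * n%:R < `|degree_dev inc p x v| then expR (energy inc b p x) else 0).
apply: (@le_trans _ _ ((1 - th) ^+ n * \sum_v \sum_d S v d)).
  rewrite ler_wpM2l //.
  under [leRHS]eq_bigr do rewrite sum_by_degree //.
  rewrite exchange_big /= big_mkcondr; apply: ler_sum => x _.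
  have nn v : 0 <= (if e * n%:R < `|degree_dev inc p x v| then expR (energy inc b p x) else 0).
    by case: ifP => // _; exact: expR_ge0.
  case: ifPn => [/existsP[v hv]|_]; last by apply: sumr_ge0.
  by rewrite (bigD1 v) //= hv lerDl sumr_ge0.
rewrite !mulr_sumr; apply: (@le_trans _ _ (\sum_(v < n) \sum_(d < n) bd)); last first.
  by rewrite !sumr_const !card_ord -mulrnA -[leLHS]mulr_natl natrM expr2.
apply: ler_sum => v _; rewrite mulr_sumr; apply: ler_sum => d _.
have nR : 0 < n%:R :> R by rewrite ltr0n (leq_ltn_trans (leq0n v) (ltn_ord v)).
have [big|small] := ltP (e * n%:R) `|d%:R - n.-1%:R * p|; last first.
  rewrite /S big1 ?mulr0 // => x /andP[_ /eqP dx].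
  by rewrite /degree_dev dx ltNge small.
apply: (@le_trans _ _ ((1 - th) ^+ n * \sum_(x | has_size k x && (total_dev inc p x <= D) && (degree inc x v == d))
    expR (energy inc b p x))).
  rewrite ler_wpM2l //; apply: ler_sum => x _.
  by case: ifP => // _; exact: expR_ge0.
apply: le_trans (vertex_deviation_at v Einc p01 kp K0 Kc b0 th0 th1 N1 N2 C1 C2 (ltn_ord d)) _.
rewrite /bd ler_wpM2r //; first by apply: sumr_ge0 => x _; exact: expR_ge0.
rewrite ler_wpM2l // ler_expR lerD2r lerN2.
have KB : 0 <= K - b * n%:R by rewrite subr_ge0.
have H : e ^+ 2 * n%:R <= (d%:R - n.-1%:R * p) ^+ 2 / n%:R.
  rewrite ler_pdivlMr //.
  have : (e * n%:R) ^+ 2 <= `|d%:R - n.-1%:R * p| ^+ 2.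
    by rewrite lerXn2r ?nnegrE ?mulr_ge0 // ltW.
  rewrite real_normK ?num_real //; congr (is_true (_ <= _)); ring.
have := ler_wpM2l KB H; congr (is_true (_ <= _)); ring.
Qed.

(** * Choice of constants and exponential concentration *)

Lemma eventually_ge (R : realType) (M : R) : exists n0 : nat, forall n, (n0 <= n)%N -> M <= n%:R.
Proof.
exists (Num.bound `|M|) => n nn.
apply: (le_trans (ler_norm M)); apply: ltW; apply: (lt_le_trans (archi_boundP (normr_ge0 M))).
by rewrite ler_nat.
Qed.

Lemma pow_le_expR (R : realType) (c : R) (m n : nat) : 0 < c ->
  n%:R ^+ m.+1 <= (m.+1%:R / c) ^+ m.+1 * expR (c * n%:R).
Proof.
move=> c0.
have -> : expR (c * n%:R) = expR (c * n%:R / m.+1%:R) ^+ m.+1.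
  by rewrite -expRM_natl; congr expR; rewrite [RHS]mulrC divfK // pnatr_eq0.
rewrite -exprMn lerXn2r ?nnegrE //.
  by rewrite mulr_ge0 ?expR_ge0 // divr_ge0 // ltW.
have h : c * n%:R / m.+1%:R <= expR (c * n%:R / m.+1%:R).
  by apply: (le_trans _ (expR_ge1Dx _)); rewrite lerDr.
apply: (@le_trans _ _ (m.+1%:R / c * (c * n%:R / m.+1%:R))).
  have : m.+1%:R != 0 :> R by rewrite pnatr_eq0.
  move: (m.+1%:R) => s s0; rewrite le_eqVlt; apply/orP; left; apply/eqP.
  by field; rewrite s0 gt_eqF.
by rewrite ler_wpM2l // divr_ge0 // ltW.
Qed.

Lemma succ_le_expR (R : realType) (a : R) (n : nat) : 0 < a -> 8 / a ^+ 2 <= n%:R -> (1 <= n)%N ->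
  n.+1%:R <= expR (a * n%:R).
Proof.
move=> a0 an n1.
have n1R : 1 <= n%:R :> R by rewrite ler1n.
have h : a * n%:R / 2 <= expR (a * n%:R / 2).
  by apply: (le_trans _ (expR_ge1Dx _)); rewrite lerDr.
have -> : a * n%:R = a * n%:R / 2 + a * n%:R / 2 by lra.
rewrite expRD; apply: (@le_trans _ _ (a * n%:R / 2 * (a * n%:R / 2))); last first.
  by rewrite ler_pM // divr_ge0 // mulr_ge0 // ltW.
have : 8 <= n%:R * a ^+ 2 by rewrite -ler_pdivrMr // exprn_gt0.
rewrite -natr1 => h2.
have -> : a * n%:R / 2 * (a * n%:R / 2) = (n%:R * a ^+ 2) * n%:R / 4 by lra.
by have := ler_wpM2r (ler0n R n) h2; lra.
Qed.

Lemma expR_le_1Bx (R : realType) (t : R) : 0 <= t -> t <= 2^-1 -> expR (- (2 * t)) <= 1 - t.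
Proof.
move=> t0 t2; rewrite expRN -[leRHS]invrK lef_pV2 ?posrE ?expR_gt0 ?invr_gt0 ?subr_gt0; [|lra..].
apply: (@le_trans _ _ (1 + 2 * t)); last exact: expR_ge1Dx.
have t1 : 0 < 1 - t by lra.
by rewrite -[leLHS]mul1r ler_pdivrMr //; nra.
Qed.

Lemma gibbs_concentration (R : realType) (eta eps : R) :
  0 < eta -> 0 < eps -> eps <= 1 ->
  exists (C c : R) (n0 : nat), [/\ 0 < C, 0 < c &
    forall (n : nat) (E : finType) (inc : 'I_n -> E -> bool) (k : nat) (p beta : R),
    (n0 <= n)%N -> incidence inc -> eta <= p -> p <= 1 - eta -> 0 <= beta ->
    beta <= (4 * eta)^-1 -> beta + eta <= c_kaw p -> k%:R = #|E|%:R * p ->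
    \sum_(x | has_size k x && [exists v, eps * n%:R < `|degree_dev inc p x v|])
       expR (energy inc (beta / n%:R) p x) <=
    C * expR (- (c * n%:R)) * \sum_(x | has_size k x) expR (energy inc (beta / n%:R) p x)].
Proof.
move=> eta0 eps0 eps1.
(* The exponent available is [eta * eps ^+ 2 * n]. The factor 35 makes the loss [2 * th] of the
   exchanges and the energy error, at most [6 * beta * dl], use up no more than half of it, as
   [16 / 35 + 6 / 140 = 1 / 2]. The other half is [2 * c]: one [c] for the decay, one to absorb
   [n ^ 4]. *)
pose dl := eta ^+ 3 * eps ^+ 2 / 35.
pose c := eta * eps ^+ 2 / 4.
(* The exponent [eta * dl ^+ 2 * n ^ 2] has four shares [a * n ^ 2]: one pays for the degree
   sequences, one for [#|E|.+1], and the remaining two exceed [c * n]. *)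
pose a := eta * dl ^+ 2 / 4.
have dl0 : 0 < dl by rewrite divr_gt0 // mulr_gt0 // exprn_gt0.
have c0 : 0 < c by rewrite divr_gt0 // mulr_gt0 // exprn_gt0.
have a0 : 0 < a by rewrite divr_gt0 // mulr_gt0 // exprn_gt0.
have [n0 Hn0] := eventually_ge (5 / dl + 4 / eta + 8 / a ^+ 2 + c / (2 * a) + 2).
exists (1 + (4 / c) ^+ 4), c, n0; split => //.
  by rewrite ltr_pwDl // exprn_ge0 // divr_ge0 // ltW.
move=> n E inc k p beta nn0 Einc p1 p2 b0 bB bc kp.
have := Hn0 _ nn0 => nM.
have q1 : 0 < 5 / dl by rewrite divr_gt0.
have q2 : 0 < 4 / eta by rewrite divr_gt0.
have q3 : 0 < 8 / a ^+ 2 by rewrite divr_gt0 // exprn_gt0.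
have q4 : 0 < c / (2 * a) by rewrite divr_gt0 // mulr_gt0.
have n2R : 2 <= n%:R :> R by lra.
have n2 : (2 <= n)%N by rewrite -(ler_nat R).
have nR : 0 < n%:R :> R by lra.
have nr : n.-1%:R = n%:R - 1 :> R by rewrite -subn1 natrB // ltnW.
have h1 : 5 <= n%:R * dl by rewrite -ler_pdivrMr //; lra.
have h2 : 4 <= n%:R * eta by rewrite -ler_pdivrMr //; lra.
have h3 : 8 / a ^+ 2 <= n%:R by lra.
have h4 : c <= n%:R * (2 * a) by rewrite -ler_pdivrMr ?mulr_gt0 //; lra.
have eta2 : eta <= 2^-1 by lra.
have p01 : 0 < p < 1 by lra.
have NE : 2 * #|E|%:R = n%:R * (n%:R - 1) :> R.
  by rewrite -nr -!natrM (card_edges_inc Einc).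
set b := beta / n%:R.
have b0' : 0 <= b by rewrite divr_ge0 // ltW.
have bn : b * n%:R = beta by rewrite /b divfK // gt_eqF.
have K0 : 0 < beta + eta by lra.
have bK : b * n%:R <= beta + eta by rewrite bn; lra.
have KB : beta + eta - b * n%:R = eta by rewrite bn; ring.
set Z := \sum_(x | has_size k x) expR (energy inc b p x).
have Z0 : 0 <= Z by apply: sumr_ge0 => x _; exact: expR_ge0.
have qge0 x : 0 <= energy inc b p x.
  by rewrite /energy mulr_ge0 // sumr_ge0 // => v _; exact: sqr_ge0.
have ZO : \sum_(x : {ffun E -> bool} | has_size k x) 1 <= Z.
  by apply: ler_sum => x _; rewrite -[leLHS]expR0 ler_expR.
have NE1 : #|E|.+1%:R <= n%:R ^+ 2 :> R.
  by rewrite -natr1; nra.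
have E1 : expR (- (c * n%:R)) * expR (c * n%:R) = 1 by rewrite -expRD addNr expR0.
have A1 : \sum_(x | has_size k x && (dl * n%:R ^+ 2 <= \sum_v `|degree_dev inc p x v|))
    expR (energy inc b p x) <= expR (- (c * n%:R)) * Z.
  apply: le_trans (total_deviation Einc _ p01 kp K0 bc b0' bK (ltW dl0)) _; first exact: ltnW.
  rewrite KB.
  have s1 := succ_le_expR a0 h3 (ltnW n2).
  have s2 : n.+1%:R ^+ n <= expR (a * n%:R ^+ 2).
    have -> : a * n%:R ^+ 2 = n%:R * (a * n%:R) by ring.
    by rewrite expRM_natl lerXn2r ?nnegrE ?expR_ge0.
  have s3 : #|E|.+1%:R <= expR (a * n%:R ^+ 2).
    apply: (le_trans NE1); apply: (@le_trans _ _ (n.+1%:R ^+ 2)).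
      by rewrite lerXn2r ?nnegrE // ler_nat.
    apply: (@le_trans _ _ (expR (a * n%:R) ^+ 2)).
      by rewrite lerXn2r ?nnegrE ?expR_ge0.
    by rewrite -expRM_natl ler_expR; have := ler_wpM2l (mulr_ge0 (ltW a0) (ltW nR)) n2R; lra.
  apply: (@le_trans _ _ (expR (a * n%:R ^+ 2) * (expR (a * n%:R ^+ 2) * Z *
     expR (- (eta * dl ^+ 2 * n%:R ^+ 2))))).
    rewrite ler_pM ?exprn_ge0 ?mulr_ge0 ?expR_ge0 ?sumr_ge0 //.
    by rewrite ler_wpM2r ?expR_ge0 // ler_pM // sumr_ge0.
  have -> : eta * dl ^+ 2 * n%:R ^+ 2 = a * n%:R ^+ 2 + a * n%:R ^+ 2 + 2 * (a * n%:R ^+ 2).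
    by rewrite /a; field.
  rewrite !opprD !expRD !expRN.
  have -> : expR (a * n%:R ^+ 2) * (expR (a * n%:R ^+ 2) * Z *
    ((expR (a * n%:R ^+ 2))^-1 / expR (a * n%:R ^+ 2) / expR (2 * (a * n%:R ^+ 2)))) =
    (expR (2 * (a * n%:R ^+ 2)))^-1 * Z.
    by field; rewrite !gt_eqF ?expR_gt0.
  rewrite -!expRN ler_wpM2r // ler_expR lerN2.
  by have := ler_wpM2r (ltW nR) h4; lra.
(* Chosen so that the loss over partners, at most [4 * beta * dl * n ^ 2], is below
   [th * (eta * n ^ 2 / 8)], where [eta * n ^ 2 / 8] bounds the number of partner edges from
   below. *)
pose th := 8 * eta * eps ^+ 2 / 35.
have e2 : 0 < eps ^+ 2 by rewrite exprn_gt0.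
have e21 : eps ^+ 2 <= 1 by rewrite expr_le1 // ltW.
have th0 : 0 <= th by rewrite divr_ge0 // !mulr_ge0 // ltW.
have th2 : th <= 2^-1 by rewrite /th; nra.
have bdl : beta * dl <= eta ^+ 2 * eps ^+ 2 / 140.
  apply: (le_trans (ler_wpM2r (ltW dl0) bB)).
  by rewrite /dl le_eqVlt; apply/orP; left; apply/eqP; field; rewrite gt_eqF.
have A2 : \sum_(x | has_size k x && (total_dev inc p x <= dl * n%:R ^+ 2) &&
       [exists v, eps * n%:R < `|degree_dev inc p x v|]) expR (energy inc b p x) <=
    (4 / c) ^+ 4 * expR (- (c * n%:R)) * Z.
  have half (y : R) : eta * #|E|%:R <= y -> eta * n%:R ^+ 2 / 8 <= y - n%:R.
    move=> yE; suff : eta * n%:R ^+ 2 / 8 + n%:R <= eta * #|E|%:R by lra.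
    have -> : #|E|%:R = n%:R * (n%:R - 1) / 2 :> R by rewrite -NE; field.
    have -> : eta * (n%:R * (n%:R - 1) / 2) = n%:R * (eta * (n%:R - 1) / 2) by ring.
    have -> : eta * n%:R ^+ 2 / 8 + n%:R = n%:R * (eta * n%:R / 8 + 1) by ring.
    by rewrite ler_pM2l //; lra.
  have E0 : 0 <= #|E|%:R :> R by [].
  have k1 : eta * n%:R ^+ 2 / 8 <= k%:R - n%:R.
    by apply: half; rewrite kp mulrC ler_wpM2l.
  have k2 : eta * n%:R ^+ 2 / 8 <= #|E|%:R - k%:R - n%:R.
    apply: half; rewrite kp -[X in X - _]mulr1 -mulrBr mulrC ler_wpM2l //; lra.
  have en0 : 0 < eta * n%:R ^+ 2 / 8 by rewrite divr_gt0 // mulr_gt0 // exprn_gt0.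
  have C0 : 2 * b * n%:R * (dl * n%:R ^+ 2 + 5 * n%:R) <= th * (eta * n%:R ^+ 2 / 8).
    have -> : 2 * b * n%:R = 2 * beta by rewrite -mulrA bn.
    apply: (@le_trans _ _ (2 * beta * (2 * dl * n%:R ^+ 2))).
      rewrite ler_wpM2l ?mulr_ge0 //.
      by have := ler_wpM2r (ltW nR) h1; lra.
    have -> : 2 * beta * (2 * dl * n%:R ^+ 2) = 4 * (beta * dl) * n%:R ^+ 2 by ring.
    have -> : th * (eta * n%:R ^+ 2 / 8) = 4 * (eta ^+ 2 * eps ^+ 2 / 140) * n%:R ^+ 2.
      by rewrite /th; field.
    by rewrite ler_wpM2r ?sqr_ge0 // ler_wpM2l.
  have th1 : th < 1 by lra.
  have := @vertex_deviation R n E inc k p (beta + eta) b th (dl * n%:R ^+ 2) eps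
    Einc p01 kp K0 bc b0' bK th0 th1 (ltW eps0).
  rewrite KB -/Z => /(_ _ _ _ _) H.
  have {H} := H _ _ (le_trans C0 (ler_wpM2l th0 k2)) (le_trans C0 (ler_wpM2l th0 k1)).
  move=> /(_ _ _) H; have {H} := H ltac:(lra) ltac:(lra).
  set S := \sum_(x | _) _ => H.
  have S0 : 0 <= S by apply: sumr_ge0 => x _; exact: expR_ge0.
  have T1 : expR (- (2 * th * n%:R)) <= (1 - th) ^+ n.
    have -> : - (2 * th * n%:R) = n%:R * - (2 * th) by ring.
    by rewrite expRM_natl lerXn2r ?nnegrE ?expR_ge0 ?expR_le_1Bx //; lra.
  have {H T1} H : expR (- (2 * th * n%:R)) * S <= n%:R ^+ 2 * (n%:R ^+ 2 *
      expR (- (eta * eps ^+ 2 * n%:R) + 2 * b * (2 * (dl * n%:R ^+ 2) + 5 * n%:R)) * Z).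
    apply: (le_trans (ler_wpM2r S0 T1)); apply: (le_trans H).
    by rewrite ler_wpM2l ?sqr_ge0 // ler_wpM2r // ler_wpM2r ?expR_ge0.
  rewrite -(ler_pM2l (expR_gt0 (- (2 * th * n%:R)))); apply: (le_trans H).
  have P4 := @pow_le_expR R c 3 n c0.
  have ex : - (eta * eps ^+ 2 * n%:R) + 2 * b * (2 * (dl * n%:R ^+ 2) + 5 * n%:R) <=
     - (2 * th * n%:R) - 2 * (c * n%:R).
    have -> : 2 * b * (2 * (dl * n%:R ^+ 2) + 5 * n%:R) = 2 * (b * n%:R) * (2 * (dl * n%:R) + 5) by ring.
    rewrite bn.
    have : 2 * beta * (2 * (dl * n%:R) + 5) <= 6 * (eta ^+ 2 * eps ^+ 2 / 140) * n%:R.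
      apply: (@le_trans _ _ (2 * beta * (3 * (dl * n%:R)))).
        by rewrite ler_wpM2l ?mulr_ge0 //; lra.
      have -> : 2 * beta * (3 * (dl * n%:R)) = 6 * (beta * dl) * n%:R by ring.
      by rewrite ler_wpM2r // ler_wpM2l.
    have ee : eta ^+ 2 * eps ^+ 2 <= eta * eps ^+ 2.
      by rewrite ler_wpM2r ?(ltW e2) // expr2 -[leRHS]mul1r ler_wpM2r ?(ltW eta0) //; lra.
    have := ler_wpM2r (ltW nR) ee.
    have -> : th = 8 * (eta * eps ^+ 2) / 35 by rewrite /th; ring.
    rewrite /c; move: (eta ^+ 2 * eps ^+ 2) (eta * eps ^+ 2) => u w uw H6.
    lra.
  have ex0 := ex; rewrite -ler_expR in ex0.
  apply: (@le_trans _ _ (n%:R ^+ 4 * (expR (- (2 * th * n%:R) - 2 * (c * n%:R)) * Z))).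
    have -> : n%:R ^+ 4 = n%:R ^+ 2 * n%:R ^+ 2 :> R by rewrite -exprD.
    have := ler_wpM2r Z0 ex0; set X := expR _; set Y := expR _ => H5.
    have := ler_wpM2l (mulr_ge0 (sqr_ge0 (n%:R : R)) (sqr_ge0 n%:R)) H5.
    by congr (is_true (_ <= _)); ring.
  have -> : - (2 * th * n%:R) - 2 * (c * n%:R) = - (2 * th * n%:R) + - (c * n%:R) + - (c * n%:R) by ring.
  rewrite !expRD.
  apply: (@le_trans _ _ ((4 / c) ^+ 4 * expR (c * n%:R) * (expR (- (2 * th * n%:R)) *
      expR (- (c * n%:R)) * expR (- (c * n%:R)) * Z))).
    by rewrite ler_wpM2r // !mulr_ge0 ?expR_ge0.
  rewrite le_eqVlt; apply/orP; left; apply/eqP.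
  transitivity ((4 / c) ^+ 4 * expR (- (2 * th * n%:R)) * expR (- (c * n%:R)) * Z *
    (expR (- (c * n%:R)) * expR (c * n%:R))); first by ring.
  by rewrite E1; ring.
apply: (@le_trans _ _ (expR (- (c * n%:R)) * Z + (4 / c) ^+ 4 * expR (- (c * n%:R)) * Z)); last by lra.
apply: le_trans (lerD A1 A2).
rewrite (bigID (fun x => total_dev inc p x <= dl * n%:R ^+ 2)) /= addrC lerD //.
  rewrite [leRHS]big_mkcond [leLHS]big_mkcond; apply: ler_sum => x _.
  case: (has_size k x) => //=; rewrite -/(total_dev inc p x).
  case: (leP (total_dev inc p x)) => [_|/ltW ->]; last by rewrite andbT; case: ifP => // _; exact: expR_ge0.
  by rewrite andbF; case: ifP => // _; exact: expR_ge0.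
rewrite (eq_bigl (fun x => has_size k x && (total_dev inc p x <= dl * n%:R ^+ 2) &&
       [exists v, eps * n%:R < `|degree_dev inc p x v|])) // => x.
by rewrite andbAC.
Qed.

(** * Weak Poincare inequality *)

(** The quantity is [u v / (u + v)] for the weights [u] and [v]; detailed balance makes it
    symmetric, so the weights can be raised one at a time. *)
Lemma conductance_mono (R : realType) (a b a' b' : R) : a <= a' -> b <= b' ->
  expR a * logistic (b - a) <= expR a' * logistic (b' - a').
Proof.
move=> aa bb; apply: (@le_trans _ _ (expR a * logistic (b' - a))).
  by rewrite ler_wpM2l ?expR_ge0 // logistic_mono // lerD2r.
by rewrite !(logistic_balance _ b') ler_wpM2l ?expR_ge0 // logistic_mono // lerD2r.
Qed.

Lemma huber_energy_le (R : realType) (n : nat) (E : finType) (inc : 'I_n -> E -> bool)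
    (b m p : R) (x : {ffun E -> bool}) : 0 <= b ->
  huber_energy inc b m (n.-1%:R * p) x <= energy inc b p x.
Proof.
by move=> b0; rewrite ler_wpM2l //; apply: ler_sum => v _; exact: huber_le.
Qed.

Lemma huber_energy_eq (R : realType) (n : nat) (E : finType) (inc : 'I_n -> E -> bool)
    (b m p : R) (x : {ffun E -> bool}) : ~~ [exists v, m < `|degree_dev inc p x v|] ->
  huber_energy inc b m (n.-1%:R * p) x = energy inc b p x.
Proof.
rewrite negb_exists => /forallP h; congr (_ * _); apply: eq_bigr => v _.
by rewrite huber_in // leNgt; exact: h.
Qed.

Lemma kawasaki_gap (R : realType) (eta : R) : 0 < eta ->
  exists n0 : nat, forall (n : nat) (E : finType) (inc : 'I_n -> E -> bool) (k : nat)
     (p beta m : R) (H f : {ffun E -> bool} -> R),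
    (n0 <= n)%N -> incidence inc -> eta <= p -> p <= 1 - eta -> 0 <= beta ->
    beta <= (4 * eta)^-1 -> 4 * beta * p * (1 - p) <= 2^-1 - eta -> k%:R = #|E|%:R * p ->
    H = huber_energy inc (beta / n%:R) (eta ^+ 2 / 6 * n%:R) (n.-1%:R * p) ->
    m = (\sum_(x | has_size k x) expR (H x) * f x) / \sum_(x | has_size k x) expR (H x) ->
    eta * #|E|%:R * \sum_(x | has_size k x) expR (H x) * (f x - m) ^+ 2 <=
    \sum_(x | has_size k x) \sum_(s | x s) \sum_(t | ~~ x t)
      expR (H x) * logistic (H (exch x s t) - H x) * (f (exch x s t) - f x) ^+ 2.
Proof.
move=> eta0.
have [n0 Hn0] := eventually_ge (6 / eta ^+ 2 + 4).
exists n0 => n E inc k p beta m H f nn0 Einc p1 p2 b0 bB b4 kp HE mE.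
have e20 : 0 < eta ^+ 2 by rewrite exprn_gt0.
have nM := Hn0 _ nn0.
have q1 : 0 < 6 / eta ^+ 2 by rewrite divr_gt0.
have nR4 : 4 <= n%:R :> R by lra.
have nR : 0 < n%:R :> R by lra.
have n4 : (4 <= n)%N by rewrite -(ler_nat R).
have eta2 : eta <= 2^-1 by lra.
have p01 : 0 < p < 1 by lra.
(* Since [beta * eta <= 1/4], this cut-off gives [b * mm <= eta / 24], so the two errors
   [6 * (b * mm)] and [6 * b] in the gap each take at most a quarter of the margin [eta], and half
   of it is left. *)
pose mm : R := eta ^+ 2 / 6 * n%:R.
have mm1 : 1 <= mm.
  have : 6 <= n%:R * eta ^+ 2 by rewrite -ler_pdivrMr //; lra.
  by rewrite /mm; lra.
pose b := beta / n%:R.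
have b0' : 0 <= b by rewrite divr_ge0 // ltW.
have bn : b * n%:R = beta by rewrite /b divfK // gt_eqF.
pose N : R := #|E|%:R.
have nr : n.-1%:R = n%:R - 1 :> R by rewrite -subn1 natrB // (leq_trans _ n4).
have NE : 2 * N = n%:R * (n%:R - 1).
  by rewrite -nr -!natrM (card_edges_inc Einc).
have N3 : 3 <= N by nra.
pose h := b * (4 * (2 * mm + 1)).
pose M := b * (8 * (N * (2 * p * (1 - p) * n%:R + mm + 2))).
pose gap := N * (2^-1 - h / 2) - M / 4.
have h0 : 0 <= h by rewrite mulr_ge0 //; lra.
have M0 : 0 <= M.
  rewrite mulr_ge0 // mulr_ge0 // mulr_ge0 ?addr_ge0 ?mulr_ge0 //; lra.
have bmm : b * mm = beta * eta ^+ 2 / 6 by rewrite /mm -bn; field.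
have beta_eta : beta * eta <= 4^-1.
  apply: (le_trans (ler_wpM2r (ltW eta0) bB)).
  by rewrite le_eqVlt; apply/orP; left; apply/eqP; field; rewrite gt_eqF.
have bmm24 : b * mm <= eta / 24.
  rewrite bmm; have -> : beta * eta ^+ 2 / 6 = (beta * eta) * eta / 6 by ring.
  by have := ler_wpM2r (ltW eta0) beta_eta; lra.
have b24 : b <= eta / 24.
  by apply: (le_trans _ bmm24); rewrite -[leLHS]mulr1 ler_wpM2l.
have gapE : gap = N * (2^-1 - 4 * beta * p * (1 - p) - 6 * (b * mm) - 6 * b).
  by rewrite /gap /h /M -bn; field.
have gap_ge : eta / 2 * N <= gap.
  by rewrite gapE [leLHS]mulrC ler_wpM2l //; lra.
have gap_le : gap <= N / 2.
  have : 0 <= N * h by rewrite mulr_ge0 //; lra.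
  by rewrite /gap; lra.
have k1 : 1 <= k%:R :> R.
  have : 0 < k%:R :> R by rewrite kp mulr_gt0 // -/N; lra.
  by rewrite ltr0n ler1n.
have k2 : 1 <= N - k%:R.
  have kN : 0 < N - k%:R by rewrite kp -/N -[X in X - _]mulr1 -mulrBr mulr_gt0; lra.
  have kE : (k <= #|E|)%N by rewrite -(ler_nat R) -/N; lra.
  by move: kN; rewrite /N -natrB // ltr0n ler1n.
have gapD : gap < k%:R * (N - k%:R) by nra.
have gap0 : 0 < gap by apply: (lt_le_trans _ gap_ge); rewrite mulr_gt0; lra.
have := @kawasaki_poincare R E k H f _ gap m h M erefl erefl mE h0 gap0 gapD.
move=> PO; have {}PO := PO _ _.
set V := \sum_(x | has_size k x) _ * (f x - m) ^+ 2 in PO *.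
have V0 : 0 <= V by apply: sumr_ge0 => x _; rewrite mulr_ge0 ?expR_ge0 ?sqr_ge0.
set Dir := \sum_(x | has_size k x) \sum_(s | x s) _ in PO *.
have {PO} : gap * V <= 2^-1 * Dir.
  apply: PO => [z s t _ zs zt|x s t xk xs xt]; first by rewrite HE; exact: huber_energy_step.
  exact: (huber_energy_mixed HE Einc b0' mm1 p01 kp xk xs xt).
have := ler_wpM2r V0 gap_ge; rewrite -/N; lra.
Qed.

(* Conductances [w x * w y / (w x + w y)] increase with the weights, so lowering
   the weights to the truncated ones only lowers the Dirichlet form; the variance
   loses the configurations with a badly deviating degree. *)
Lemma weak_poincare (R : realType) (eta : R) : 0 < eta ->
  exists (C c : R) (n0 : nat), [/\ 0 < C, 0 < c &
   forall (n : nat) (E : finType) (inc : 'I_n -> E -> bool) (k : nat)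
     (p beta F : R) (f : {ffun E -> bool} -> R),
    (n0 <= n)%N -> incidence inc -> eta <= p -> p <= 1 - eta -> 0 <= beta ->
    beta + eta <= c_kaw p ->
    4 * beta * p * (1 - p) <= 2^-1 - eta -> k%:R = #|E|%:R * p ->
    (forall x, has_size k x -> `|f x| <= F) ->
    exists m : R, \sum_(x | has_size k x) expR (energy inc (beta / n%:R) p x) * (f x - m) ^+ 2 <=
    (eta * #|E|%:R)^-1 * \sum_(x | has_size k x) \sum_(s | x s) \sum_(t | ~~ x t)
      expR (energy inc (beta / n%:R) p x) *
      logistic (energy inc (beta / n%:R) p (exch x s t) - energy inc (beta / n%:R) p x) *
      (f (exch x s t) - f x) ^+ 2 +
    C * expR (- (c * n%:R)) * F ^+ 2 *
      \sum_(x | has_size k x) expR (energy inc (beta / n%:R) p x)].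
Proof.
move=> eta0.
have [n1 gap] := kawasaki_gap eta0.
(* The concentration estimate requires [eps <= 1]; as [eta <= 1/2], the minimum is the truncation
   level [eta ^+ 2 / 6]. *)
pose eps := Num.min (eta ^+ 2 / 6) 1.
have eps0 : 0 < eps by rewrite lt_min ltr01 divr_gt0 // exprn_gt0.
have eps1 : eps <= 1 by rewrite ge_min lexx orbT.
have [C [c [n2 [C0 c0 conc]]]] := gibbs_concentration eta0 eps0 eps1.
exists (4 * C), c, (n1 + n2 + 2)%N; split => //; first by rewrite mulr_gt0.
move=> n E inc k p beta F f nn Einc p1 p2 b0 bc b4 kp fF.
have nn1 : (n1 <= n)%N by apply: leq_trans nn; rewrite -addnA leq_addr.
have nn2 : (n2 <= n)%N by apply: leq_trans nn; rewrite addnAC leq_addl.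
have nn3 : (2 <= n)%N by apply: leq_trans nn; rewrite leq_addl.
have nR : 0 < n%:R :> R by rewrite ltr0n (leq_trans _ nn3).
have eta2 : eta <= 2^-1 by lra.
(* From [p (1 - p) >= eta / 2] and [4 beta p (1 - p) <= 1/2]. *)
have bB : beta <= (4 * eta)^-1.
  rewrite -[leRHS]mul1r ler_pdivlMr ?mulr_gt0 //.
  have pp : eta / 2 <= p * (1 - p) by nra.
  have := ler_wpM2l (mulr_ge0 (ltW (ltr0n R 4)) b0) pp; lra.
have {gap} := gap n E inc k p beta _ _ f nn1 Einc p1 p2 b0 bB b4 kp erefl erefl.
have epsE : eps = eta ^+ 2 / 6.
  have e1 : eta ^+ 2 <= 1 by nra.
  by rewrite /eps min_l //; lra.
rewrite -epsE; set H := huber_energy _ _ _ _; set m := _ / _ => gap.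
have {conc} := conc n E inc k p beta nn2 Einc p1 p2 b0 bB bc kp.
set q := energy inc (beta / n%:R) p => conc.
have b0' : 0 <= beta / n%:R by rewrite divr_ge0 // ltW.
have Hq x : H x <= q x by exact: huber_energy_le.
have N0 : 0 < eta * #|E|%:R.
  rewrite mulr_gt0 // ltr0n lt0n; apply/eqP => E0; move: (card_edges_inc Einc) nn3.
  by rewrite E0 muln0; case: (n) => [|[|j]].
(* The mean of the truncated measure rather than of the Gibbs measure: centring at any constant
   bounds the variance from above. *)
exists m.
have ZH0 : 0 <= \sum_(x | has_size k x) expR (H x) by apply: sumr_ge0 => x _; exact: expR_ge0.
have F0 (x : {ffun E -> bool}) : has_size k x -> 0 <= F by move=> /fF; apply: le_trans.
have mF (x : {ffun E -> bool}) : has_size k x -> `|m| <= F.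
  move=> xk; have Z0 : 0 < \sum_(x | has_size k x) expR (H x).
    by apply: (sumr_gt0_in xk) => y _; exact: expR_gt0.
  rewrite /m normrM normfV (gtr0_norm Z0) ler_pdivrMr // mulr_sumr.
  apply: ler_norm_sum_le => y yk; rewrite normrM gtr0_norm ?expR_gt0 // mulrC.
  by rewrite ler_wpM2r ?expR_ge0 // fF.
set bad := fun x => [exists v, eps * n%:R < `|degree_dev inc p x v|].
have split_w : \sum_(x | has_size k x) expR (q x) * (f x - m) ^+ 2 <=
    \sum_(x | has_size k x) expR (H x) * (f x - m) ^+ 2 +
    \sum_(x | has_size k x && bad x) expR (q x) * (4 * F ^+ 2).
  rewrite [X in _ <= _ + X]big_mkcondr -big_split /=; apply: ler_sum => x xk.
  case: ifPn => [_|good]; last by rewrite addr0 /H huber_energy_eq.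
  rewrite -[leLHS]add0r; apply: lerD; first by rewrite mulr_ge0 ?expR_ge0 // sqr_ge0.
  apply: ler_wpM2l; first exact: expR_ge0.
  have fm : `|f x - m| <= 2 * F.
    apply: le_trans (ler_normB _ _) _.
    by rewrite mulr_natl mulr2n lerD ?fF ?(mF x).
  have -> : 4 * F ^+ 2 = (2 * F) ^+ 2 by ring.
  by rewrite -[leLHS]real_normK ?num_real // lerXn2r ?nnegrE // mulr_ge0 // (F0 x).
apply: (le_trans split_w); apply: lerD.
  rewrite [leRHS]mulrC ler_pdivlMr // mulrC; apply: (le_trans gap).
  apply: ler_sum => x xk; apply: ler_sum => s _; apply: ler_sum => t _.
  by rewrite ler_wpM2r ?sqr_ge0 //; exact: conductance_mono.
rewrite -mulr_suml.
have := ler_wpM2r (mulr_ge0 (ltW (ltr0n R 4)) (sqr_ge0 F)) conc.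
move/le_trans; apply; rewrite le_eqVlt; apply/orP; left; apply/eqP; ring.
Qed.

(** * Identification with the Kawasaki chain on [Omega n k] *)

Definition edge_inc (n : nat) (v : 'I_n) (e : edge n) : bool := v \in val e.

Lemma edge_incidence (n : nat) : incidence (@edge_inc n).
Proof.
split => [e|u v uv].
  by rewrite -big_mkcond sum1_card; apply/eqP/(valP e).
have c2 : #|[set u; v]%SET| == 2%N by rewrite cards2 uv.
pose e0 : edge n := exist (fun e : {set 'I_n} => #|e| == 2%N) _ c2.
rewrite /edge_inc (bigD1 e0) //= !inE !eqxx orbT /= big1 // => e ne.
apply/eqP; rewrite eqb0; apply: contra ne => /andP[ue ve].
apply/eqP/val_inj => /=; apply/esym/eqP; rewrite eqEcard (eqP c2) (eqP (valP e)) andbT.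
by apply/fintype.subsetP => w; rewrite !inE => /orP[] /eqP ->.
Qed.

Lemma deg_degree (n : nat) (x : graph n) (v : 'I_n) : deg x v = degree (@edge_inc n) x v.
Proof.
by rewrite /deg -sum1dep_card big_mkcond; apply: eq_bigr => e _; case: (x e && _).
Qed.

Lemma swap_exch (n : nat) (x : graph n) (s t : edge n) : swap x s t = exch x s t.
Proof. by apply/ffunP => e; rewrite !ffunE. Qed.

Lemma Omega_has_size (n k : nat) (x : Omega n k) : has_size k (val x).
Proof. exact: (valP x). Qed.

Lemma sum_Omega (R : realType) (n k : nat) (F : {ffun edge n -> bool} -> R) :
  \sum_(x : Omega n k) F (val x) = \sum_(x | has_size k x) F x.
Proof.
rewrite [RHS](reindex_omap (val : Omega n k -> graph n) insub) /=.
  by apply: eq_bigl => x; rewrite Omega_has_size valK eqxx.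
by move=> x xk; rewrite insubT.
Qed.

Lemma exch_inj (E : finType) (x : {ffun E -> bool}) (s t s' t' : E) :
  x s -> ~~ x t -> x s' -> ~~ x t' -> exch x s t = exch x s' t' -> s = s' /\ t = t'.
Proof.
move=> xs xt xs' xt' /ffunP h; split.
  have := h s; rewrite exch_at1 exchE xs; case: eqVneq => // _.
  by case: ifP.
have := h t; rewrite exch_at2 ?(exch_neq xs xt) // exchE (negbTE xt).
by case: ifP => // _; case: eqVneq.
Qed.

(** Distinct pairs [(s, t)] lead to distinct configurations, so each neighbour comes from exactly
    one exchange. *)
Lemma sum_neighbors (R : realType) (n k : nat) (x : graph n) (G : {ffun edge n -> bool} -> R) :
  has_size k x -> \sum_(y : Omega n k | swap_neighbor x (val y)) G (val y) =
    \sum_(s | x s) \sum_(t | ~~ x t) G (exch x s t).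
Proof.
move=> xk; rewrite big_mkcond (sum_Omega k (fun y => if swap_neighbor x y then G y else 0)).
rewrite -big_mkcondr pair_big_dep /=.
pose A : {set edge n * edge n} := [set a | x a.1 && ~~ x a.2]%SET.
pose h (a : edge n * edge n) := exch x a.1 a.2.
transitivity (\sum_(a in A) G (h a)); last by apply: eq_bigl => a; rewrite inE.
have hinj : {in A &, injective h}.
  move=> [s t] [s' t']; rewrite !inE /= => /andP[xs xt] /andP[xs' xt'] e.
  by have [-> ->] := exch_inj xs xt xs' xt' e.
rewrite -(big_imset G hinj); apply: eq_bigl => y; apply/andP/imsetP => [[yk]|[[s t]]].
  case/existsP => s /existsP[t /and3P[xs xt /eqP yE]].
  by exists (s, t); rewrite ?inE /= ?xs // /h /= yE swap_exch.
rewrite inE /= => /andP[xs xt] ->; split; first by rewrite has_size_exch.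
by apply/existsP; exists s; apply/existsP; exists t; rewrite xs xt swap_exch eqxx.
Qed.

(** Twice ['C(d, 2)] is [d ^+ 2 - d]. Around [(n - 1) p], the linear terms sum to constants because
    the degrees of a configuration of size [k] sum to [2 * k]. *)
Lemma hamiltonian_energy (R : realType) (n k : nat) (beta p : R) (x : graph n) :
  k%:R = #|{: edge n}|%:R * p -> has_size k x ->
  hamiltonian beta x = energy (@edge_inc n) (beta / n%:R) p x +
    beta / n%:R * (n%:R * (n.-1%:R * p) ^+ 2 - 2 * k%:R).
Proof.
move=> kp xk; set d0 := n.-1%:R * p.
have Einc := @edge_incidence n.
have sz := sum_degree_dev Einc kp xk.
have sd : \sum_v (degree (@edge_inc n) x v)%:R = 2 * k%:R :> R.
  by rewrite -natr_sum (sum_degree Einc xk) natrM.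
have S : 2 * \sum_(v < n) 'C(deg x v, 2)%:R =
    \sum_v degree_dev (@edge_inc n) p x v ^+ 2 + (n%:R * d0 ^+ 2 - 2 * k%:R).
  transitivity (\sum_v (degree_dev (@edge_inc n) p x v ^+ 2 + (2 * d0 * degree_dev (@edge_inc n) p x v) +
      d0 ^+ 2 - (degree (@edge_inc n) x v)%:R)).
    rewrite mulr_sumr; apply: eq_bigr => v _; rewrite deg_degree.
    set d := degree _ _ _.
    have -> : 2 * 'C(d, 2)%:R = d%:R * (d%:R - 1) :> R.
      have := mul_bin_left d 1; rewrite bin1 => /(congr1 (GRing.natmul (1 : R))).
      rewrite !natrM => ->; case: d => [|d]; first by rewrite sub0n !mul0r.
      by rewrite subn1 /= -natr1 addrK mulrC.
    by rewrite /degree_dev -/d -/d0; ring.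
  rewrite sumrB !big_split /= -mulr_sumr sz sd sumr_const card_ord -mulr_natl.
  ring.
transitivity (beta / n%:R * (2 * \sum_(v < n) 'C(deg x v, 2)%:R)).
  by rewrite /hamiltonian; ring.
by rewrite S /energy mulrDr.
Qed.

Lemma gibbs_energy (R : realType) (n k : nat) (beta p : R) (x : Omega n k) :
  k%:R = #|{: edge n}|%:R * p ->
  gibbs beta x = expR (energy (@edge_inc n) (beta / n%:R) p (val x)) /
    \sum_(y | has_size k y) expR (energy (@edge_inc n) (beta / n%:R) p y).
Proof.
move=> kp; rewrite /gibbs.
set c := beta / n%:R * (n%:R * (n.-1%:R * p) ^+ 2 - 2 * k%:R).
set q := energy _ _ _.
have hE (y : Omega n k) : expR (hamiltonian beta (val y)) = expR (q (val y)) * expR c.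
  by rewrite (hamiltonian_energy beta kp (Omega_has_size y)) expRD.
under eq_bigr do rewrite hE.
rewrite hE -mulr_suml (sum_Omega k (fun y => expR (q y))).
have := expR_gt0 c; move: (expR c) => C C0.
by rewrite invfM mulrACA divff ?mulr1 // gt_eqF.
Qed.

Lemma dirichlet_energy (R : realType) (n k : nat) (beta p : R) (q g : {ffun edge n -> bool} -> R)
    (f : Omega n k -> R) :
  k%:R = #|{: edge n}|%:R * p -> q = energy (@edge_inc n) (beta / n%:R) p ->
  (forall x, f x = g (val x)) ->
  dirichlet (@gibbs R n k beta) (@kawasaki R n k beta) f =
  (2 * (k%:R * (#|{: edge n}|%:R - k%:R)) * \sum_(y | has_size k y) expR (q y))^-1 *
  \sum_(x | has_size k x) \sum_(s | x s) \sum_(t | ~~ x t)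
    expR (q x) * logistic (q (exch x s t) - q x) * (g (exch x s t) - g x) ^+ 2.
Proof.
move=> kp qE fg; set Z := \sum_(y | has_size k y) expR (q y).
pose D : R := k%:R * (#|{: edge n}|%:R - k%:R); rewrite -/D.
have gE (x : Omega n k) : gibbs beta x = expR (q (val x)) / Z.
  by rewrite (gibbs_energy beta x kp) -qE.
rewrite -(sum_Omega k (fun x => \sum_(s | x s) \sum_(t | ~~ x t)
    expR (q x) * logistic (q (exch x s t) - q x) * (g (exch x s t) - g x) ^+ 2)).
rewrite /dirichlet [2 * D]mulrC -mulrA mulrCA invfM -mulrA; congr (_ * _).
rewrite mulr_sumr; apply: eq_bigr => x _.
rewrite -(sum_neighbors (fun y => expR (q (val x)) * logistic (q y - q (val x)) *
   (g y - g (val x)) ^+ 2) (Omega_has_size x)).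
rewrite mulr_sumr [RHS]big_mkcond; apply: eq_bigr => y _.
have Z0 : Z != 0.
  by rewrite gt_eqF // (sumr_gt0_in (Omega_has_size x)) // => z _; exact: expR_gt0.
(* The diagonal entry of the kernel meets a zero increment of [f]. *)
have koff : gibbs beta x * kawasaki beta x y * (f y - f x) ^+ 2 =
   gibbs beta x * kawasaki_off beta x y * (f y - f x) ^+ 2.
  rewrite /kawasaki; case: eqVneq => // ->.
  by rewrite subrr expr0n /= !mulr0.
rewrite koff /kawasaki_off; case: ifP => // _; last by rewrite mulr0 mul0r.
rewrite !gE !fg -card_edge -/D -logistic_expR.
have := expR_gt0 (q (val x)); have := expR_gt0 (q (val y)).
move: (expR _) (expR _) => u v u0 v0.
(* In the degenerate case both sides vanish, the inverse of 0 being 0. *)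
have [->|Dn] := eqVneq D 0; first by rewrite !(invr0, mul0r, mulr0).
by field; rewrite Z0 Dn !gt_eqF //; lra.
Qed.

(** The mean minimises the quadratic deviation. Here [m] will be the mean of the truncated
    measure. *)
Lemma var_le (R : realType) (T : finType) (mu f : T -> R) (m : R) :
  \sum_x mu x = 1 -> var mu f <= \sum_x mu x * (f x - m) ^+ 2.
Proof.
move=> mu1; rewrite /var; set a := mean mu f; rewrite /mean.
have -> : \sum_x mu x * (f x - m) ^+ 2 =
    \sum_x mu x * (f x - a) ^+ 2 + (2 * (a - m) * (\sum_x mu x * f x - a * \sum_x mu x) +
      (a - m) ^+ 2 * \sum_x mu x).
  rewrite !mulr_sumr -sumrB mulr_sumr -!big_split /=.
  by apply: eq_bigr => x _; ring.
by rewrite mu1 mulr1 -/(mean mu f) -/a subrr mulr0 add0r mulr1 lerDl sqr_ge0.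
Qed.

Lemma le_sup_norm (R : realType) (T : Type) (f : T -> R) (M : R) (x : T) :
  (forall y, `|f y| <= M) -> `|f x| <= sup_norm f.
Proof.
move=> fM; apply: sup_upper_bound; last by exists x.
by split; [exists `|f x|, x | exists M => _ [y _ <-]].
Qed.

Theorem corollary2p1 (R : realType) (B : set (R * R))
    (hBcompact : compact B) (hBsub : B `<=` @R_kaw R) :
  exists (C c : R) (n0 : nat), 0 < c /\
    forall (p beta : R), B (p, beta) ->
    forall (n k : nat), (n0 <= n)%N -> k%:R = (nb_edges n)%:R * p ->
    forall f : Omega n k -> R, (exists M : R, forall x, `|f x| <= M) ->
      var (@gibbs R n k beta) f
      <= C * n%:R ^+ 2 * dirichlet (@gibbs R n k beta) (@kawasaki R n k beta) f
         + C * expR (- (c * n%:R)) * sup_norm f ^+ 2.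
Proof.
have [eta [eta0 marg]] := compact_margin hBcompact hBsub.
have [C [c [n0 [C0 c0 wp]]]] := weak_poincare eta0.
exists (C + eta^-1), c, (n0 + 2)%N; split=> // p beta /marg [p1 p2 b0 bc b4] n k nn kp f [M fM].
have nn0 : (n0 <= n)%N by apply: leq_trans nn; exact: leq_addr.
have nn2 : (2 <= n)%N by apply: leq_trans nn; exact: leq_addl.
have eta2 : eta <= 2^-1 by lra.
(* The extension of [f] by 0, as the weak Poincare inequality is stated for functions of all
   configurations. *)
pose g (x : {ffun edge n -> bool}) : R := if insub x is Some o then f (o : Omega n k) else 0.
have fg x : f x = g (val x) by rewrite /g valK.
have kp' : k%:R = #|{: edge n}|%:R * p by rewrite card_edge.
have gF x : has_size k x -> `|g x| <= sup_norm f.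
  move=> xk; have -> : x = val (exist _ x xk : Omega n k) by [].
  by rewrite -fg; exact: le_sup_norm fM.
have [m] := wp n (edge n) (@edge_inc n) k p beta (sup_norm f) g nn0 (@edge_incidence n)
  p1 p2 b0 bc b4 kp' gF.
have := dirichlet_energy kp' erefl fg.
set q := energy _ _ _; set Z := \sum_(y | has_size k y) expR (q y).
set Dir := \sum_(x | has_size k x) \sum_(s | x s) _.
set V := \sum_(x | has_size k x) _ => dirE VE.
have Dir0 : 0 <= Dir.
  apply: sumr_ge0 => x _; apply: sumr_ge0 => s _; apply: sumr_ge0 => t _.
  by rewrite mulr_ge0 ?sqr_ge0 // mulr_ge0 ?expR_ge0 // ltW // logistic_gt0.
have Cge : 0 <= C + eta^-1 by rewrite addr_ge0 ?invr_ge0 // ltW.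
pose N : R := #|{: edge n}|%:R.
have nR : 2 <= n%:R :> R by rewrite ler_nat.
have nr : n.-1%:R = n%:R - 1 :> R by rewrite -subn1 natrB // ltnW.
have NE : 2 * N = n%:R * (n%:R - 1).
  by rewrite -nr -!natrM (card_edges_inc (@edge_incidence n)).
have N0 : 0 < N by nra.
pose D : R := k%:R * (N - k%:R).
have DE : D = N * (N * (p * (1 - p))) by rewrite /D kp' -/N; ring.
have pq : 0 < p * (1 - p) by rewrite mulr_gt0; lra.
have D0 : 0 < D by rewrite DE; exact: mulr_gt0 N0 (mulr_gt0 N0 pq).
have Zge : 0 <= Z by apply: sumr_ge0 => x _; exact: expR_ge0.
set d := dirichlet _ _ _.
have d0 : 0 <= d.
  rewrite /d dirE -/N -/D mulr_ge0 // invr_ge0 mulr_ge0 //.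
  exact: mulr_ge0 (ler0n _ 2) (ltW D0).
(* Without configurations the variance is an empty sum, and the right-hand side is nonnegative. *)
have [x0 xk0|no] := pickP (@has_size (edge n) k); last first.
  have -> : var (@gibbs R n k beta) f = 0.
    by rewrite /var /mean big1 // => x; have := Omega_has_size x; rewrite no.
  apply: addr_ge0; apply: mulr_ge0 => //; last exact: sqr_ge0.
    by apply: mulr_ge0 => //; exact: sqr_ge0.
  by apply: mulr_ge0 => //; exact: expR_ge0.
have Z0 : 0 < Z by apply: (sumr_gt0_in xk0) => y _; exact: expR_gt0.
have muE (x : Omega n k) : gibbs beta x = expR (q (val x)) / Z by rewrite (gibbs_energy beta x kp').
have mu1 : \sum_x gibbs beta (x : Omega n k) = 1 :> R.
  under eq_bigr do rewrite muE.
  by rewrite -mulr_suml (sum_Omega k (fun x => expR (q x))) divff // gt_eqF.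
apply: le_trans (var_le f m mu1) _.
have -> : \sum_x gibbs beta x * (f x - m) ^+ 2 = V / Z.
  under eq_bigr do rewrite muE fg mulrAC.
  rewrite -mulr_suml; congr (_ / _).
  exact: (sum_Omega k (fun x => expR (q x) * (g x - m) ^+ 2)).
rewrite ler_pdivrMr //; apply: (le_trans VE).
have nz : 2 * D * Z != 0 by rewrite gt_eqF // mulr_gt0 // mulr_gt0.
have DirE : Dir = 2 * D * Z * d by rewrite /d dirE -/N -/D mulrA divff ?mul1r.
rewrite DirE -/N [leRHS]mulrDl; apply: lerD.
  (* Origin of [n ^ 2]: [2 * D = 2 N^2 p (1 - p)] divided by [eta * N] leaves [2 N p (1 - p) / eta],
     and [2 N <= n^2]. *)
  have -> : (eta * N)^-1 * (2 * D * Z * d) = (eta^-1 * (2 * N * (p * (1 - p)))) * d * Z.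
    by rewrite DE; field; rewrite !gt_eqF.
  rewrite ler_wpM2r ?(ltW Z0) // ler_wpM2r //.
  apply: (@le_trans _ _ (eta^-1 * n%:R ^+ 2)).
    rewrite ler_wpM2l ?invr_ge0 ?(ltW eta0) // NE.
    have : p * (1 - p) <= 1 by nra.
    by move: (p * (1 - p)) pq => r r0 r1; nra.
  by rewrite ler_wpM2r ?sqr_ge0 // lerDr ltW.
rewrite ler_wpM2r ?(ltW Z0) // ler_wpM2r ?sqr_ge0 // ler_wpM2r ?expR_ge0 //.
by rewrite lerDl invr_ge0 ltW.
Qed.
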